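(* Let $\mathcal C$ be a weakly-integral modular fusion category (over $\mathbb C$) with $\mathrm{FPdim}(\mathcal C)=dm$, where $d$ is a square-free positive integer coprime with $m$ and coprime with $\mathrm{FPdim}(X)^2$ for every simple object $X$ of $\mathcal C$. Then $d\mid\mathrm{FPdim}(\mathcal C_{pt})$ and $\mathcal C$ admits a decomposition $$\mathcal C\simeq\mathcal D\boxtimes\mathcal D',$$ where $\mathcal D$ is a pointed modular fusion category of dimension $d$ and $\mathcal D'$ is a modular fusion category of dimension $m$.
   Context: $\mathrm{FPdim}$ is the Frobenius–Perron dimension; weakly-integral means $\mathrm{FPdim}(\mathcal C)\in\mathbb Z$ (then $\mathrm{FPdim}(X)^2\in\mathbb Z$ for every simple object $X$). $\mathcal C_{pt}$ is the maximal pointed fusion subcategory, generated by the invertible simple objects; pointed means all simple objects are invertible. $\boxtimes$ is the Deligne tensor product, and $\simeq$ is equivalence of braided fusion categories. *)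

(* Defs.v *)
From mathcomp Require Import all_boot all_order all_algebra.
From mathcomp Require Import boolp classical_sets reals.
From mathcomp Require Import complex.

Set Implicit Arguments.
Unset Strict Implicit.
Unset Printing Implicit Defensive.

Import Order.TTheory GRing.Theory Num.Theory.

Local Open Scope ring_scope.

Declare Scope lincat_scope.
Delimit Scope lincat_scope with lincat.
Local Open Scope lincat_scope.

Record lin_cat (K : fieldType) := LinCat {
  obj :> Type;
  hom : obj -> obj -> lmodType K;
  idm : forall X, hom X X;
  hcomp : forall X Y Z, hom Y Z -> hom X Y -> hom X Z;
  hcompA : forall W X Y Z (h : hom Y Z) (g : hom X Y) (f : hom W X),
    hcomp h (hcomp g f) = hcomp (hcomp h g) f;
  hcomp1m : forall X Y (f : hom X Y), hcomp (idm Y) f = f;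
  hcompm1 : forall X Y (f : hom X Y), hcomp f (idm X) = f;
  hcomp_linearl : forall X Y Z (f : hom X Y),
    linear (fun g : hom Y Z => hcomp g f);
  hcomp_linearr : forall X Y Z (g : hom Y Z),
    linear (fun f : hom X Y => hcomp g f)
}.

Arguments idm {K l} X.
Notation "g \oc f" := (hcomp g f)
  (at level 50, left associativity) : lincat_scope.

Section LinCatTheory.
Context {K : fieldType} {C : lin_cat K}.
Implicit Types X Y Z : C.

Definition inverse X Y (f : hom X Y) (g : hom Y X) : Prop :=
  g \oc f = idm X /\ f \oc g = idm Y.

Definition is_iso X Y (f : hom X Y) : Prop := exists g, inverse f g.

Definition isomorphic X Y : Prop := exists f : hom X Y, is_iso f.

Definition is_zero X : Prop :=
  forall Y, (forall f : hom X Y, f = 0) /\ (forall f : hom Y X, f = 0).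

Definition mono X Y (f : hom X Y) : Prop :=
  forall W (g h : hom W X), f \oc g = f \oc h -> g = h.

Definition epi X Y (f : hom X Y) : Prop :=
  forall Z (g h : hom Y Z), g \oc f = h \oc f -> g = h.

Definition is_kernel X Y (f : hom X Y) Z (k : hom Z X) : Prop :=
  f \oc k = 0 /\
  forall W (g : hom W X), f \oc g = 0 -> exists! h : hom W Z, k \oc h = g.

Definition is_cokernel X Y (f : hom X Y) Z (q : hom Y Z) : Prop :=
  q \oc f = 0 /\
  forall W (g : hom Y W), g \oc f = 0 -> exists! h : hom Z W, h \oc q = g.

Definition is_biproduct n (X : 'I_n -> C) (S : C) : Prop :=
  exists (i : forall k, hom (X k) S) (p : forall k, hom S (X k)),
    [/\ forall k, p k \oc i k = idm (X k),
        forall k l, k != l -> p k \oc i l = 0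
      & \sum_(k < n) (i k \oc p k) = idm S].

Definition simple X : Prop :=
  ~ is_zero X /\
  forall Y (f : hom Y X), mono f -> is_zero Y \/ is_iso f.

End LinCatTheory.

Section LinCatProperties.
Context {K : fieldType}.

(* The empty biproduct is a zero object. *)
Definition abelian (C : lin_cat K) : Prop :=
  [/\ forall n (X : 'I_n -> C), exists S, is_biproduct X S,
      forall (X Y : C) (f : hom X Y), exists Z (k : hom Z X), is_kernel f k,
      forall (X Y : C) (f : hom X Y), exists Z (q : hom Y Z), is_cokernel f q,
      forall (X Y : C) (f : hom X Y),
        mono f -> exists Z (g : hom Y Z), is_kernel g f
    & forall (X Y : C) (f : hom X Y),
        epi f -> exists Z (g : hom Z X), is_cokernel g f].

Definition semisimple (C : lin_cat K) : Prop :=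
  forall X : C, exists n (S : 'I_n -> C),
    (forall k, simple (S k)) /\ is_biproduct S X.

Definition has_dim (V : lmodType K) (n : nat) : Prop :=
  exists b : 'I_n -> V, forall v : V,
    exists! c : 'rV[K]_n, v = \sum_(i < n) c 0 i *: b i.

Definition fdim (V : lmodType K) : nat := xget 0%N [set n | has_dim V n].

Definition hom_finite (C : lin_cat K) : Prop :=
  forall X Y : C, exists n, has_dim (hom X Y) n.

End LinCatProperties.

Record lin_functor (K : fieldType) (C D : lin_cat K) := LinFunctor {
  fobj :> C -> D;
  fmap : forall X Y : C, hom X Y -> hom (fobj X) (fobj Y);
  fmap1 : forall X, fmap (idm X) = idm (fobj X);
  fmapM : forall (X Y Z : C) (g : hom Y Z) (f : hom X Y),
    fmap (g \oc f) = fmap g \oc fmap f;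
  fmap_linear : forall X Y : C, linear (@fmap X Y)
}.

Record bifunctor (K : fieldType) (C D E : lin_cat K) := Bifunctor {
  bobj :> C -> D -> E;
  bmap : forall (X X' : C) (Y Y' : D),
    hom X X' -> hom Y Y' -> hom (bobj X Y) (bobj X' Y');
  bmap1 : forall X Y, bmap (idm X) (idm Y) = idm (bobj X Y);
  bmapM : forall (X X' X'' : C) (Y Y' Y'' : D)
      (f' : hom X' X'') (f : hom X X') (g' : hom Y' Y'') (g : hom Y Y'),
    bmap (f' \oc f) (g' \oc g) = bmap f' g' \oc bmap f g;
  bmap_linearl : forall (X X' : C) (Y Y' : D) (g : hom Y Y'),
    linear (fun f : hom X X' => bmap f g);
  bmap_linearr : forall (X X' : C) (Y Y' : D) (f : hom X X'),
    linear (fun g : hom Y Y' => bmap f g)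
}.

Section Exactness.
Context {K : fieldType}.

Definition right_exact (C D : lin_cat K) (F : lin_functor C D) : Prop :=
  forall (X Y Z : C) (f : hom X Y) (q : hom Y Z),
    is_cokernel f q -> is_cokernel (fmap F f) (fmap F q).

Definition biright_exact (C D E : lin_cat K) (T : bifunctor C D E) : Prop :=
  (forall (Y : D) (X X' X'' : C) (f : hom X X') (q : hom X' X''),
     is_cokernel f q ->
     is_cokernel (bmap T f (idm Y)) (bmap T q (idm Y))) /\
  (forall (X : C) (Y Y' Y'' : D) (g : hom Y Y') (q : hom Y' Y''),
     is_cokernel g q ->
     is_cokernel (bmap T (idm X) g) (bmap T (idm X) q)).

(* T : D x D' -> P exhibits P as the Deligne tensor product of D and D': for
   every linear abelian category A, restriction along T is an equivalence from
   right exact functors P -> A to bilinear bifunctors D x D' -> A that are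
   right exact in each variable (essentially surjective, then fully
   faithful). *)
Definition deligne_universal (D D' P : lin_cat K) (T : bifunctor D D' P)
    : Prop :=
  biright_exact T /\
  forall A : lin_cat K, abelian A ->
    (forall F : bifunctor D D' A, biright_exact F ->
       exists G : lin_functor P A, right_exact G /\
       exists a : forall X Y, hom (G (T X Y)) (F X Y),
         (forall X Y, is_iso (a X Y)) /\
         forall (X X' : D) (Y Y' : D') (f : hom X X') (g : hom Y Y'),
           a X' Y' \oc fmap G (bmap T f g) = bmap F f g \oc a X Y) /\
    (forall G G' : lin_functor P A, right_exact G -> right_exact G' ->
       forall a : forall X Y, hom (G (T X Y)) (G' (T X Y)),
       (forall (X X' : D) (Y Y' : D') (f : hom X X') (g : hom Y Y'),
          a X' Y' \oc fmap G (bmap T f g) = fmap G' (bmap T f g) \oc a X Y) ->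
       exists! b : forall Z, hom (G Z) (G' Z),
         (forall (Z Z' : P) (f : hom Z Z'),
            b Z' \oc fmap G f = fmap G' f \oc b Z) /\
         forall X Y, b (T X Y) = a X Y).

End Exactness.

Record monoidal (K : fieldType) := Monoidal {
  mcat :> lin_cat K;
  tens : bifunctor mcat mcat mcat;
  munit : mcat;
  assoc : forall X Y Z, hom (tens (tens X Y) Z) (tens X (tens Y Z));
  associ : forall X Y Z, hom (tens X (tens Y Z)) (tens (tens X Y) Z);
  lunit : forall X, hom (tens munit X) X;
  luniti : forall X, hom X (tens munit X);
  runit : forall X, hom (tens X munit) X;
  runiti : forall X, hom X (tens X munit);
  assocK : forall X Y Z, inverse (assoc X Y Z) (associ X Y Z);
  lunitK : forall X, inverse (lunit X) (luniti X);
  runitK : forall X, inverse (runit X) (runiti X);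
  assoc_nat : forall (X X' Y Y' Z Z' : mcat)
      (f : hom X X') (g : hom Y Y') (h : hom Z Z'),
    assoc X' Y' Z' \oc bmap tens (bmap tens f g) h =
    bmap tens f (bmap tens g h) \oc assoc X Y Z;
  lunit_nat : forall (X X' : mcat) (f : hom X X'),
    lunit X' \oc bmap tens (idm munit) f = f \oc lunit X;
  runit_nat : forall (X X' : mcat) (f : hom X X'),
    runit X' \oc bmap tens f (idm munit) = f \oc runit X;
  pentagon : forall W X Y Z,
    assoc W X (tens Y Z) \oc assoc (tens W X) Y Z =
    bmap tens (idm W) (assoc X Y Z) \oc assoc W (tens X Y) Z
      \oc bmap tens (assoc W X Y) (idm Z);
  triangle : forall X Y,
    bmap tens (idm X) (lunit Y) \oc assoc X munit Y =
    bmap tens (runit X) (idm Y)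
}.

Arguments munit {K m}.
Notation "X \ot Y" := (tens _ X Y)
  (at level 40, left associativity) : lincat_scope.
Notation "f \otm g" := (bmap (tens _) f g)
  (at level 40, left associativity) : lincat_scope.

Definition is_left_dual (K : fieldType) (C : monoidal K) (X Xs : C)
    (ev : hom (Xs \ot X) munit) (coev : hom munit (X \ot Xs)) : Prop :=
  runit X \oc (idm X \otm ev) \oc assoc X Xs X \oc (coev \otm idm X)
    \oc luniti X = idm X /\
  lunit Xs \oc (ev \otm idm Xs) \oc associ Xs X Xs \oc (idm Xs \otm coev)
    \oc runiti Xs = idm Xs.

(* Dual objects and representatives of the isomorphism classes of simple
   objects are chosen once and for all. *)
Record fusion (K : fieldType) := Fusion {
  fmon :> monoidal K;
  fus_abelian : abelian fmon;
  fus_semisimple : semisimple fmon;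
  fus_hom_finite : hom_finite fmon;
  fus_one_simple : simple (munit : fmon);
  rank : nat;
  irr : 'I_rank -> fmon;
  irr_simple : forall i, simple (irr i);
  irr_inj : forall i j, isomorphic (irr i) (irr j) -> i = j;
  irr_surj : forall X : fmon, simple X -> exists i, isomorphic X (irr i);
  ldual : fmon -> fmon;
  ldual_ev : forall X, hom (ldual X \ot X) munit;
  ldual_coev : forall X, hom munit (X \ot ldual X);
  ldualP : forall X, is_left_dual (ldual_ev X) (ldual_coev X);
  rdual : fmon -> fmon;
  rdual_ev : forall X, hom (X \ot rdual X) munit;
  rdual_coev : forall X, hom munit (rdual X \ot X);
  rdualP : forall X, is_left_dual (rdual_ev X) (rdual_coev X)
}.

Arguments irr {K} f i.

Section FusionTheory.
Context {K : fieldType}.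

Definition invertible (C : fusion K) (X : C) : Prop :=
  is_iso (ldual_ev X) /\ is_iso (ldual_coev X).

Definition pointed (C : fusion K) : Prop :=
  forall X : C, simple X -> invertible X.

(* E is the class of objects of a full, replete subcategory; closure under
   isomorphism is the case of a direct summand with trivial complement. *)
Definition fusion_subcat (C : fusion K) (E : C -> Prop) : Prop :=
  [/\ E munit,
      forall X Y, E X -> E Y -> E (X \ot Y),
      forall X, E X -> E (ldual X) /\ E (rdual X),
      forall n (X : 'I_n -> C) S,
        (forall k, E (X k)) -> is_biproduct X S -> E S
    & forall (X Y : C) (i : hom X Y) (p : hom Y X),
        p \oc i = idm X -> E Y -> E X].

Definition pt_subcat (C : fusion K) (X : C) : Prop :=
  forall E, fusion_subcat E ->
    (forall Y, simple Y -> invertible Y -> E Y) -> E X.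

(* For S simple and K algebraically closed, dim Hom(S, X) is the multiplicity
   of S in a decomposition of X into simple objects (Schur's lemma). *)
Definition mult (C : fusion K) (S X : C) : nat := fdim (hom S X).

(* The matrix of left multiplication by X in the Grothendieck ring. *)
Definition fusion_mx (R : realType) (C : fusion K) (X : C)
    : 'M[R]_(rank C) :=
  \matrix_(i, j) (mult (irr C j) (X \ot irr C i))%:R.

(* The set of eigenvalues is finite, and it has a nonnegative element by the
   Frobenius-Perron theorem, so the supremum is a maximum. *)
Definition FPdim (R : realType) (C : fusion K) (X : C) : R :=
  sup [set x : R | 0 <= x /\ eigenvalue (fusion_mx R X) x].

(* The Frobenius-Perron dimension of the fusion subcategory E; the dimension
   of an object of E is the same computed in E or in C. *)
Definition FPdim_sub (R : realType) (C : fusion K) (E : C -> Prop) : R :=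
  \sum_(i < rank C | `[< E (irr C i) >]) FPdim R (irr C i) ^+ 2.

Definition FPdim_cat (R : realType) (C : fusion K) : R :=
  \sum_(i < rank C) FPdim R (irr C i) ^+ 2.

Definition weakly_integral (R : realType) (C : fusion K) : Prop :=
  FPdim_cat R C \is a Num.int.

End FusionTheory.

Record braided_fusion (K : fieldType) := BraidedFusion {
  bfus :> fusion K;
  braid : forall X Y : bfus, hom (X \ot Y) (Y \ot X);
  braid_iso : forall X Y, is_iso (braid X Y);
  braid_nat : forall (X X' Y Y' : bfus) (f : hom X X') (g : hom Y Y'),
    braid X' Y' \oc (f \otm g) = (g \otm f) \oc braid X Y;
  hexagon1 : forall X Y Z : bfus,
    assoc Y Z X \oc braid X (Y \ot Z) \oc assoc X Y Z =
    (idm Y \otm braid X Z) \oc assoc Y X Z \oc (braid X Y \otm idm Z);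
  hexagon2 : forall X Y Z : bfus,
    associ Z X Y \oc braid (X \ot Y) Z \oc associ X Y Z =
    (braid X Z \otm idm Y) \oc associ X Z Y \oc (idm X \otm braid Y Z)
}.

Section Ribbon.
Context {K : fieldType} {C : braided_fusion K}.

Definition dual_mor (X Y : C) (f : hom X Y) : hom (ldual Y) (ldual X) :=
  lunit (ldual X) \oc (ldual_ev Y \otm idm (ldual X))
    \oc associ (ldual Y) Y (ldual X)
    \oc (idm (ldual Y) \otm (f \otm idm (ldual X)))
    \oc (idm (ldual Y) \otm ldual_coev X) \oc runiti (ldual Y).

(* The quantum trace for the spherical structure determined by the twist t,
   i.e. the Drinfeld isomorphism X -> X** precomposed with t. *)
Definition qtrace (t : forall X : C, hom X X) (X : C) (f : hom X X)
    : hom (munit : C) munit :=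
  ldual_ev X \oc braid X (ldual X) \oc ((t X \oc f) \otm idm (ldual X))
    \oc ldual_coev X.

(* Well defined over an algebraically closed K, where End(1) = K id_1. *)
Definition scalar_of (f : hom (munit : C) munit) : K :=
  xget 0 [set a : K | f = a *: idm munit].

Definition S_mx (t : forall X : C, hom X X) : 'M[K]_(rank C) :=
  \matrix_(i, j) scalar_of
    (qtrace t (braid (irr C j) (irr C i) \oc braid (irr C i) (irr C j))).

End Ribbon.

Record modular (K : fieldType) := Modular {
  mod_braided :> braided_fusion K;
  twist : forall X : mod_braided, hom X X;
  twist_iso : forall X, is_iso (twist X);
  twist_nat : forall (X Y : mod_braided) (f : hom X Y),
    twist Y \oc f = f \oc twist X;
  twist_tens : forall X Y : mod_braided,
    twist (X \ot Y) = (twist X \otm twist Y) \oc braid Y X \oc braid X Y;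
  twist_dual : forall X : mod_braided,
    twist (ldual X) = dual_mor (twist X);
  S_nondegenerate : S_mx twist \in unitmx
}.

Section BraidedEquivalence.
Context {K : fieldType}.

Definition is_equivalence (C D : lin_cat K) (F : lin_functor C D) : Prop :=
  (forall X Y : C, bijective (@fmap K C D F X Y)) /\
  (forall Z : D, exists X : C, isomorphic (F X) Z).

Definition is_braided_functor (C D : braided_fusion K) (F : lin_functor C D)
    (J : forall X Y : C, hom (F X \ot F Y) (F (X \ot Y)))
    (phi : hom munit (F munit)) : Prop :=
  [/\ (forall X Y, is_iso (J X Y)) /\ is_iso phi,
      forall (X X' Y Y' : C) (f : hom X X') (g : hom Y Y'),
        fmap F (f \otm g) \oc J X Y = J X' Y' \oc (fmap F f \otm fmap F g),
      forall X Y Z : C,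
        fmap F (assoc X Y Z) \oc J (X \ot Y) Z \oc (J X Y \otm idm (F Z)) =
        J X (Y \ot Z) \oc (idm (F X) \otm J Y Z) \oc assoc (F X) (F Y) (F Z),
      forall X : C,
        fmap F (lunit X) \oc J munit X \oc (phi \otm idm (F X)) = lunit (F X) /\
        fmap F (runit X) \oc J X munit \oc (idm (F X) \otm phi) = runit (F X)
    & forall X Y : C,
        fmap F (braid X Y) \oc J X Y = J Y X \oc braid (F X) (F Y)].

Definition braided_equivalent (C D : braided_fusion K) : Prop :=
  exists F : lin_functor C D, is_equivalence F /\
    exists J phi, @is_braided_functor C D F J phi.

(* J and phi make T : D x D' -> P a braided monoidal functor, for the
   componentwise tensor product, associativity, units and braiding on
   D x D'. *)
Definition is_braided_bifunctor (D D' P : braided_fusion K)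
    (T : bifunctor D D' P)
    (J : forall (X X' : D) (Y Y' : D'),
           hom (T X Y \ot T X' Y') (T (X \ot X') (Y \ot Y')))
    (phi : hom munit (T munit munit)) : Prop :=
  [/\ (forall X X' Y Y', is_iso (J X X' Y Y')) /\ is_iso phi,
      forall (X1 X2 X1' X2' : D) (Y1 Y2 Y1' Y2' : D')
          (f : hom X1 X2) (f' : hom X1' X2') (g : hom Y1 Y2)
          (g' : hom Y1' Y2'),
        bmap T (f \otm f') (g \otm g') \oc J X1 X1' Y1 Y1' =
        J X2 X2' Y2 Y2' \oc (bmap T f g \otm bmap T f' g'),
      forall (X1 X2 X3 : D) (Y1 Y2 Y3 : D'),
        bmap T (assoc X1 X2 X3) (assoc Y1 Y2 Y3)
          \oc J (X1 \ot X2) X3 (Y1 \ot Y2) Y3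
          \oc (J X1 X2 Y1 Y2 \otm idm (T X3 Y3)) =
        J X1 (X2 \ot X3) Y1 (Y2 \ot Y3)
          \oc (idm (T X1 Y1) \otm J X2 X3 Y2 Y3)
          \oc assoc (T X1 Y1) (T X2 Y2) (T X3 Y3),
      forall (X : D) (Y : D'),
        bmap T (lunit X) (lunit Y) \oc J munit X munit Y
          \oc (phi \otm idm (T X Y)) = lunit (T X Y) /\
        bmap T (runit X) (runit Y) \oc J X munit Y munit
          \oc (idm (T X Y) \otm phi) = runit (T X Y)
    & forall (X X' : D) (Y Y' : D'),
        bmap T (braid X X') (braid Y Y') \oc J X X' Y Y' =
        J X' X Y' Y \oc braid (T X Y) (T X' Y')].

(* The universal property and the structure (J, phi) on T determine P up to
   braided equivalence. *)
Definition is_deligne_product (D D' P : braided_fusion K) : Prop :=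
  exists T : bifunctor D D' P, deligne_universal T /\
    exists J phi, @is_braided_bifunctor D D' P T J phi.

End BraidedEquivalence.

Definition square_free (d : nat) : Prop :=
  forall p, prime p -> ~~ (p ^ 2 %| d)%N.

(* Main.v *)
(** The double braiding turns every simple object [X] of [C] into a character
   [chi_X] of the fusion ring, and these characters are distinct because the
   S-matrix is invertible.  Exactly one of them is positive; its values are the
   Frobenius-Perron dimensions.  Sums and products over the kernel of an integral
   matrix of the fusion ring are rational, whence [C] is pseudo-unitary and the
   squared dimensions [k_X] are natural numbers with sum [dm].

   Let [p] divide [d], and call two characters congruent if their values agree
   modulo a prime ideal over [p] of the algebraic integers.  The sum of [k_X] over
   a congruence class (a block) is divisible by [p].  A character congruent to
   the unit vanishes on no simple object, because [p] divides no [k_X]; by the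
   inequality of the arithmetic and geometric means it comes from an invertible
   object.  So the invertible objects form a union of blocks, and [p] divides
   their number.  Comparing the twists of congruent objects shows that an
   invertible object of order [p] does not centralise itself: the objects
   centralising it would otherwise form a union of blocks, and [p] would divide
   [dm / p].  Hence the Hall subgroup of order [d] of the group of invertible
   objects spans a modular category [D], and every simple object of [C] is
   uniquely a product of a simple object of [D] and one of its centraliser [D'].

   Linear functors on a semisimple category are right exact, and they and their
   natural transformations are determined by their restriction to the products
   of simple objects; so the tensor product of [C] exhibits [C] as the Deligne
   product of [D] and [D'].  It is braided because [D] and [D'] centralise each
   other. *)

From HB Require Import structures.
From mathcomp Require Import all_boot all_order all_fingroup all_solvable all_algebra all_field.
From mathcomp Require Import boolp classical_sets reals.
From mathcomp Require Import complex ring.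
Require Import Defs.

Set Implicit Arguments.
Unset Strict Implicit.
Unset Printing Implicit Defensive.

Import Order.TTheory GRing.Theory Num.Theory.

Local Open Scope ring_scope.
Local Open Scope lincat_scope.

(** * Linear categories *)

(** The twist is arbitrary, so the quantum dimensions [chi o] need not be positive. The positive
    character may be [chi i0] for an object [i0] other than the unit; what is proved is that both
    have the same squared absolute values.

    Galois conjugation of characters is replaced by linear algebra over the rationals: the
    characters killing a given element of the fusion ring form a set over which sums and products
    are a trace and a determinant of rational matrices.

    Associativity is not strict. An object [X] is therefore used through the functor tensoring with
    [X] on the left: evaluations, braidings and loops all carry a trailing object [W] at the end of
    a right-nested product. In this form they compose as in a strict category, and the pentagon is
    spent once for each basic morphism.

    The arithmetic sees nothing of the category but its fusion coefficients, its characters and one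
    consequence of the balancing of the twist. *)

Section HasDim.
Context {K : fieldType}.
Implicit Types V W : lmodType K.

Lemma linear_zero V W (f : V -> W) : linear f -> f 0 = 0.
Proof. by move=> lf; have := lf (-1) 0 0; rewrite scaler0 addr0 scaleN1r addNr. Qed.

Lemma linear_sum V W (f : V -> W) (I : Type) (r : seq I) (P : pred I) F :
  linear f -> f (\sum_(i <- r | P i) F i) = \sum_(i <- r | P i) f (F i).
Proof.
move=> lf; apply: (big_morph f) => [x y|]; last exact: linear_zero.
by have := lf 1 x y; rewrite !scale1r.
Qed.

Lemma linear_scale V W (f : V -> W) a v : linear f -> f (a *: v) = a *: f v.
Proof. by move=> lf; have := lf a v 0; rewrite !addr0 (linear_zero lf) addr0. Qed.

Lemma has_dimP V n : has_dim V n <->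
  exists (e : 'rV[K]_n -> V) (c : V -> 'rV[K]_n),
    [/\ linear e, linear c, cancel e c & cancel c e].
Proof.
split=> [[b bP]|[e [c [le lc ec ce]]]].
  pose e (u : 'rV[K]_n) := \sum_(i < n) u 0 i *: b i.
  have le : linear e.
    move=> a u v; rewrite /e scaler_sumr -big_split /=; apply: eq_bigr => i _.
    by rewrite !mxE scalerDl scalerA.
  have [c cP] : {c : V -> 'rV[K]_n & forall v, v = e (c v)}.
    by apply: (choice (P := fun v u => v = e u)) => v; have [u [vE _]] := bP v; exists u.
  have ec : cancel e c.
    by move=> u; have [w [_ uniq]] := bP (e u); rewrite -(uniq _ (cP _)) (uniq u).
  exists e, c; split=> // a u v.
  by apply: (can_inj ec); rewrite -cP le -!cP.
exists (fun i => e (delta_mx 0 i)) => v.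
have eE u : e u = \sum_(i < n) u 0 i *: e (delta_mx 0 i).
  rewrite {1}[u]row_sum_delta (linear_sum _ _ _ le); apply: eq_bigr => i _.
  exact: linear_scale.
exists (c v); split=> [|u vE]; first by rewrite -eE ce.
by rewrite vE -eE ec.
Qed.

(** The change of coordinates has the opposite change as inverse, so its matrix has full row rank,
    which is at most its number of columns. *)
Lemma has_dim_le V n m : has_dim V n -> has_dim V m -> (n <= m)%N.
Proof.
move=> /has_dimP[e [c [le _ ec ce]]] /has_dimP[e' [c' [le' lc' ec' ce']]].
have lf : linear (c' \o e) by move=> a u v; rewrite /= le lc'.
pose hf := GRing.isLinear.Build K _ _ _ (c' \o e) lf.
pose f : {linear _ -> _} := HB.pack (c' \o e) hf.
have : row_free (lin1_mx f).
  apply/row_freeP.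
  have lg : linear (c \o e').
    move=> a u v /=; apply: (can_inj ec).
    by rewrite ce le !ce le'.
  pose hg := GRing.isLinear.Build K _ _ _ (c \o e') lg.
  pose g : {linear _ -> _} := HB.pack (c \o e') hg.
  exists (lin1_mx g); apply/row_matrixP => i.
  by rewrite !rowE mulmxA !mul_rV_lin1 /= ce' ec mulmx1.
by rewrite /row_free => /eqP <-; apply: rank_leq_col.
Qed.

Lemma fdim_eq V n : has_dim V n -> fdim V = n.
Proof.
move=> h; rewrite /fdim; case: xgetP => [m _ hm|/(_ n)]; last by [].
by apply/eqP; rewrite eqn_leq !(has_dim_le h hm, has_dim_le hm h).
Qed.

Lemma has_dim_bij V W n (f : V -> W) (g : W -> V) :
  linear f -> cancel f g -> cancel g f -> has_dim V n -> has_dim W n.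
Proof.
move=> lf fK gK /has_dimP[e [c [le lc ec ce]]].
apply/has_dimP; exists (f \o e), (c \o g); split.
- by move=> a u v /=; rewrite le lf.
- by move=> a u v /=; rewrite -lc; congr c; apply: (can_inj fK); rewrite lf !gK.
- exact: can_comp.
- exact: can_comp.
Qed.

Lemma fdim_bij V W n (f : V -> W) (g : W -> V) :
  linear f -> cancel f g -> cancel g f -> has_dim V n -> fdim V = fdim W.
Proof.
by move=> lf fK gK h; rewrite (fdim_eq h) (fdim_eq (has_dim_bij lf fK gK h)).
Qed.

End HasDim.

Section LinCat.
Context {K : fieldType} {C : lin_cat K}.
Implicit Types X Y Z : C.

Lemma comp0m X Y Z (f : hom X Y) : (0 : hom Y Z) \oc f = 0.
Proof. exact: linear_zero (hcomp_linearl _). Qed.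

Lemma compm0 X Y Z (g : hom Y Z) : g \oc (0 : hom X Y) = 0.
Proof. exact: linear_zero (hcomp_linearr _). Qed.

Lemma compZm X Y Z a (g : hom Y Z) (f : hom X Y) : (a *: g) \oc f = a *: (g \oc f).
Proof. exact: linear_scale (hcomp_linearl _). Qed.

Lemma compmZ X Y Z a (g : hom Y Z) (f : hom X Y) : g \oc (a *: f) = a *: (g \oc f).
Proof. exact: linear_scale (hcomp_linearr _). Qed.

Lemma compDm X Y Z (g g' : hom Y Z) (f : hom X Y) :
  (g + g') \oc f = (g \oc f) + (g' \oc f).
Proof. by have := hcomp_linearl f 1 g g'; rewrite !scale1r. Qed.

Lemma compmD X Y Z (g : hom Y Z) (f f' : hom X Y) :
  g \oc (f + f') = (g \oc f) + (g \oc f').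
Proof. by have := hcomp_linearr g 1 f f'; rewrite !scale1r. Qed.

Lemma compNm X Y Z (g : hom Y Z) (f : hom X Y) : (- g) \oc f = - (g \oc f).
Proof. by rewrite -!scaleN1r compZm. Qed.

Lemma compmN X Y Z (g : hom Y Z) (f : hom X Y) : g \oc (- f) = - (g \oc f).
Proof. by rewrite -!scaleN1r compmZ. Qed.

Lemma comp_suml X Y Z (I : Type) (r : seq I) (P : pred I)
    (g : I -> hom Y Z) (f : hom X Y) :
  (\sum_(i <- r | P i) g i) \oc f = \sum_(i <- r | P i) (g i \oc f).
Proof. exact: linear_sum (hcomp_linearl f). Qed.

Lemma comp_sumr X Y Z (I : Type) (r : seq I) (P : pred I)
    (g : hom Y Z) (f : I -> hom X Y) :
  g \oc (\sum_(i <- r | P i) f i) = \sum_(i <- r | P i) (g \oc f i).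
Proof. exact: linear_sum (hcomp_linearr g). Qed.

(* [comp_eq] and [comp_eq2] rewrite with an equation between composites inside
   a right-nested composite. *)
Lemma comp_eq X Y Z (g : hom Y Z) (f : hom X Y) h : g \oc f = h ->
  forall W (k : hom W X), g \oc (f \oc k) = h \oc k.
Proof. by move=> <- W k; rewrite hcompA. Qed.

Lemma comp_eq2 X Y Y' Z (g : hom Y Z) (f : hom X Y) (g' : hom Y' Z) (f' : hom X Y') :
  g \oc f = g' \oc f' ->
  forall W (k : hom W X), g \oc (f \oc k) = g' \oc (f' \oc k).
Proof. by move=> e W k; rewrite hcompA e hcompA. Qed.

Lemma comp_eq3 X Y Z V (g : hom Z V) (f : hom Y Z) (e : hom X Y) h :
  g \oc (f \oc e) = h -> forall W (k : hom W X), g \oc (f \oc (e \oc k)) = h \oc k.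
Proof. by move=> <- W k; rewrite !hcompA. Qed.

Lemma comp_eq4 X Y Z V U (g : hom V U) (f : hom Z V) (e : hom Y Z) (d : hom X Y) h :
  g \oc (f \oc (e \oc d)) = h ->
  forall W (k : hom W X), g \oc (f \oc (e \oc (d \oc k))) = h \oc k.
Proof. by move=> <- W k; rewrite !hcompA. Qed.

Lemma inverse_sym X Y (f : hom X Y) g : inverse f g -> inverse g f.
Proof. by case. Qed.

Lemma is_iso_id X : is_iso (idm X).
Proof. by exists (idm X); split; rewrite hcomp1m. Qed.

Lemma is_iso_comp X Y Z (g : hom Y Z) (f : hom X Y) :
  is_iso g -> is_iso f -> is_iso (g \oc f).
Proof.
move=> [g' [g'g gg']] [f' [f'f ff']]; exists (f' \oc g'); split.
  by rewrite -hcompA (comp_eq g'g) hcomp1m.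
by rewrite -hcompA (comp_eq ff') hcomp1m.
Qed.

Lemma iso_sym X Y : isomorphic X Y -> isomorphic Y X.
Proof. by case=> f [g /inverse_sym fg]; exists g, f. Qed.

Lemma iso_refl X : isomorphic X X.
Proof. by exists (idm X); apply: is_iso_id. Qed.

Lemma iso_trans X Y Z : isomorphic X Y -> isomorphic Y Z -> isomorphic X Z.
Proof. by move=> [f hf] [g hg]; exists (g \oc f); apply: is_iso_comp. Qed.

Lemma zeroP X : is_zero X <-> idm X = 0.
Proof.
split=> [/(_ X)[]//|e Y]; split=> f.
  by rewrite -(hcompm1 f) e compm0.
by rewrite -(hcomp1m f) e comp0m.
Qed.

Lemma simple_id_neq0 X : simple X -> idm X != 0.
Proof. by case=> nz _; apply/eqP => /zeroP. Qed.

Lemma iso_mono X Y (f : hom X Y) : is_iso f -> mono f.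
Proof.
move=> [g' [g'f _]] W g h e.
by rewrite -(hcomp1m g) -(hcomp1m h) -g'f -!hcompA e.
Qed.

Lemma iso_epi X Y (f : hom X Y) : is_iso f -> epi f.
Proof.
move=> [f' [_ ff']] W g h e.
by rewrite -(hcompm1 g) -(hcompm1 h) -ff' !hcompA e.
Qed.

Lemma mono_comp X Y Z (g : hom Y Z) (f : hom X Y) : mono g -> mono f -> mono (g \oc f).
Proof. by move=> mg mf W a b e; apply/mf/mg; rewrite !hcompA. Qed.

Lemma simple_iso X Y : isomorphic X Y -> simple X -> simple Y.
Proof.
move=> [f [g [gf fg]]] [nzX sX]; split=> [/zeroP Y0|W h mh].
  by apply/nzX/zeroP; rewrite -gf -(hcomp1m f) Y0 comp0m compm0.
have ig : is_iso g by exists f.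
have [?|[k [kgh ghk]]] := sX W (g \oc h) (mono_comp (iso_mono ig) mh); first by left.
right; exists (k \oc g); split; first by rewrite -hcompA.
by apply: (iso_mono ig); rewrite hcompm1 !hcompA ghk hcomp1m.
Qed.

Lemma kernel_mono X Y (f : hom X Y) Z (k : hom Z X) : is_kernel f k -> mono k.
Proof.
move=> [fk u] W g h e.
have [|l [_ lu]] := u W (k \oc g); first by rewrite hcompA fk comp0m.
by rewrite -(lu g erefl) (lu h).
Qed.

Lemma cokernel_epi X Y (f : hom X Y) Z (q : hom Y Z) : is_cokernel f q -> epi q.
Proof.
move=> [qf u] W g h e.
have [|l [_ lu]] := u W (g \oc q); first by rewrite -hcompA qf compm0.
by rewrite -(lu g erefl) (lu h).
Qed.

(** Unlike [is_biproduct], this names the structure maps and admits any finite index type, so that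
    biproducts can be nested and paired. *)
Definition bisys (T : finType) (S : T -> C) X
    (i : forall t, hom (S t) X) (p : forall t, hom X (S t)) : Prop :=
  [/\ forall t, p t \oc i t = idm (S t),
      forall t u, t != u -> p t \oc i u = 0
    & \sum_t (i t \oc p t) = idm X].

Hypothesis abC : abelian C.

(** Simplicity speaks of monomorphisms only: that of [X] makes the kernel of [f] zero, so [f] is
    mono, and that of [Y] then makes it invertible. *)
Lemma schur_iso X Y (f : hom X Y) : simple X -> simple Y -> f != 0 -> is_iso f.
Proof.
move=> [nzX sX] [nzY sY] f0; have [_ ker _ _ _] := abC.
have [Z [k kk]] := ker _ _ f; have [fk _] := kk.
have [Z0|[k' [_ kk']]] := sX Z k (kernel_mono kk); last first.
  by case/eqP: f0; rewrite -(hcompm1 f) -kk' hcompA fk comp0m.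
have mf : mono f.
  move=> W g h e; apply/subr0_eq.
  have [|l [<- _]] := kk.2 W (g - h).
    by rewrite compmD compmN e subrr.
  by rewrite ((Z0 _).2 l) compm0.
by have [|] := sY X f mf.
Qed.

End LinCat.

Lemma eigenvalue_exists (K : closedFieldType) n (A : 'M[K]_n) :
  (0 < n)%N -> exists a, eigenvalue A a.
Proof.
move=> n0; have [|a ra] := closed_rootP (char_poly A) _.
  by rewrite size_char_poly eqSS -lt0n.
by exists a; rewrite eigenvalue_root_char.
Qed.

(** * Monoidal categories and duality *)

Reserved Notation "X \lw f" (at level 40, left associativity).
Reserved Notation "f \rw X" (at level 40, left associativity).

(* Locking keeps the rewriting of composites from unfolding these morphisms. *)
Fact strict_key : unit. Proof. by []. Qed.

Section Strict.
Context {K : fieldType} {C : monoidal K}.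
Implicit Types V W X Y Z : C.

Definition lwhisk X Y Z (f : hom Y Z) : hom (X \ot Y) (X \ot Z) := idm X \otm f.
Definition rwhisk Y Z (f : hom Y Z) X : hom (Y \ot X) (Z \ot X) := f \otm idm X.

Local Notation "X \lw f" := (lwhisk X f).
Local Notation "f \rw X" := (rwhisk f X).

Lemma lwM X Y Z W (g : hom Z W) (f : hom Y Z) : X \lw (g \oc f) = (X \lw g) \oc (X \lw f).
Proof. by rewrite /lwhisk -bmapM hcomp1m. Qed.

Lemma rwM X Y Z W (g : hom Z W) (f : hom Y Z) : (g \oc f) \rw X = (g \rw X) \oc (f \rw X).
Proof. by rewrite /rwhisk -bmapM hcomp1m. Qed.

Lemma lw1 X Y : X \lw idm Y = idm (X \ot Y). Proof. exact: bmap1. Qed.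
Lemma rw1 X Y : idm X \rw Y = idm (X \ot Y). Proof. exact: bmap1. Qed.

Lemma lw_linear X Y Z : linear (@lwhisk X Y Z).
Proof. exact: bmap_linearr. Qed.

Lemma rw_linear X Y Z : linear (fun f : hom Y Z => f \rw X).
Proof. exact: bmap_linearl. Qed.

Lemma lwZ X Y Z a (f : hom Y Z) : X \lw (a *: f) = a *: (X \lw f).
Proof. exact: (linear_scale _ _ (@lw_linear X Y Z)). Qed.

Lemma rwZ X Y Z a (f : hom Y Z) : (a *: f) \rw X = a *: (f \rw X).
Proof. exact: (linear_scale _ _ (@rw_linear X Y Z)). Qed.

Lemma otmE X X' Y Y' (f : hom X X') (g : hom Y Y') : f \otm g = (f \rw Y') \oc (X \lw g).
Proof. by rewrite /lwhisk /rwhisk -bmapM hcompm1 hcomp1m. Qed.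

Lemma interchange X X' Y Y' (f : hom X X') (g : hom Y Y') :
  (f \rw Y') \oc (X \lw g) = (X' \lw g) \oc (f \rw Y).
Proof. by rewrite -otmE /lwhisk /rwhisk -bmapM hcompm1 hcomp1m. Qed.

Lemma assocE X Y Z : assoc X Y Z \oc associ X Y Z = idm _.
Proof. by have [] := assocK X Y Z. Qed.
Lemma associE X Y Z : associ X Y Z \oc assoc X Y Z = idm _.
Proof. by have [] := assocK X Y Z. Qed.
Lemma lunitE X : lunit X \oc luniti X = idm X. Proof. by have [] := lunitK X. Qed.
Lemma lunitiE X : luniti X \oc lunit X = idm _. Proof. by have [] := lunitK X. Qed.
Lemma runitE X : runit X \oc runiti X = idm X. Proof. by have [] := runitK X. Qed.
Lemma assoc_lw X Y Z Z' (h : hom Z Z') :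
  assoc X Y Z' \oc ((X \ot Y) \lw h) = (X \lw (Y \lw h)) \oc assoc X Y Z.
Proof. by rewrite /lwhisk -bmap1 assoc_nat. Qed.

Lemma assoc_rw X X' Y Z (f : hom X X') :
  assoc X' Y Z \oc ((f \rw Y) \rw Z) = (f \rw (Y \ot Z)) \oc assoc X Y Z.
Proof. by rewrite /rwhisk assoc_nat bmap1. Qed.

Lemma assoc_mw X Y Y' Z (g : hom Y Y') :
  assoc X Y' Z \oc ((X \lw g) \rw Z) = (X \lw (g \rw Z)) \oc assoc X Y Z.
Proof. by rewrite /rwhisk /lwhisk assoc_nat. Qed.

Lemma conj_inv X X' Y Y' (a : hom X Y) a' (b : hom X' Y') b' (f : hom X X') (g : hom Y Y') :
  inverse a a' -> inverse b b' -> b \oc f = g \oc a -> b' \oc g = f \oc a'.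
Proof.
move=> [_ aa'] [b'b _] e.
by rewrite -(hcompm1 g) -aa' [g \oc _]hcompA -e -hcompA (comp_eq b'b) hcomp1m.
Qed.

Lemma associ_lw X Y Z Z' (h : hom Z Z') :
  associ X Y Z' \oc (X \lw (Y \lw h)) = ((X \ot Y) \lw h) \oc associ X Y Z.
Proof. exact: conj_inv (assocK _ _ _) (assocK _ _ _) (assoc_lw _ _ _). Qed.

Lemma associ_rw X X' Y Z (f : hom X X') :
  associ X' Y Z \oc (f \rw (Y \ot Z)) = ((f \rw Y) \rw Z) \oc associ X Y Z.
Proof. exact: conj_inv (assocK _ _ _) (assocK _ _ _) (assoc_rw _ _ _). Qed.

Lemma associ_mw X Y Y' Z (g : hom Y Y') :
  associ X Y' Z \oc (X \lw (g \rw Z)) = ((X \lw g) \rw Z) \oc associ X Y Z.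
Proof. exact: conj_inv (assocK _ _ _) (assocK _ _ _) (assoc_mw _ _ _). Qed.

Lemma pentagonw W X Y Z :
  assoc W X (Y \ot Z) \oc assoc (W \ot X) Y Z =
  (W \lw assoc X Y Z) \oc (assoc W (X \ot Y) Z \oc (assoc W X Y \rw Z)).
Proof. by rewrite hcompA pentagon. Qed.

Lemma trianglew X Y : (X \lw lunit Y) \oc assoc X munit Y = runit X \rw Y.
Proof. exact: triangle. Qed.

Lemma lunit_lw X Y (f : hom X Y) : lunit Y \oc (munit \lw f) = f \oc lunit X.
Proof. exact: lunit_nat. Qed.

Lemma runit_rw X Y (f : hom X Y) : runit Y \oc (f \rw munit) = f \oc runit X.
Proof. exact: runit_nat. Qed.

Lemma lw_munit_inj X Y (f g : hom X Y) : munit \lw f = munit \lw g -> f = g.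
Proof.
move=> e; rewrite -(hcompm1 f) -(hcompm1 g) -lunitE !hcompA.
by rewrite -!lunit_lw e.
Qed.

Lemma rw_munit_inj X Y (f g : hom X Y) : f \rw munit = g \rw munit -> f = g.
Proof.
move=> e; rewrite -(hcompm1 f) -(hcompm1 g) -runitE !hcompA.
by rewrite -!runit_rw e.
Qed.

Lemma is_iso_rw X Y (f : hom X Y) Z : is_iso f -> is_iso (f \rw Z).
Proof. by move=> [g [gf fg]]; exists (g \rw Z); split; rewrite -rwM ?gf ?fg rw1. Qed.

Lemma is_iso_lw X Y (f : hom X Y) Z : is_iso f -> is_iso (Z \lw f).
Proof. by move=> [g [gf fg]]; exists (Z \lw g); split; rewrite -lwM ?gf ?fg lw1. Qed.

Lemma is_iso_otm X X' Y Y' (f : hom X X') (g : hom Y Y') :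
  is_iso f -> is_iso g -> is_iso (f \otm g).
Proof. by move=> hf hg; rewrite otmE; apply: is_iso_comp (is_iso_rw _ hf) (is_iso_lw _ hg). Qed.

Lemma is_iso_assoc X Y Z : is_iso (assoc X Y Z).
Proof. by exists (associ X Y Z); apply: assocK. Qed.
Lemma is_iso_associ X Y Z : is_iso (associ X Y Z).
Proof. by exists (assoc X Y Z); apply/inverse_sym/assocK. Qed.

(** Kelly's argument: tensoring with [munit] is faithful, and after it the identity follows from the
    pentagon on [munit], [munit], [X], [Y] and the triangle. *)
Lemma lunit_assoc X Y : lunit (X \ot Y) \oc assoc munit X Y = lunit X \rw Y.
Proof.
apply: lw_munit_inj.
have ia : is_iso (assoc munit (munit \ot X) Y \oc (assoc munit munit X \rw Y)).
  by apply: is_iso_comp; [|apply: is_iso_rw]; apply: is_iso_assoc.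
apply: (iso_epi ia); rewrite lwM -hcompA -pentagonw [LHS]hcompA trianglew.
rewrite -assoc_rw -trianglew rwM [LHS]hcompA assoc_mw [RHS]hcompA.
by rewrite -!hcompA.
Qed.

Lemma runit_assoc X Y : (X \lw runit Y) \oc assoc X Y munit = runit (X \ot Y).
Proof.
apply: rw_munit_inj; rewrite rwM.
apply: (iso_mono (is_iso_assoc X Y munit)).
rewrite [LHS]hcompA assoc_mw -[in LHS]trianglew lwM -!hcompA.
rewrite -pentagonw [LHS]hcompA -assoc_lw -!hcompA; congr (_ \oc _).
exact: trianglew.
Qed.

Lemma luniti_assoc X Y : associ munit X Y \oc luniti (X \ot Y) = luniti X \rw Y.
Proof.
have il : is_iso (lunit X \rw Y).
  by apply: is_iso_rw; exists (luniti X); apply: lunitK.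
apply: (iso_mono il); rewrite -rwM lunitE rw1 -lunit_assoc -!hcompA.
by rewrite (comp_eq (assocE _ _ _)) hcomp1m lunitE.
Qed.

Lemma trianglei X Y : assoc X munit Y \oc (runiti X \rw Y) = X \lw luniti Y.
Proof.
rewrite -[LHS]hcomp1m -lw1 -lunitiE lwM -!hcompA.
by rewrite (comp_eq (trianglew X Y)) -rwM runitE rw1 hcompm1.
Qed.

Section Duality.
Variables (X Xs : C) (ev : hom (Xs \ot X) munit) (coev : hom munit (X \ot Xs)).

(** The counit, and [coevw] the unit, of the adjunction between tensoring with [Xs] and tensoring
    with [X] on the left. *)
Definition evw W : hom (Xs \ot (X \ot W)) W :=
  locked_with strict_key (lunit W \oc ((ev \rw W) \oc associ Xs X W)).
Lemma evwE W : evw W = lunit W \oc ((ev \rw W) \oc associ Xs X W).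
Proof. by rewrite /evw unlock. Qed.

Definition coevw W : hom W (X \ot (Xs \ot W)) :=
  locked_with strict_key (assoc X Xs W \oc ((coev \rw W) \oc luniti W)).
Lemma coevwE W : coevw W = assoc X Xs W \oc ((coev \rw W) \oc luniti W).
Proof. by rewrite /coevw unlock. Qed.

Lemma evw_nat W W' (f : hom W W') : evw W' \oc (Xs \lw (X \lw f)) = f \oc evw W.
Proof.
rewrite !evwE -!hcompA associ_lw (comp_eq2 (interchange _ _)) (comp_eq2 (lunit_lw _)).
by [].
Qed.

Lemma coevw_nat W W' (f : hom W W') : coevw W' \oc f = (X \lw (Xs \lw f)) \oc coevw W.
Proof.
rewrite !coevwE -!hcompA.
have -> : luniti W' \oc f = (munit \lw f) \oc luniti W.
  exact: conj_inv (lunitK _) (lunitK _) (lunit_lw _).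
by rewrite (comp_eq2 (interchange _ _)) (comp_eq2 (assoc_lw _ _ _)).
Qed.

Hypothesis dualX : is_left_dual ev coev.

(** The duality equation whiskered by [W]; [pen] is the pentagon that gathers all associators at the
    left of [W]. *)
Lemma zigzag1 W : (X \lw evw W) \oc coevw (X \ot W) = idm (X \ot W).
Proof.
rewrite evwE coevwE !lwM -!hcompA.
have pen : (X \lw associ Xs X W) \oc assoc X Xs (X \ot W) =
    assoc X (Xs \ot X) W \oc ((assoc X Xs X \rw W) \oc associ (X \ot Xs) X W).
  apply: (iso_epi (is_iso_assoc (X \ot Xs) X W)).
  rewrite -!hcompA pentagonw associE hcompm1.
  by rewrite [LHS]hcompA -lwM associE lw1 hcomp1m.
rewrite (comp_eq pen) -!hcompA (comp_eq2 (associ_rw _ _ coev)) luniti_assoc.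
rewrite -(comp_eq2 (assoc_mw X W ev)) (comp_eq (trianglew X W)).
by rewrite -!rwM !hcompA dualX.1 rw1.
Qed.

Lemma zigzag2 W : evw (Xs \ot W) \oc (Xs \lw coevw W) = idm (Xs \ot W).
Proof.
rewrite evwE coevwE !lwM -!hcompA.
have pen : associ Xs X (Xs \ot W) \oc (Xs \lw assoc X Xs W) =
    assoc (Xs \ot X) Xs W \oc ((associ Xs X Xs \rw W) \oc associ Xs (X \ot Xs) W).
  apply: (iso_mono (is_iso_assoc Xs X (Xs \ot W))).
  have e : (assoc Xs X Xs \rw W) \oc (associ Xs X Xs \rw W) = idm _.
    by rewrite -rwM assocE rw1.
  rewrite (comp_eq (assocE _ _ _)) hcomp1m (comp_eq (pentagonw _ _ _ _)) -!hcompA.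
  by rewrite (comp_eq e) hcomp1m assocE hcompm1.
rewrite (comp_eq pen) -!hcompA (comp_eq2 (associ_mw _ _ coev)) -trianglei.
rewrite (comp_eq (associE _ _ _)) hcomp1m -(comp_eq2 (assoc_rw Xs W ev)).
rewrite (comp_eq (lunit_assoc Xs W)).
by rewrite -!rwM !hcompA dualX.2 rw1.
Qed.

Lemma dual_adj Y Z n : has_dim (hom (Xs \ot Y) Z) n ->
  fdim (hom (Xs \ot Y) Z) = fdim (hom Y (X \ot Z)).
Proof.
apply: (@fdim_bij _ _ _ _ (fun f => (X \lw f) \oc coevw Y) (fun g => evw Z \oc (Xs \lw g))).
- by move=> a f g; rewrite lw_linear compDm compZm.
- move=> f; rewrite lwM [LHS]hcompA evw_nat -hcompA.
  by rewrite zigzag2 hcompm1.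
- move=> g; rewrite lwM -hcompA -coevw_nat hcompA.
  by rewrite zigzag1 hcomp1m.
Qed.

End Duality.
End Strict.
Notation "X \lw f" := (lwhisk X f) : lincat_scope.
Notation "f \rw X" := (rwhisk f X) : lincat_scope.

(** * Fusion coefficients *)

Lemma dep_choice (T : Type) (U : T -> Type) (P : forall t, U t -> Prop) :
  (forall t, exists u, P t u) -> exists f : forall t, U t, forall t, P t (f t).
Proof. by move=> h; exists (fun t => sval (cid (h t))) => t; apply: svalP. Qed.

Section Bisys.
Context {K : fieldType} {C : lin_cat K}.

Lemma bisys_expand (T : finType) (S : T -> C) X i p Y (f : hom Y X) :
  @bisys _ C T S X i p -> f = \sum_t (i t \oc (p t \oc f)).
Proof.
move=> [_ _ e]; rewrite -{1}[f]hcomp1m -e comp_suml.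
by apply: eq_bigr => t _; rewrite hcompA.
Qed.

Lemma bisys_expandr (T : finType) (S : T -> C) X i p Y (f : hom X Y) :
  @bisys _ C T S X i p -> f = \sum_t (f \oc i t \oc p t).
Proof.
move=> [_ _ e]; rewrite -{1}[f]hcompm1 -e comp_sumr.
by apply: eq_bigr => t _; rewrite hcompA.
Qed.

Lemma bisys_comp (T : finType) (S : T -> C) X i p
    (T' : T -> finType) (S' : forall t, T' t -> C) i' p' :
  @bisys _ C T S X i p -> (forall t, @bisys _ C (T' t) (S' t) (S t) (i' t) (p' t)) ->
  @bisys _ C {t : T & T' t} (fun x => S' (tag x) (tagged x)) X
    (fun x => i (tag x) \oc i' (tag x) (tagged x))
    (fun x => p' (tag x) (tagged x) \oc p (tag x)).
Proof.
move=> [pi pi0 ip] b; split=> [[t s]|[t s] [u r]|] /=.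
- by have [pi' _ _] := b t; rewrite -hcompA (comp_eq (pi t)) hcomp1m pi'.
- have [eqtu|ntu] := eqVneq t u; last first.
    by rewrite -hcompA [X in _ \oc X]hcompA pi0 // comp0m compm0.
  case: _ / eqtu r => r; rewrite eq_Tagged /= => nsr; have [_ pi0' _] := b t.
  by rewrite -hcompA (comp_eq (pi t)) hcomp1m pi0'.
- rewrite -(sig_big_dep (fun=> true) (fun _ _ => true)
    (fun t s => i t \oc i' t s \oc (p' t s \oc p t))) /= -ip.
  apply: eq_bigr => t _; have [_ _ ip'] := b t.
  rewrite -[in RHS](hcomp1m (p t)) -ip' comp_suml comp_sumr.
  by apply: eq_bigr => s _; rewrite !hcompA.
Qed.

Lemma bisys_iso X Y (f : hom Y X) g (T : finType) (S : T -> C) i p :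
  inverse f g -> @bisys _ C T S Y i p ->
  @bisys _ C T S X (fun t => f \oc i t) (fun t => p t \oc g).
Proof.
move=> [gf fg] [pi pi0 ip]; split=> [t|t u ntu|].
- by rewrite -hcompA (comp_eq gf) hcomp1m.
- by rewrite -hcompA (comp_eq gf) hcomp1m pi0.
- under eq_bigr => t _ do rewrite -hcompA (hcompA (i t)).
  by rewrite -comp_sumr -comp_suml ip hcomp1m.
Qed.

Lemma bisys_rename n (S : 'I_n -> C) X i p (T : finType) (a : 'I_n -> T) (F : T -> C) :
  @bisys _ C 'I_n S X i p -> (forall k, isomorphic (S k) (F (a k))) ->
  exists i' p', @bisys _ C 'I_n (fun k => F (a k)) X i' p'.
Proof.
move=> [pi pi0 ip] iso.
have [v vP] : exists v : forall k, hom (S k) (F (a k)) * hom (F (a k)) (S k),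
    forall k, inverse (v k).1 (v k).2.
  apply: (@dep_choice _ _ (fun k (v : hom (S k) (F (a k)) * hom (F (a k)) (S k)) =>
    inverse v.1 v.2)).
  by move=> k; have [f [g fg]] := iso k; exists (f, g).
exists (fun k => i k \oc (v k).2), (fun k => (v k).1 \oc p k); split=> [k|k l nkl|].
- by have [_ vv] := vP k; rewrite -hcompA (comp_eq (pi k)) hcomp1m.
- by rewrite -hcompA [X in _ \oc X]hcompA pi0 // comp0m compm0.
- rewrite -ip; apply: eq_bigr => k _; have [vv _] := vP k.
  by rewrite -hcompA (comp_eq vv) hcomp1m.
Qed.

End Bisys.

Section FusionNumbers.
Context {K : numClosedFieldType} {C : fusion K}.
Implicit Types W X Y Z : C.
Local Notation I := 'I_(rank C).

Lemma irr_schur (i j : I) (f : hom (irr C i) (irr C j)) : i != j -> f = 0.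
Proof.
move=> nij; apply/eqP/negPn/negP => f0; case/eqP: nij; apply: irr_inj.
by exists f; apply: schur_iso f0; [exact: fus_abelian|exact: irr_simple|exact: irr_simple].
Qed.

(** Composition with [f] on the finite-dimensional space of endomorphisms has an eigenvalue [a].
    Then [f - a *: idm X] kills a nonzero morphism, so it is not invertible, hence zero. *)
Lemma schur_end X (f : hom X X) : simple X -> exists c, f = c *: idm X.
Proof.
move=> sX; have [n /has_dimP[e [c [le lc ec ce]]]] := fus_hom_finite X X.
pose g u := c (f \oc e u).
have lg : linear g by move=> a u v; rewrite /g le hcomp_linearr lc.
pose hg := GRing.isLinear.Build K _ _ _ g lg.
pose h : {linear _ -> _} := HB.pack g hg.
have n0 : (0 < n)%N.
  rewrite lt0n; apply/eqP => n0; have := simple_id_neq0 sX.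
  rewrite -[idm X]ce (_ : c _ = 0) ?(linear_zero le) ?eqxx //.
  by apply/rowP => -[m lm]; exfalso; move: lm; rewrite n0.
have [a /eigenvalueP[v]] := eigenvalue_exists (lin1_mx h) n0.
rewrite mul_rV_lin1 /= /g => ve v0; exists a; apply/eqP; rewrite -subr_eq0.
apply/negP => /negP/(schur_iso (@fus_abelian _ C) sX sX)[g' [gf _]].
have : (f - a *: idm X) \oc e v = 0.
  rewrite compDm compNm compZm hcomp1m -[f \oc _]ce ve (linear_scale _ _ le).
  exact: subrr.
move/(congr1 (fun w => g' \oc w)); rewrite hcompA gf hcomp1m compm0 => ev0.
by case/eqP: v0; rewrite -[v]ec ev0 (linear_zero lc).
Qed.

(** The identity transported along an equality of indices, or 0. Every morphism between
    representatives of simple objects is a multiple of it, so casts stay confined to this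
    definition. *)
Definition eirr (i j : I) : hom (irr C i) (irr C j) :=
  if i =P j is ReflectT e then ecast k (hom (irr C i) (irr C k)) e (idm _) else 0.

Lemma eirr_id i : eirr i i = idm _.
Proof. by rewrite /eirr; case: eqP => // e; rewrite eq_axiomK. Qed.

Lemma eirr_ne i j : i != j -> eirr i j = 0.
Proof. by move=> nij; rewrite /eirr; case: eqP nij => // ->; rewrite eqxx. Qed.

Lemma eirr_comp i j k : i = j -> eirr j k \oc eirr i j = eirr i k.
Proof. by move=> <-; rewrite eirr_id hcompm1. Qed.

Lemma eirr_neq0 i : eirr i i != 0.
Proof. by rewrite eirr_id; apply/simple_id_neq0/irr_simple. Qed.

Lemma irr_homP (i j : I) (f : hom (irr C i) (irr C j)) : exists c, f = c *: eirr i j.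
Proof.
have [e|nij] := eqVneq i j; last by exists 0; rewrite (irr_schur f nij) scale0r.
case: _ / e f => f; have [c ->] := schur_end f (irr_simple i).
by exists c; rewrite eirr_id.
Qed.

Definition coef i j (f : hom (irr C i) (irr C j)) : K := sval (cid (irr_homP f)).

Lemma coefE i j (f : hom (irr C i) (irr C j)) : f = coef f *: eirr i j.
Proof. exact: (svalP (cid (irr_homP f))). Qed.

Lemma coef_linear i j : i = j -> linear (@coef i j : hom _ _ -> K^o).
Proof.
move=> <- a f g; apply/eqP; rewrite -subr_eq0.
have : coef (a *: f + g) *: eirr i i == (a * coef f + coef g) *: eirr i i.
  by rewrite -coefE scalerDl -scalerA -!coefE.
by rewrite -subr_eq0 -scalerBl scaler_eq0 (negPf (eirr_neq0 i)) orbF.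
Qed.

Lemma coef_eirr i j : i = j -> coef (eirr i j) = 1.
Proof.
move=> <-.
have : (coef (eirr i i) - 1) *: eirr i i == 0.
  by rewrite scalerBl -coefE scale1r subrr.
by rewrite scaler_eq0 (negPf (eirr_neq0 i)) orbF subr_eq0 => /eqP.
Qed.

Notation irr_sys X a u v := (@bisys _ C _ (fun t => irr C (a t)) X u v).

Lemma irr_sysP X : exists n (a : 'I_n -> I) u v, irr_sys X a u v.
Proof.
have [n [S [sS [i [p b]]]]] := fus_semisimple X.
have [a aP] := choice (fun k => irr_surj (sS k)).
by exists n, a; apply: bisys_rename b aP.
Qed.

Section Sys.
Variables (T : finType) (a : T -> I) (X : C).
Variables (u : forall t, hom (irr C (a t)) X) (v : forall t, hom X (irr C (a t))).
Hypothesis sysX : irr_sys X a u v.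

Lemma sys_has_dim j : has_dim (hom (irr C j) X) #|[pred t | a t == j]|.
Proof.
set A := [pred t | a t == j].
have aj (s : 'I_#|A|) : a (enum_val s) = j by have := enum_valP s; rewrite inE => /eqP.
apply/has_dimP.
exists (fun w : 'rV_#|A| => \sum_s w 0 s *: (u (enum_val s) \oc eirr j (a (enum_val s)))).
exists (fun f => \row_s coef (v (enum_val s) \oc f)); split.
- move=> c w w'; rewrite scaler_sumr -big_split /=; apply: eq_bigr => s _.
  by rewrite !mxE scalerDl scalerA.
- move=> c f g; apply/rowP => s; rewrite !mxE hcomp_linearr.
  exact: (coef_linear (esym (aj s))).
- move=> w; apply/rowP => s; rewrite mxE comp_sumr.
  rewrite (bigD1 s) //= big1 ?addr0 => [|r nrs]; last first.
    have [_ vu0 _] := sysX; rewrite compmZ hcompA vu0 ?comp0m ?scaler0 //.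
    by rewrite (inj_eq enum_val_inj) eq_sym.
  have [vu _ _] := sysX; rewrite compmZ hcompA vu hcomp1m.
  by rewrite (linear_scale _ _ (coef_linear (esym (aj s)))) coef_eirr ?aj // [LHS]mulr1.
- move=> f; rewrite {2}(bisys_expand f sysX).
  rewrite (bigID (mem A)) [X in _ = _ + X]big1 ?addr0 => [|t]; last first.
    rewrite inE => /= nt.
    by rewrite (irr_schur (v t \oc f)) ?compm0 // eq_sym.
  rewrite [RHS]big_enum_val /=; apply: eq_bigr => s _.
  by rewrite mxE -compmZ -coefE.
Qed.

Lemma sys_has_dimr j : has_dim (hom X (irr C j)) #|[pred t | a t == j]|.
Proof.
set A := [pred t | a t == j].
have aj (s : 'I_#|A|) : a (enum_val s) = j by have := enum_valP s; rewrite inE => /eqP.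
apply/has_dimP.
exists (fun w : 'rV_#|A| => \sum_s w 0 s *: (eirr (a (enum_val s)) j \oc v (enum_val s))).
exists (fun f => \row_s coef (f \oc u (enum_val s))); split.
- move=> c w w'; rewrite scaler_sumr -big_split /=; apply: eq_bigr => s _.
  by rewrite !mxE scalerDl scalerA.
- move=> c f g; apply/rowP => s; rewrite !mxE hcomp_linearl.
  exact: (coef_linear (aj s)).
- move=> w; apply/rowP => s; rewrite mxE comp_suml.
  rewrite (bigD1 s) //= big1 ?addr0 => [|r nrs]; last first.
    have [_ vu0 _] := sysX; rewrite compZm -hcompA vu0 ?compm0 ?scaler0 //.
    by rewrite (inj_eq enum_val_inj).
  have [vu _ _] := sysX; rewrite compZm -hcompA vu hcompm1.
  by rewrite (linear_scale _ _ (coef_linear (aj s))) coef_eirr ?aj // [LHS]mulr1.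
- move=> f; rewrite {2}(bisys_expandr f sysX).
  rewrite (bigID (mem A)) [X in _ = _ + X]big1 ?addr0 => [|t]; last first.
    rewrite inE => /= nt.
    by rewrite (irr_schur (f \oc u t)) ?comp0m.
  rewrite [RHS]big_enum_val /=; apply: eq_bigr => s _.
  by rewrite mxE -compZm -coefE.
Qed.

Lemma mult_sys j : mult (irr C j) X = #|[pred t | a t == j]|.
Proof. exact/fdim_eq/sys_has_dim. Qed.

Lemma mult_sysr j : fdim (hom X (irr C j)) = mult (irr C j) X.
Proof. by rewrite mult_sys; apply/fdim_eq/sys_has_dimr. Qed.

Lemma sum_sys (V : nmodType) (F : I -> V) :
  \sum_t F (a t) = \sum_j F j *+ mult (irr C j) X.
Proof.
rewrite (partition_big a (fun=> true)) //=; apply: eq_bigr => j _.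
rewrite mult_sys (eq_bigr (fun=> F j)) => [|t /eqP -> //].
by rewrite sumr_const.
Qed.

End Sys.

Lemma mult_hom_l j X : fdim (hom X (irr C j)) = mult (irr C j) X.
Proof. by have [n [a [u [v b]]]] := irr_sysP X; apply: mult_sysr b _. Qed.

Lemma mult_has_dim j X : has_dim (hom (irr C j) X) (mult (irr C j) X).
Proof.
by have [n [a [u [v b]]]] := irr_sysP X; rewrite (mult_sys b); exact: (sys_has_dim b j).
Qed.

Lemma mult_iso j X Y : isomorphic X Y -> mult (irr C j) X = mult (irr C j) Y.
Proof.
move=> [f [g fg]]; have [n [a [u [v b]]]] := irr_sysP X.
by rewrite (mult_sys b) (mult_sys (bisys_iso fg b)).
Qed.

Lemma mult_irr i j : mult (irr C j) (irr C i) = (i == j).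
Proof.
have b : irr_sys (irr C i) (fun _ : 'I_1 => i) (fun=> idm _) (fun=> idm _).
  split=> [t|t s|].
  - exact: hcomp1m.
  - by rewrite (ord1 t) (ord1 s).
  - by rewrite big_ord1 hcomp1m.
by rewrite (mult_sys b) -sum1_card big_mkcond big_ord1 inE; case: (i == j).
Qed.

Lemma mult_bisys j (T : finType) (S : T -> C) X i p :
  @bisys _ C T S X i p -> mult (irr C j) X = (\sum_t mult (irr C j) (S t))%N.
Proof.
move=> b.
have [n nP] := choice (fun t => irr_sysP (S t)).
have [a aP] := dep_choice nP.
have [u uP] := dep_choice aP.
have [v vP] := dep_choice uP.
rewrite (mult_sys (a := fun x => a (tag x) (tagged x)) (bisys_comp b vP)).
rewrite -sum1_card -(sig_big_dep (fun=> true) (fun t s => a t s == j) (fun _ _ => 1%N)).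
by apply: eq_bigr => t _; rewrite (mult_sys (vP t)) -sum1_card.
Qed.

Lemma bisys_rw (T : finType) (S : T -> C) X i p Y : @bisys _ C T S X i p ->
  @bisys _ C T (fun t => S t \ot Y) (X \ot Y) (fun t => i t \rw Y) (fun t => p t \rw Y).
Proof.
move=> [pi pi0 ip]; split=> [t|t s nts|]; rewrite -?rwM ?pi ?rw1 //.
  by rewrite pi0 // (linear_zero (@rw_linear _ C _ _ _)).
by under eq_bigr => t _ do rewrite -rwM; rewrite -(linear_sum _ _ _ (@rw_linear _ C _ _ _)) ip rw1.
Qed.

Lemma bisys_lw (T : finType) (S : T -> C) X i p Y : @bisys _ C T S X i p ->
  @bisys _ C T (fun t => Y \ot S t) (Y \ot X) (fun t => Y \lw i t) (fun t => Y \lw p t).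
Proof.
move=> [pi pi0 ip]; split=> [t|t s nts|]; rewrite -?lwM ?pi ?lw1 //.
  by rewrite pi0 // (linear_zero (@lw_linear _ C _ _ _)).
by under eq_bigr => t _ do rewrite -lwM; rewrite -(linear_sum _ _ _ (@lw_linear _ C _ _ _)) ip lw1.
Qed.

Lemma mult_tensl l X Y : mult (irr C l) (X \ot Y) =
  (\sum_m mult (irr C m) X * mult (irr C l) (irr C m \ot Y))%N.
Proof.
have [n [a [u [v b]]]] := irr_sysP X.
rewrite (mult_bisys _ (bisys_rw Y b)).
rewrite (sum_sys b (fun m => mult (irr C l) (irr C m \ot Y))).
by apply: eq_bigr => m _; rewrite mulnC -[RHS]natn natrM natn mulr_natr.
Qed.

Lemma mult_tensr l X Y : mult (irr C l) (X \ot Y) =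
  (\sum_m mult (irr C m) Y * mult (irr C l) (X \ot irr C m))%N.
Proof.
have [n [a [u [v b]]]] := irr_sysP Y.
rewrite (mult_bisys _ (bisys_lw X b)).
rewrite (sum_sys b (fun m => mult (irr C l) (X \ot irr C m))).
by apply: eq_bigr => m _; rewrite mulnC -[RHS]natn natrM natn mulr_natr.
Qed.

Lemma iso_otm X X' Y Y' : isomorphic X X' -> isomorphic Y Y' ->
  isomorphic (X \ot Y) (X' \ot Y').
Proof. by move=> [f hf] [g hg]; exists (f \otm g); apply: is_iso_otm. Qed.

Definition Nf (i j k : I) : nat := mult (irr C k) (irr C i \ot irr C j).

Lemma unit_irr : exists o, isomorphic munit (irr C o).
Proof. exact/irr_surj/fus_one_simple. Qed.

Definition iunit : I := sval (cid unit_irr).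
Lemma iunitP : isomorphic munit (irr C iunit).
Proof. exact: svalP (cid unit_irr). Qed.

Lemma iso_lunit X : isomorphic (munit \ot X) X.
Proof. by exists (lunit X), (luniti X); apply: lunitK. Qed.
Lemma iso_runit X : isomorphic (X \ot munit) X.
Proof. by exists (runit X), (runiti X); apply: runitK. Qed.

Lemma Nf1l i j : Nf iunit i j = (i == j).
Proof.
rewrite -mult_irr; apply: mult_iso; apply: iso_trans (iso_lunit _).
by apply: iso_otm; [exact/iso_sym/iunitP|exact: iso_refl].
Qed.

Lemma Nf1r i j : Nf i iunit j = (i == j).
Proof.
rewrite -mult_irr; apply: mult_iso; apply: iso_trans (iso_runit _).
by apply: iso_otm; [exact: iso_refl|exact/iso_sym/iunitP].
Qed.

(** Frobenius reciprocity, valid for left and right duals alike since each is given by the same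
    duality equations. *)
Lemma dual_mult X Xs ev coev Y l : @is_left_dual _ C X Xs ev coev ->
  mult (irr C l) (Xs \ot Y) = fdim (hom Y (X \ot irr C l)).
Proof.
move=> dX; rewrite -mult_hom_l; have [n hn] := fus_hom_finite (Xs \ot Y) (irr C l).
exact (dual_adj dX hn).
Qed.

(** Count the unit in the products of the dual with all simple objects: by reciprocity it occurs
    once in total, while each simple summand of the dual contributes at least once. So there is a
    single summand. *)
Lemma dual_irr i : exists j, isomorphic (ldual (irr C i)) (irr C j).
Proof.
have q k : mult (irr C iunit) (ldual (irr C i) \ot irr C k) = (i == k).
  by rewrite (dual_mult _ _ (ldualP (irr C i))) -/(mult _ _) -Nf1r.
have [n [a [u [v b]]]] := irr_sysP (ldual (irr C i)).
have qs k : (\sum_t Nf (a t) k iunit = (i == k))%N.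
  by rewrite -q (mult_bisys _ (bisys_rw (irr C k) b)).
(* Otherwise the right dual of [irr C (a t)] has no simple constituent, so it is zero, against the
   duality equation. *)
have ex t : exists k, Nf (a t) k iunit != 0.
  apply: contrapT => nex.
  have all0 k : Nf (a t) k iunit = 0%N.
    by apply/eqP/negPn/negP => h; apply: nex; exists k.
  have r0 k : mult (irr C k) (rdual (irr C (a t))) = 0.
    rewrite -(mult_iso _ (iso_runit _)).
    rewrite (mult_iso k (iso_otm (iso_refl _) iunitP)).
    rewrite [LHS]/mult -(dual_mult (irr C k) iunit (rdualP (irr C (a t)))).
    exact: all0.
  have [m [c [x [y bs]]]] := irr_sysP (rdual (irr C (a t))).
  have idr0 : idm (rdual (irr C (a t))) = 0.
    have [_ _ <-] := bs; apply: big1 => s _; exfalso.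
    by have := r0 (c s); rewrite (mult_sys bs) => /card0_eq/(_ s); rewrite inE eqxx.
  have coev0 : rdual_coev (irr C (a t)) = 0.
    rewrite -[LHS]hcomp1m -rw1 idr0 (linear_zero (@rw_linear _ C _ _ _)).
    exact: comp0m.
  have [_ z2] := rdualP (irr C (a t)).
  have := simple_id_neq0 (irr_simple (a t)).
  rewrite -z2 coev0 -/(lwhisk _ _) (linear_zero (@lw_linear _ C _ _ _)).
  by rewrite compm0 comp0m eqxx.
have n1 : n = 1%N.
  have s1 : (\sum_t \sum_k Nf (a t) k iunit = 1)%N.
    rewrite exchange_big (bigD1 i) //= qs eqxx big1 // => k nki.
    by rewrite qs eq_sym (negPf nki).
  have ge1 t : (1 <= \sum_k Nf (a t) k iunit)%N.
    by have [k nk] := ex t; rewrite (bigD1 k) //= (leq_trans _ (leq_addr _ _)) // lt0n.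
  apply/eqP; rewrite eqn_leq -{1}s1; apply/andP; split.
    by rewrite -{1}[n]card_ord -sum1_card; apply: leq_sum.
  by rewrite lt0n; apply/eqP => n0; move: s1; rewrite big1 // => -[m lm]; exfalso; move: lm; rewrite n0.
move: a u v b {qs ex}; rewrite n1 => a u v [vu _ uv]; exists (a ord0).
exists (v ord0), (u ord0); split; last exact: vu.
by rewrite -uv big_ord1.
Qed.

Definition idual i : I := sval (cid (dual_irr i)).
Lemma idualP i : isomorphic (ldual (irr C i)) (irr C (idual i)).
Proof. exact: svalP (cid (dual_irr i)). Qed.

Lemma Nf_dual i j k : Nf i j k = Nf (idual i) k j.
Proof.
rewrite /Nf -(mult_iso j (iso_otm (idualP i) (iso_refl (irr C k)))).
by rewrite (dual_mult (irr C k) j (ldualP (irr C i))).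
Qed.

Lemma Nf_unit i j : Nf i j iunit = (j == idual i).
Proof. by rewrite Nf_dual Nf1r eq_sym. Qed.

End FusionNumbers.

(** * Braidings, twists and characters of the fusion ring *)

Section Braided.
Context {K : fieldType} {C : braided_fusion K}.
Implicit Types V W X Y Z : C.

(** The crossing of the first two strands of a right-nested product. *)
Definition cw X Y W : hom (X \ot (Y \ot W)) (Y \ot (X \ot W)) :=
  locked_with strict_key (assoc Y X W \oc ((braid X Y \rw W) \oc associ X Y W)).

Lemma cwE X Y W : cw X Y W = assoc Y X W \oc ((braid X Y \rw W) \oc associ X Y W).
Proof. by rewrite /cw unlock. Qed.

Lemma cw_nat X Y W W' (f : hom W W') :
  cw X Y W' \oc (X \lw (Y \lw f)) = (Y \lw (X \lw f)) \oc cw X Y W.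
Proof.
by rewrite !cwE -!hcompA associ_lw (comp_eq2 (interchange _ _)) (comp_eq2 (assoc_lw _ _ _)).
Qed.

Lemma braid_rw X X' Y (f : hom X X') :
  braid X' Y \oc (f \rw Y) = (Y \lw f) \oc braid X Y.
Proof. exact: braid_nat. Qed.

Lemma braid_lw X Y Y' (g : hom Y Y') :
  braid X Y' \oc (X \lw g) = (g \rw X) \oc braid X Y.
Proof. exact: braid_nat. Qed.

Lemma cw_natl X X' Y W (f : hom X X') :
  cw X' Y W \oc (f \rw (Y \ot W)) = (Y \lw (f \rw W)) \oc cw X Y W.
Proof.
have e : (braid X' Y \rw W) \oc ((f \rw Y) \rw W) = ((Y \lw f) \rw W) \oc (braid X Y \rw W).
  by rewrite -!rwM braid_rw.
by rewrite !cwE -!hcompA associ_rw (comp_eq2 e) (comp_eq2 (assoc_mw _ _ _)).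
Qed.

Lemma cw_natr X Y Y' W (g : hom Y Y') :
  cw X Y' W \oc (X \lw (g \rw W)) = (g \rw (X \ot W)) \oc cw X Y W.
Proof.
have e : (braid X Y' \rw W) \oc ((X \lw g) \rw W) = ((g \rw X) \rw W) \oc (braid X Y \rw W).
  by rewrite -!rwM braid_lw.
by rewrite !cwE -!hcompA associ_mw (comp_eq2 e) (comp_eq2 (assoc_rw _ _ _)).
Qed.

Lemma is_iso_cw X Y W : is_iso (cw X Y W).
Proof.
rewrite cwE; apply: is_iso_comp (is_iso_assoc _ _ _) _.
exact: is_iso_comp (is_iso_rw _ (braid_iso _ _)) (is_iso_associ _ _ _).
Qed.

Lemma cw_assoc X Y W : assoc Y X W \oc (braid X Y \rw W) = cw X Y W \oc assoc X Y W.
Proof. by rewrite !cwE -!hcompA associE hcompm1. Qed.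

(** The hexagon for crossings: moving [X] past a product is moving it past the factors in turn. *)
Lemma cw_hex1 X Y Z W : assoc Y Z (X \ot W) \oc cw X (Y \ot Z) W =
  (Y \lw cw X Z W) \oc (cw X Y (Z \ot W) \oc (X \lw assoc Y Z W)).
Proof.
have ia : is_iso (assoc X (Y \ot Z) W \oc (assoc X Y Z \rw W)).
  by apply: is_iso_comp; [|apply: is_iso_rw]; apply: is_iso_assoc.
apply: (iso_epi ia); rewrite -!hcompA -pentagonw.
rewrite !cwE !lwM -!hcompA !(comp_eq (associE _ _ _)) !hcomp1m.
rewrite -assoc_rw !(comp_eq (pentagonw _ _ _ _)) -!hcompA.
have e : (Y \lw associ X Z W) \oc (Y \lw assoc X Z W) = idm _.
  by rewrite -lwM associE lw1.
rewrite (comp_eq e) hcomp1m (comp_eq2 (esym (assoc_mw _ _ _))) -!rwM.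
congr (_ \oc (_ \oc (_ \rw _))).
by have := hexagon1 X Y Z; rewrite -!hcompA.
Qed.

Lemma cw_hex2 X Y Z W : (Z \lw assoc X Y W) \oc cw (X \ot Y) Z W =
  cw X Z (Y \ot W) \oc ((X \lw cw Y Z W) \oc assoc X Y (Z \ot W)).
Proof.
have cE : braid (X \ot Y) Z = assoc Z X Y \oc ((braid X Z \rw Y) \oc
    (associ X Z Y \oc ((X \lw braid Y Z) \oc assoc X Y Z))).
  have e := hexagon2 X Y Z.
  have {}e : associ Z X Y \oc braid (X \ot Y) Z =
      (braid X Z \rw Y) \oc (associ X Z Y \oc ((X \lw braid Y Z) \oc assoc X Y Z)).
    apply: (iso_epi (is_iso_associ X Y Z)).
    by rewrite -!hcompA assocE hcompm1 !hcompA.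
  by rewrite -e (comp_eq (assocE _ _ _)) hcomp1m.
have e1 : assoc X (Z \ot Y) W \oc (assoc X Z Y \rw W) =
    (X \lw associ Z Y W) \oc (assoc X Z (Y \ot W) \oc assoc (X \ot Z) Y W).
  by rewrite pentagonw hcompA -lwM associE lw1 hcomp1m.
have e2 : assoc (X \ot Z) Y W \oc (associ X Z Y \rw W) =
    associ X Z (Y \ot W) \oc ((X \lw assoc Z Y W) \oc assoc X (Z \ot Y) W).
  apply: (iso_epi (is_iso_rw W (is_iso_assoc X Z Y))).
  rewrite -!hcompA -rwM associE rw1 hcompm1 -pentagonw.
  by rewrite (comp_eq (associE _ _ _)) hcomp1m.
have e3 : assoc X (Y \ot Z) W \oc ((assoc X Y Z \rw W) \oc associ (X \ot Y) Z W) =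
    (X \lw associ Y Z W) \oc assoc X Y (Z \ot W).
  apply: (iso_epi (is_iso_assoc (X \ot Y) Z W)); rewrite -!hcompA associE hcompm1.
  by rewrite pentagonw [RHS]hcompA -lwM associE lw1 hcomp1m.
rewrite {1}cwE cE !rwM -!hcompA.
rewrite (comp_eq3 (esym (pentagonw Z X Y W))) -!hcompA (comp_eq2 (assoc_rw _ _ _)).
rewrite (comp_eq e2) -!hcompA (comp_eq2 (assoc_mw _ _ _)) e3 !cwE !lwM -!hcompA.
by [].
Qed.

(** Triviality of the braiding with the unit comes from the hexagon: crossing [munit \ot munit] is
    crossing [munit] twice, and one of these two isomorphisms cancels. *)
Lemma lunit_cw Y W : lunit (Y \ot W) \oc cw Y munit W = Y \lw lunit W.
Proof.
have key : lunit (Y \ot (munit \ot W)) \oc cw Y munit (munit \ot W) = Y \lw lunit (munit \ot W).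
  apply: (iso_mono (is_iso_cw Y munit W)).
  apply: (iso_epi (is_iso_lw Y (is_iso_assoc munit munit W))).
  rewrite -!hcompA -[in RHS]lwM lunit_assoc cw_natr -lunit_assoc -hcompA cw_hex1.
  by rewrite (comp_eq2 (lunit_lw _)).
have il : is_iso (Y \lw (munit \lw lunit W)).
  by do 2!apply: is_iso_lw; exists (luniti W); apply: lunitK.
apply: (iso_epi il); rewrite -hcompA cw_nat (comp_eq2 (lunit_lw _)) key -!lwM.
by rewrite lunit_lw.
Qed.

Lemma cw_lunit Y W : (Y \lw lunit W) \oc cw munit Y W = lunit (Y \ot W).
Proof.
have key : (Y \lw lunit (munit \ot W)) \oc cw munit Y (munit \ot W) =
    lunit (Y \ot (munit \ot W)).
  apply: (iso_epi (is_iso_lw munit (is_iso_cw munit Y W))).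
  apply: (iso_epi (is_iso_assoc munit munit (Y \ot W))).
  rewrite -!hcompA -cw_hex2 (comp_eq2 (lunit_lw _)) lunit_assoc cw_natl.
  by rewrite [LHS]hcompA -lwM lunit_assoc.
have il : is_iso (munit \lw (Y \lw lunit W)).
  by do 2!apply: is_iso_lw; exists (luniti W); apply: lunitK.
apply: (iso_epi il); rewrite -hcompA cw_nat lunit_lw -key !hcompA -!lwM.
by rewrite lunit_lw.
Qed.

(** The Yang-Baxter equation: naturality of the crossing of [X] past a product, applied to the
    braiding of [Y] and [Z]. *)
Lemma cw_ybe X Y Z V :
  (Z \lw cw X Y V) \oc (cw X Z (Y \ot V) \oc (X \lw cw Y Z V)) =
  cw Y Z (X \ot V) \oc ((Y \lw cw X Z V) \oc cw X Y (Z \ot V)).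
Proof.
have e := cw_natr X V (braid Y Z).
have ia : is_iso (X \lw assoc Y Z V) by apply/is_iso_lw/is_iso_assoc.
apply: (iso_epi ia); rewrite -!hcompA -lwM -cw_assoc lwM.
rewrite (comp_eq3 (esym (cw_hex1 X Z Y V))) -!hcompA cw_natr.
by rewrite (comp_eq2 (cw_assoc Y Z (X \ot V))) cw_hex1.
Qed.

End Braided.

(** * Dual pairs and their tensor products *)

Section DualPairs.
Context {K : fieldType} {C : monoidal K}.
Implicit Types V W X Y Z : C.

(** Traces are computed with an arbitrary dual, because the natural dual of [X \ot Y] is the product
    of the duals in reverse order rather than the chosen [ldual (X \ot Y)]. The zigzag identity is
    kept in whiskered form, which passes to tensor products. *)
Record dual_pair X := DualPair {
  dob :> C;
  dev : hom (dob \ot X) munit;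
  dcoev : hom munit (X \ot dob);
  dzig : forall W, (X \lw evw dev W) \oc coevw dcoev (X \ot W) = idm (X \ot W)
}.

Definition dual_pair_of X Xs ev coev (d : @is_left_dual K C X Xs ev coev) : dual_pair X :=
  DualPair (zigzag1 d).

Lemma evw_mod X (P : dual_pair X) W V :
  evw (dev P) (W \ot V) \oc (P \lw assoc X W V) =
  (evw (dev P) W \rw V) \oc associ P (X \ot W) V.
Proof.
apply: (iso_epi (is_iso_assoc P (X \ot W) V)); rewrite -!hcompA associE hcompm1.
apply: (iso_epi (is_iso_rw V (is_iso_assoc P X W))); rewrite -!hcompA -pentagonw.
rewrite !evwE !rwM -!hcompA (comp_eq (associE _ _ _)) hcomp1m -assoc_rw.
have e : (associ P X W \rw V) \oc (assoc P X W \rw V) = idm _.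
  by rewrite -rwM associE rw1.
by rewrite (comp_eq (lunit_assoc _ _)) e hcompm1.
Qed.

Lemma coevw_mod X (P : dual_pair X) W V :
  (X \lw assoc P W V) \oc (assoc X (P \ot W) V \oc (coevw (dcoev P) W \rw V)) =
  coevw (dcoev P) (W \ot V).
Proof.
rewrite !coevwE !rwM.
rewrite (comp_eq3 (esym (pentagonw X P W V))) -!hcompA (comp_eq2 (assoc_rw _ _ _)).
rewrite -luniti_assoc (comp_eq (assocE _ _ _)) hcomp1m.
by [].
Qed.

Definition dmor X Y (P : dual_pair X) (Q : dual_pair Y) (f : hom X Y) : hom Q P :=
  lunit P \oc ((dev Q \rw P) \oc (associ Q Y P \oc ((Q \lw (f \rw P)) \oc
   ((Q \lw dcoev P) \oc runiti Q)))).

Lemma dmor_rw X Y (P : dual_pair X) (Q : dual_pair Y) (f : hom X Y) W :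
  dmor P Q f \rw W =
  evw (dev Q) (P \ot W) \oc ((Q \lw (f \rw (P \ot W))) \oc (Q \lw coevw (dcoev P) W)).
Proof.
rewrite evwE coevwE !lwM !rwM -!hcompA -trianglei.
have e : associ Q Y (P \ot W) \oc ((Q \lw assoc Y P W) \oc assoc Q (Y \ot P) W) =
    assoc (Q \ot Y) P W \oc (associ Q Y P \rw W).
  apply: (iso_epi (is_iso_rw W (is_iso_assoc Q Y P))).
  rewrite -!hcompA -pentagonw (comp_eq (associE _ _ _)) hcomp1m -rwM associE.
  by rewrite rw1 hcompm1.
have e1 : (Q \lw (f \rw (P \ot W))) \oc (Q \lw assoc X P W) =
    (Q \lw assoc Y P W) \oc (Q \lw ((f \rw P) \rw W)) by rewrite -!lwM assoc_rw.
rewrite -(comp_eq2 (assoc_mw Q W (dcoev P))) (comp_eq2 e1).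
rewrite -(comp_eq2 (assoc_mw Q W (f \rw P))) (comp_eq3 e) -!hcompA.
by rewrite -(comp_eq2 (assoc_rw P W (dev Q))) (comp_eq (lunit_assoc _ _)).
Qed.

Lemma dmor_coev X Y (P : dual_pair X) (Q : dual_pair Y) (f : hom X Y) W :
  (Y \lw (dmor P Q f \rw W)) \oc coevw (dcoev Q) W =
  (f \rw (P \ot W)) \oc coevw (dcoev P) W.
Proof.
rewrite dmor_rw !lwM -!hcompA -coevw_nat -(comp_eq2 (coevw_nat _ _)).
by rewrite (comp_eq (dzig Q _)) hcomp1m.
Qed.

Lemma dmor_ev X Y (P : dual_pair X) (Q : dual_pair Y) (f : hom X Y) W :
  evw (dev P) W \oc (dmor P Q f \rw (X \ot W)) =
  evw (dev Q) W \oc (Q \lw (f \rw W)).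
Proof.
rewrite dmor_rw [LHS]hcompA -evw_nat -!hcompA; congr (_ \oc _).
rewrite -!lwM; congr (_ \lw _); rewrite hcompA -interchange -hcompA dzig.
exact: hcompm1.
Qed.

Section Tensor.
Variables (X Y : C) (P : dual_pair X) (Q : dual_pair Y).

(** The nested caps of [X] and [Y] on a fully right-nested product; [tev] is the bracketed version,
    which a dual pair for [X \ot Y] requires, and [tevE] compares the two. *)
Definition nev W : hom (Q \ot (P \ot (X \ot (Y \ot W)))) W :=
  locked_with strict_key (evw (dev Q) W \oc (Q \lw evw (dev P) (Y \ot W))).
Lemma nevE W : nev W = evw (dev Q) W \oc (Q \lw evw (dev P) (Y \ot W)).
Proof. by rewrite /nev unlock. Qed.

Definition ncoev W : hom W (X \ot (Y \ot (Q \ot (P \ot W)))) :=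
  locked_with strict_key ((X \lw coevw (dcoev Q) (P \ot W)) \oc coevw (dcoev P) W).
Lemma ncoevE W : ncoev W = (X \lw coevw (dcoev Q) (P \ot W)) \oc coevw (dcoev P) W.
Proof. by rewrite /ncoev unlock. Qed.

Definition tev : hom ((Q \ot P) \ot (X \ot Y)) munit :=
  dev Q \oc ((Q \lw evw (dev P) Y) \oc assoc Q P (X \ot Y)).
Definition tcoev : hom munit ((X \ot Y) \ot (Q \ot P)) :=
  associ X Y (Q \ot P) \oc ((X \lw coevw (dcoev Q) P) \oc dcoev P).

Lemma tevE W : evw tev W = nev W \oc (assoc Q P (X \ot (Y \ot W)) \oc
  ((Q \ot P) \lw assoc X Y W)).
Proof.
rewrite assoc_lw nevE -!hcompA.
have e : (Q \lw evw (dev P) (Y \ot W)) \oc (Q \lw (P \lw assoc X Y W)) =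
   (Q \lw (evw (dev P) Y \rw W)) \oc (Q \lw associ P (X \ot Y) W).
  by rewrite -!lwM evw_mod.
rewrite (comp_eq2 e) [in LHS]evwE /tev !rwM [evw (dev Q) W]evwE -!hcompA; congr (_ \oc (_ \oc _)).
rewrite (comp_eq2 (associ_mw _ _ _)); congr (_ \oc _).
apply: (iso_mono (is_iso_assoc Q (P \ot (X \ot Y)) W)).
rewrite (comp_eq (assocE _ _ _)) hcomp1m.
apply: (iso_mono (is_iso_lw Q (is_iso_assoc P (X \ot Y) W))).
rewrite (comp_eq3 (esym (pentagonw Q P (X \ot Y) W))) -!hcompA assocE hcompm1.
by rewrite [RHS]hcompA -lwM assocE lw1 hcomp1m.
Qed.

Lemma tcoevE W : ((X \ot Y) \lw assoc Q P W) \oc coevw tcoev W =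
  associ X Y (Q \ot (P \ot W)) \oc ncoev W.
Proof.
apply: (iso_mono (is_iso_assoc X Y (Q \ot (P \ot W)))).
rewrite (comp_eq (assocE _ _ _)) hcomp1m hcompA assoc_lw -hcompA coevwE.
rewrite (comp_eq (pentagonw X Y (Q \ot P) W)) /tcoev !rwM -!hcompA.
have e : (assoc X Y (Q \ot P) \rw W) \oc (associ X Y (Q \ot P) \rw W) = idm _.
  by rewrite -rwM assocE rw1.
rewrite (comp_eq e) hcomp1m (comp_eq2 (assoc_mw _ _ _)) -coevwE.
by rewrite ncoevE !hcompA -!lwM -hcompA coevw_mod.
Qed.

Lemma nzig W : (X \lw (Y \lw nev W)) \oc ncoev (X \ot (Y \ot W)) = idm _.
Proof.
rewrite nevE ncoevE [LHS]hcompA -lwM [Y \lw (_ \oc _)]lwM -hcompA -coevw_nat hcompA dzig hcomp1m.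
exact: dzig.
Qed.

Lemma tzig W : ((X \ot Y) \lw evw tev W) \oc coevw tcoev ((X \ot Y) \ot W) = idm _.
Proof.
rewrite tevE !lwM -!hcompA -coevw_nat (comp_eq (tcoevE _)).
by rewrite -!hcompA (comp_eq2 (esym (associ_lw _ _ _))) (comp_eq (nzig W)) hcomp1m associE.
Qed.

Definition dual_pair_tens : dual_pair (X \ot Y) := DualPair tzig.

End Tensor.
End DualPairs.

(** * Closing strands: partial traces of the double braiding *)

Section Closing.
Context {K : fieldType} {C : modular K}.
Implicit Types V W X Y Z : C.

Definition eb X (P : dual_pair X) W : hom (X \ot (P \ot W)) W :=
  locked_with strict_key (evw (dev P) W \oc cw X P W).
Lemma ebE X (P : dual_pair X) W : eb P W = evw (dev P) W \oc cw X P W.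
Proof. by rewrite /eb unlock. Qed.

(** Evaluation of [X] against its dual on the wrong side: braiding and twist together stand for the
    isomorphism of [X] with its double dual, as in [qtrace]. *)
Definition et X (P : dual_pair X) W : hom (X \ot (P \ot W)) W :=
  locked_with strict_key (eb P W \oc (twist X \rw (P \ot W))).
Lemma etE X (P : dual_pair X) W : et P W = eb P W \oc (twist X \rw (P \ot W)).
Proof. by rewrite /et unlock. Qed.

Lemma eb_nat X (P : dual_pair X) W W' (f : hom W W') :
  eb P W' \oc (X \lw (P \lw f)) = f \oc eb P W.
Proof. by rewrite !ebE -hcompA cw_nat hcompA evw_nat -hcompA. Qed.

Lemma et_cyc X Y (P : dual_pair X) (Q : dual_pair Y) (f : hom X Y) (g : hom Y X) W :
  et P W \oc ((g \rw (P \ot W)) \oc (Y \lw (dmor P Q f \rw W))) =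
  et Q W \oc ((f \oc g) \rw (Q \ot W)).
Proof.
rewrite !etE !ebE -!hcompA [X in _ = _ \oc (_ \oc X)](_ : _ =
  ((f \oc g) \rw (Q \ot W)) \oc (twist Y \rw (Q \ot W))); last first.
  by rewrite -!rwM twist_nat.
rewrite (_ : (twist X \rw (P \ot W)) \oc ((g \rw (P \ot W)) \oc (Y \lw (dmor P Q f \rw W))) =
  (g \rw (P \ot W)) \oc ((Y \lw (dmor P Q f \rw W)) \oc (twist Y \rw (Q \ot W)))); last first.
  by rewrite -interchange !hcompA -!rwM twist_nat.
rewrite (comp_eq2 (cw_natl _ _ g)) (comp_eq2 (cw_natr _ _ _)).
rewrite (comp_eq2 (esym (interchange _ _))) (comp_eq2 (dmor_ev _ _ _ _)).
by rewrite (comp_eq2 (cw_natl _ _ _)) rwM lwM -!hcompA.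
Qed.

(** A strand [Y] crossing both legs of a cap can be pulled off: the cap ends in the unit, and
    crossing the unit is trivial. *)
Lemma eb_slide X (P : dual_pair X) Y W :
  eb P (Y \ot W) \oc ((X \lw cw Y P W) \oc cw Y X (P \ot W)) = Y \lw eb P W.
Proof.
have ebw V : eb P V = lunit V \oc (((dev P \oc braid X P) \rw V) \oc associ X P V).
  by rewrite ebE evwE cwE !rwM -!hcompA (comp_eq (associE _ _ _)) hcomp1m.
have e : (X \lw cw Y P W) \oc cw Y X (P \ot W) =
   assoc X P (Y \ot W) \oc (cw Y (X \ot P) W \oc (Y \lw associ X P W)).
  apply: (iso_epi (is_iso_lw Y (is_iso_assoc X P W))).
  by rewrite -!hcompA -lwM associE lw1 hcompm1 cw_hex1.
rewrite e !ebw -!hcompA (comp_eq (associE _ _ _)) hcomp1m.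
by rewrite (comp_eq2 (esym (cw_natr _ _ _))) (comp_eq (lunit_cw _ _)) -!lwM.
Qed.

Lemma twist_tensw X Y V : assoc X Y V \oc (twist (X \ot Y) \rw V) =
  cw Y X V \oc (cw X Y V \oc ((twist X \rw (Y \ot V)) \oc ((X \lw (twist Y \rw V)) \oc assoc X Y V))).
Proof.
have -> : twist (X \ot Y) = (twist X \otm twist Y) \oc (braid Y X \oc braid X Y).
  by rewrite twist_tens -hcompA.
rewrite otmE !rwM -!hcompA (comp_eq2 (assoc_rw _ _ _)) (comp_eq2 (assoc_mw _ _ _)).
rewrite (comp_eq2 (cw_assoc _ _ _)) cw_assoc.
rewrite (comp_eq2 (esym (cw_natl _ _ _))) (comp_eq2 (esym (cw_natr _ _ _))).
rewrite (comp_eq2 (esym (cw_natr _ _ _))) (comp_eq2 (esym (cw_natl _ _ _))).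
by rewrite (comp_eq2 (interchange _ _)).
Qed.

Section Nested.
Variables (X Y : C) (P : dual_pair X) (Q : dual_pair Y).

Lemma cw_tens W :
  assoc Q P (X \ot (Y \ot W)) \oc (((Q \ot P) \lw assoc X Y W) \oc cw (X \ot Y) (Q \ot P) W) =
  (Q \lw cw X P (Y \ot W)) \oc ((Q \lw (X \lw cw Y P W)) \oc (cw X Q (Y \ot (P \ot W)) \oc
   ((X \lw cw Y Q (P \ot W)) \oc ((X \lw (Y \lw assoc Q P W)) \oc assoc X Y ((Q \ot P) \ot W))))).
Proof.
rewrite (comp_eq2 (assoc_lw _ _ _)) cw_hex1.
have e : (Q \lw (P \lw assoc X Y W)) \oc (Q \lw cw (X \ot Y) P W) =
    (Q \lw cw X P (Y \ot W)) \oc ((Q \lw (X \lw cw Y P W)) \oc (Q \lw assoc X Y (P \ot W))).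
  by rewrite -!lwM cw_hex2.
rewrite (comp_eq e) -!hcompA (comp_eq (cw_hex2 _ _ _ _)) -!hcompA.
by rewrite (assoc_lw X Y (assoc Q P W)).
Qed.

(** The caps of [X] and [Y] built by braiding are interlocked. The double braiding in [twist_tens]
    frees them: each of its two crossings is absorbed by one use of [eb_slide], the first ([e1])
    after a Yang-Baxter move. *)
Lemma et_tens W : et (dual_pair_tens P Q) W =
  et P W \oc ((X \lw et Q (P \ot W)) \oc
   ((X \lw (Y \lw assoc Q P W)) \oc assoc X Y ((Q \ot P) \ot W))).
Proof.
rewrite etE ebE tevE nevE -!hcompA (comp_eq3 (cw_tens W)) -!hcompA.
rewrite twist_tensw.
set V := (Q \ot P) \ot W.
have e1 : evw (dev Q) W \oc ((Q \lw evw (dev P) (Y \ot W)) \oc ((Q \lw cw X P (Y \ot W)) \oc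
   ((Q \lw (X \lw cw Y P W)) \oc (cw X Q (Y \ot (P \ot W)) \oc
   ((X \lw cw Y Q (P \ot W)) \oc cw Y X (Q \ot (P \ot W))))))) =
   eb Q W \oc ((Y \lw (Q \lw eb P W)) \oc (Y \lw cw X Q (P \ot W))).
  rewrite -cw_ybe.
  have e0 : (Q \lw evw (dev P) (Y \ot W)) \oc ((Q \lw cw X P (Y \ot W)) \oc
      ((Q \lw (X \lw cw Y P W)) \oc (Q \lw cw Y X (P \ot W)))) = Q \lw (Y \lw eb P W).
    by rewrite -!lwM -eb_slide ebE -!hcompA.
  by rewrite (comp_eq4 e0) (comp_eq2 (esym (cw_nat _ _ _))) [eb Q W]ebE -!hcompA.
have e2 : eb Q W \oc ((Y \lw (Q \lw eb P W)) \oc ((Y \lw cw X Q (P \ot W)) \oc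
    cw X Y (Q \ot (P \ot W)))) = eb P W \oc (X \lw eb Q (P \ot W)).
  by rewrite (comp_eq2 (eb_nat _ _)) eb_slide.
rewrite !(comp_eq2 (esym (cw_nat _ _ (assoc Q P W)))).
have e3 U (k : hom U _) := congr1 (fun f => f \oc (cw X Y (Q \ot (P \ot W)) \oc k)) e1.
have {e3} := e3 _ ((X \lw (Y \lw assoc Q P W)) \oc ((twist X \rw (Y \ot V)) \oc
    ((X \lw (twist Y \rw V)) \oc assoc X Y V))).
rewrite -!hcompA (comp_eq4 e2) => ->; rewrite [in RHS]etE [et Q _]etE !lwM -!hcompA.
rewrite !(comp_eq2 (interchange (twist X) _)); do 2 congr (_ \oc _).
by rewrite [LHS]hcompA [RHS]hcompA -!lwM interchange.
Qed.

End Nested.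

Definition mon j X V : hom (j \ot (X \ot V)) (j \ot (X \ot V)) :=
  locked_with strict_key (cw X j V \oc cw j X V).
Lemma monE j X V : mon j X V = cw X j V \oc cw j X V.
Proof. by rewrite /mon unlock. Qed.

Lemma mon_assoc X Y V :
  assoc X Y V \oc ((braid Y X \oc braid X Y) \rw V) = mon X Y V \oc assoc X Y V.
Proof. by rewrite rwM (comp_eq (cw_assoc _ _ _)) -hcompA cw_assoc monE -hcompA. Qed.

Lemma mon_nat j X V V' (f : hom V V') :
  mon j X V' \oc (j \lw (X \lw f)) = (j \lw (X \lw f)) \oc mon j X V.
Proof. by rewrite !monE -hcompA cw_nat hcompA cw_nat -hcompA. Qed.

Lemma mon_natr j X Y V (f : hom X Y) :
  mon j Y V \oc (j \lw (f \rw V)) = (j \lw (f \rw V)) \oc mon j X V.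
Proof. by rewrite !monE -hcompA cw_natr hcompA cw_natl -hcompA. Qed.

(* The partial trace over [X], taken with the dual pair [P], of the double
   braiding of [j] and [X] followed by [f]. *)
Definition clo j X (P : dual_pair X) (f : hom X X) W : hom (j \ot W) (j \ot W) :=
  locked_with strict_key ((j \lw et P W) \oc (mon j X (P \ot W) \oc
    ((j \lw (f \rw (P \ot W))) \oc (j \lw coevw (dcoev P) W)))).
Lemma cloE j X (P : dual_pair X) (f : hom X X) W : clo j P f W =
  (j \lw et P W) \oc (mon j X (P \ot W) \oc
    ((j \lw (f \rw (P \ot W))) \oc (j \lw coevw (dcoev P) W))).
Proof. by rewrite /clo unlock. Qed.

Definition trw X (P : dual_pair X) (f : hom X X) W : hom W W :=
  et P W \oc ((f \rw (P \ot W)) \oc coevw (dcoev P) W).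

(** The morphism [f] travels once around the loop: through the cup as its dual, past the double
    braiding by naturality, and back through the cap by [et_cyc]. *)
Lemma clo_cyc j X Y (P : dual_pair X) (Q : dual_pair Y) (f : hom X Y) (g : hom Y X) W :
  clo j P (g \oc f) W = clo j Q (f \oc g) W.
Proof.
rewrite !cloE rwM lwM -!hcompA -[(j \lw (f \rw _)) \oc _]lwM -(dmor_coev P Q f) lwM.
rewrite (comp_eq2 (mon_natr _ _ _)) (comp_eq2 (mon_nat _ _ _)).
rewrite (comp_eq2 (mon_natr _ _ (f \oc g))).
have e : (j \lw et P W) \oc ((j \lw (g \rw (P \ot W))) \oc (j \lw (Y \lw (dmor P Q f \rw W)))) =
    (j \lw et Q W) \oc (j \lw ((f \oc g) \rw (Q \ot W))) by rewrite -!lwM et_cyc.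
by rewrite (comp_eq3 e) -hcompA.
Qed.

Lemma trw_cyc X Y (P : dual_pair X) (Q : dual_pair Y) (f : hom X Y) (g : hom Y X) W :
  trw P (g \oc f) W = trw Q (f \oc g) W.
Proof.
rewrite /trw rwM -hcompA -(dmor_coev P Q f).
by rewrite (comp_eq3 (et_cyc P Q f g W)) -hcompA.
Qed.

Lemma mon_tens j X Y V : (j \lw assoc X Y V) \oc mon j (X \ot Y) V =
  cw X j (Y \ot V) \oc ((X \lw mon j Y V) \oc (cw j X (Y \ot V) \oc (j \lw assoc X Y V))).
Proof.
rewrite !monE lwM -!hcompA (comp_eq (cw_hex2 _ _ _ _)) -!hcompA.
by rewrite cw_hex1.
Qed.

(** The loop of [X \ot Y] around [j] is the loop of [Y] inside that of [X]. The inner one acts by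
    the scalar [h] and comes out; this makes [hch] multiplicative. *)
Lemma clo_tens j X Y (P : dual_pair X) (Q : dual_pair Y) h W :
  clo j Q (idm Y) (P \ot W) = h *: idm _ ->
  clo j (dual_pair_tens P Q) (idm (X \ot Y)) W = h *: clo j P (idm X) W.
Proof.
rewrite !cloE !rw1 !lw1 !hcomp1m => hQ.
rewrite et_tens !lwM -!hcompA (comp_eq (mon_tens _ _ _ _)) -!hcompA.
rewrite (comp_eq2 (esym (cw_nat _ _ (Y \lw assoc Q P W)))).
rewrite (comp_eq2 (esym (cw_nat _ _ (et Q (P \ot W))))).
have e1 : (X \lw (j \lw (Y \lw assoc Q P W))) \oc (X \lw mon j Y ((Q \ot P) \ot W)) =
    (X \lw mon j Y (Q \ot (P \ot W))) \oc (X \lw (j \lw (Y \lw assoc Q P W))).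
  by rewrite -!lwM mon_nat.
rewrite (comp_eq2 e1) (comp_eq2 (esym (cw_nat _ _ (Y \lw assoc Q P W)))).
have e2 : (j \lw (X \lw (Y \lw assoc Q P W))) \oc ((j \lw assoc X Y ((Q \ot P) \ot W)) \oc
    (j \lw coevw (tcoev P Q) W)) =
    (j \lw (X \lw coevw (dcoev Q) (P \ot W))) \oc (j \lw coevw (dcoev P) W).
  by rewrite -!lwM (comp_eq2 (esym (assoc_lw _ _ _))) tcoevE (comp_eq (assocE _ _ _)) hcomp1m ncoevE.
rewrite e2 (comp_eq2 (cw_nat _ _ (coevw (dcoev Q) (P \ot W)))).
have e3 : (X \lw (j \lw et Q (P \ot W))) \oc ((X \lw mon j Y (Q \ot (P \ot W))) \oc
    (X \lw (j \lw coevw (dcoev Q) (P \ot W)))) = h *: idm _.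
  by rewrite -!lwM hQ lwZ lw1.
rewrite (comp_eq3 e3) compZm hcomp1m !compmZ monE -!hcompA.
by [].
Qed.

(** Closing the strand [Y] first leaves its loop around [X], a scalar; for simple objects this
    factors an entry of the S-matrix. *)
Lemma trw_tens X Y (P : dual_pair X) (Q : dual_pair Y) h W :
  clo X Q (idm Y) (P \ot W) = h *: idm _ ->
  trw (dual_pair_tens P Q) (braid Y X \oc braid X Y) W = h *: trw P (idm X) W.
Proof.
rewrite cloE /trw !rw1 !lw1 !hcomp1m => hQ.
rewrite et_tens -!hcompA (comp_eq2 (mon_assoc _ _ _)) (comp_eq2 (esym (mon_nat _ _ _))).
have e2 : (X \lw (Y \lw assoc Q P W)) \oc (assoc X Y ((Q \ot P) \ot W) \oc
    coevw (tcoev P Q) W) =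
    (X \lw coevw (dcoev Q) (P \ot W)) \oc coevw (dcoev P) W.
  by rewrite (comp_eq2 (esym (assoc_lw _ _ _))) tcoevE (comp_eq (assocE _ _ _)) hcomp1m ncoevE.
by rewrite e2 (comp_eq3 hQ) compZm hcomp1m compmZ.
Qed.

Definition etm X (P : dual_pair X) : hom (X \ot P) munit :=
  locked_with strict_key (dev P \oc (braid X P \oc (twist X \rw P))).
Lemma etmE X (P : dual_pair X) : etm P = dev P \oc (braid X P \oc (twist X \rw P)).
Proof. by rewrite /etm unlock. Qed.

Lemma et_rw X (P : dual_pair X) W : et P W = lunit W \oc ((etm P \rw W) \oc associ X P W).
Proof.
rewrite etE ebE evwE cwE etmE !rwM -!hcompA (comp_eq (associE _ _ _)) hcomp1m.
by rewrite -associ_rw.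
Qed.

(** The loop does not touch the trailing object, so it comes from an endomorphism of [j], to which
    Schur's lemma applies. *)
Lemma clo_rw j X (P : dual_pair X) : exists h : hom j j, forall W, clo j P (idm X) W = h \rw W.
Proof.
exists (runit j \oc ((j \lw etm P) \oc
  (assoc j X P \oc (((braid X j \oc braid j X) \rw P) \oc (associ j X P \oc
  ((j \lw dcoev P) \oc runiti j)))))) => W.
have monA : mon j X (P \ot W) = assoc j X (P \ot W) \oc
    (((braid X j \oc braid j X) \rw (P \ot W)) \oc associ j X (P \ot W)).
  by rewrite (comp_eq (mon_assoc _ _ _)) -hcompA assocE hcompm1.
rewrite cloE rw1 lw1 hcomp1m et_rw coevwE monA.
set m := braid X j \oc braid j X.
rewrite !lwM [(runit j \oc _) \rw W]rwM ![((_ \oc (_ \oc _)) \rw W)]rwM [(_ \oc runiti j) \rw W]rwM.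
rewrite -trianglei -!hcompA.
have e : associ j X (P \ot W) \oc ((j \lw assoc X P W) \oc assoc j (X \ot P) W) =
    assoc (j \ot X) P W \oc (associ j X P \rw W).
  apply: (iso_epi (is_iso_rw W (is_iso_assoc j X P))).
  rewrite -!hcompA -pentagonw (comp_eq (associE _ _ _)) hcomp1m -rwM associE.
  by rewrite rw1 hcompm1.
have e' : (j \lw associ X P W) \oc (assoc j X (P \ot W) \oc assoc (j \ot X) P W) =
    assoc j (X \ot P) W \oc (assoc j X P \rw W).
  by rewrite pentagonw hcompA -lwM associE lw1 hcomp1m.
rewrite -(comp_eq2 (assoc_mw j W (dcoev P))) (comp_eq3 e) -!hcompA.
rewrite -(comp_eq2 (assoc_rw P W m)) (comp_eq3 e') -!hcompA.
by rewrite -(comp_eq2 (assoc_mw j W (etm P))) (comp_eq (trianglew _ _)).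
Qed.

Lemma trw_rw X (P : dual_pair X) f W :
  trw P f W = lunit W \oc (((etm P \oc ((f \rw P) \oc dcoev P)) \rw W) \oc luniti W).
Proof.
rewrite /trw et_rw coevwE !rwM -!hcompA (comp_eq2 (associ_rw _ _ _)).
by rewrite (comp_eq (associE _ _ _)) hcomp1m.
Qed.

End Closing.

(** * Characters of the fusion ring and the S-matrix *)

Section Verlinde.
Context {K : numClosedFieldType} {C : modular K}.
Implicit Types V W X Y Z : C.
Local Notation I := 'I_(rank C).

Definition cpair (X : C) : dual_pair X := dual_pair_of (ldualP X).

Lemma clo_id j X Y (P : dual_pair X) (Q : dual_pair Y) W :
  isomorphic X Y -> clo j P (idm X) W = clo j Q (idm Y) W.
Proof. by move=> [f [g [gf fg]]]; rewrite -gf (clo_cyc j P Q) fg. Qed.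

Lemma clo_linear j X (P : dual_pair X) W : linear (fun f => clo j P f W).
Proof.
move=> a f g; rewrite !cloE rw_linear lw_linear compDm compZm compmD compmZ.
by rewrite compmD compmZ.
Qed.

Lemma clo_scalar i X (P : dual_pair X) :
  exists h, forall W, clo (irr C i) P (idm X) W = h *: idm _.
Proof.
have [f fP] := clo_rw (irr C i) P; have [h fE] := schur_end f (irr_simple i).
by exists h => W; rewrite fP fE rwZ rw1.
Qed.

(** The scalar by which a loop of [X] acts on the simple object [i]. For simple [X] it is the entry
    of the S-matrix divided by the dimension of [i] ([S_hch]), but it is defined without that
    division. *)
Definition hch (i : I) (X : C) : K := sval (cid (clo_scalar i (cpair X))).

Lemma hchP i X (P : dual_pair X) W : clo (irr C i) P (idm X) W = hch i X *: idm _.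
Proof.
rewrite (clo_id _ P (cpair X)); last exact: iso_refl.
exact: (svalP (cid (clo_scalar i (cpair X)))).
Qed.

Lemma irr_ot_neq0 i (c : K) :
  (c *: idm (irr C i \ot munit) == 0) = (c == 0).
Proof.
rewrite scaler_eq0; case: eqP => //= _; apply/negP => /eqP z.
have := simple_id_neq0 (irr_simple i); rewrite -(runitE (irr C i)).
by rewrite -[runiti _]hcomp1m z comp0m compm0 eqxx.
Qed.

Lemma hch_inj i (c c' : K) : c *: idm (irr C i \ot munit) = c' *: idm _ -> c = c'.
Proof.
move=> e; apply/eqP; rewrite -subr_eq0 -(irr_ot_neq0 i) scalerBl e subrr.
exact: eqxx.
Qed.

Lemma hch_iso i X Y : isomorphic X Y -> hch i X = hch i Y.
Proof.
move=> XY; apply: (@hch_inj i); rewrite -(hchP i (cpair X)) -(hchP i (cpair Y)).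
exact: clo_id.
Qed.

Lemma hch_tens i X Y : hch i (X \ot Y) = hch i X * hch i Y.
Proof.
apply: (@hch_inj i); rewrite -(hchP i (dual_pair_tens (cpair X) (cpair Y))).
by rewrite (clo_tens (hchP i (cpair Y) _)) (hchP i (cpair X)) scalerA mulrC.
Qed.

(** The loop is linear and cyclic in the morphism it carries, so splitting the identity of [X]
    splits it into loops of the summands. *)
Lemma hch_sum i X : hch i X = \sum_k (mult (irr C k) X)%:R * hch i (irr C k).
Proof.
have [n [a [u [v b]]]] := irr_sysP X.
have -> : \sum_k (mult (irr C k) X)%:R * hch i (irr C k) = \sum_t hch i (irr C (a t)).
  rewrite (sum_sys b (fun k => hch i (irr C k))); apply: eq_bigr => k _.
  by rewrite mulr_natl.
have [vu _ uv] := b; apply: (@hch_inj i); rewrite -(hchP i (cpair X)) -uv.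
rewrite (linear_sum _ _ _ (clo_linear _ _ _)) scaler_suml; apply: eq_bigr => t _.
by rewrite (clo_cyc _ (cpair X) (cpair (irr C (a t)))) vu hchP.
Qed.

Lemma hchM i j k :
  hch i (irr C j) * hch i (irr C k) = \sum_l (Nf j k l)%:R * hch i (irr C l).
Proof. by rewrite -hch_tens hch_sum. Qed.

Lemma munit_end (f : hom (munit : C) munit) : f = scalar_of f *: idm munit.
Proof.
have [c fE] := schur_end f (@fus_one_simple _ C).
rewrite /scalar_of; case: xgetP => [a _ //|/(_ c)]; first by case.
Qed.

Definition tr X (f : hom X X) : K := scalar_of (qtrace (@twist K C) f).

Lemma trwE X (f : hom X X) W : trw (cpair X) f W = tr f *: idm W.
Proof.
have -> : trw (cpair X) f W = lunit W \oc ((qtrace (@twist K C) f \rw W) \oc luniti W).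
  rewrite trw_rw etmE /qtrace; congr (_ \oc ((_ \rw _) \oc _)).
  by rewrite -!hcompA -/(rwhisk _ _) rwM -!hcompA.
by rewrite {1}(munit_end (qtrace _ _)) rwZ rw1 compZm hcomp1m compmZ lunitE.
Qed.

Lemma S_mxE i j : S_mx (@twist K C) i j =
  tr (braid (irr C j) (irr C i) \oc braid (irr C i) (irr C j)).
Proof. by rewrite mxE. Qed.

Lemma munit_inj (c c' : K) : c *: idm (munit : C) = c' *: idm munit -> c = c'.
Proof.
move=> e; apply/eqP; rewrite -subr_eq0.
have := congr1 (fun f => f - c' *: idm munit) e; rewrite subrr -scalerBl => /eqP.
by rewrite scaler_eq0 (negPf (simple_id_neq0 (@fus_one_simple _ C))) orbF.
Qed.

Lemma tr_cyc X Y (f : hom X Y) (g : hom Y X) : tr (g \oc f) = tr (f \oc g).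
Proof.
by apply: munit_inj; rewrite -!trwE; apply: trw_cyc.
Qed.

Lemma tr_pair X (P : dual_pair X) (f : hom X X) W : trw P f W = tr f *: idm W.
Proof. by rewrite -[f in LHS]hcomp1m (trw_cyc P (cpair X)) hcompm1 trwE. Qed.

Lemma S_sym i j : S_mx (@twist K C) i j = S_mx (@twist K C) j i.
Proof. by rewrite !S_mxE tr_cyc. Qed.

Lemma S_hch i j : S_mx (@twist K C) i j = hch i (irr C j) * tr (idm (irr C i)).
Proof.
apply: munit_inj; rewrite S_mxE.
rewrite -(tr_pair (dual_pair_tens (cpair (irr C i)) (cpair (irr C j)))).
by rewrite (trw_tens (hchP i (cpair (irr C j)) _)) trwE scalerA.
Qed.

End Verlinde.

(** * Rationality and prime ideals *)

Lemma char_poly_trmx (R : comNzRingType) n (A : 'M[R]_n) : char_poly A^T = char_poly A.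
Proof.
rewrite /char_poly -[RHS]det_tr; congr determinant.
by apply/matrixP => i j; rewrite !mxE eq_sym.
Qed.

Section RationalSpectrum.
Context {K : numClosedFieldType}.

Lemma eq_trace_diag n (A P : 'M[K]_n) (a : 'rV[K]_n) :
  P \in unitmx -> A *m P = P *m diag_mx a -> \tr A = \sum_i a 0 i.
Proof.
move=> Pu e; rewrite -[A](mulmxK Pu) e mxtrace_mulC mulmxA mulVmx // mul1mx.
exact: mxtrace_diag.
Qed.

Lemma eq_det_diag n (A P : 'M[K]_n) (a : 'rV[K]_n) :
  P \in unitmx -> A *m P = P *m diag_mx a -> \det A = \prod_i a 0 i.
Proof.
move=> Pu e; rewrite -[A](mulmxK Pu) e !det_mulmx mulrAC -det_mulmx mulmxV //.
by rewrite det1 mul1r det_diag.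
Qed.

Lemma horner_mx_diagr n (A P : 'M[K]_n.+1) (a : 'rV[K]_n.+1) (f : {poly K}) :
  A *m P = P *m diag_mx a ->
  horner_mx A f *m P = P *m diag_mx (\row_i f.[a 0 i]).
Proof.
move=> e; elim/poly_ind: f => [|f c IH].
  rewrite rmorph0 mul0mx (_ : \row_i _ = 0) ?linear0 ?mulmx0 //.
  by apply/rowP => i; rewrite !mxE horner0.
rewrite rmorphD rmorphM /= horner_mx_X horner_mx_C mulmxDl.
have -> : horner_mx A f *m A *m P = P *m diag_mx (\row_i (f.[a 0 i] * a 0 i)).
  rewrite -mulmxA e mulmxA IH -mulmxA; congr (_ *m _).
  by rewrite mulmx_diag; congr diag_mx; apply/rowP => i; rewrite !mxE.
rewrite mul_scalar_mx -mul_mx_scalar -mulmxDr; congr (_ *m _).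
rewrite -diag_const_mx -linearD; congr diag_mx; apply/rowP => i.
by rewrite !mxE !hornerE.
Qed.

(* The polynomial [f = q / q(0)], where [q] is the characteristic polynomial of
   [A] stripped of its zero roots, maps [A] to the spectral projection onto the
   kernel of [A]. *)
Lemma kernel_spectrum n (A B : 'M[rat]_n) (P : 'M[K]_n) (a b : 'rV[K]_n) :
  P \in unitmx -> map_mx ratr A *m P = P *m diag_mx a ->
  map_mx ratr B *m P = P *m diag_mx b ->
  (exists q, \sum_(i | a 0 i == 0) b 0 i = ratr q) /\
  (exists q, \prod_(i | a 0 i == 0) b 0 i = ratr q).
Proof.
case: n A B P a b => [|n] A B P a b Pu eA eB.
  by split; [exists 0; rewrite rmorph0|exists 1; rewrite rmorph1]; apply: big1 => -[].
have [m [q q0 pE]] := multiplicity_XsubC (char_poly A) 0.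
have {}q0 : q.[0] != 0 by move: q0; rewrite monic_neq0 ?char_poly_monic.
pose f := q.[0]^-1 *: q; pose F := horner_mx A f.
pose fa := \row_i (map_poly (ratr : rat -> K) f).[a 0 i].
have fq i : fa 0 i = (a 0 i == 0)%:R.
  rewrite mxE map_polyZ hornerZ; case: eqP => [->|/eqP ai].
    have -> : (map_poly (ratr : rat -> K) q).[0] = ratr q.[0].
      by rewrite !horner_coef0 coef_map.
    by rewrite fmorphV /= mulVf ?fmorph_eq0.
  suff /eqP-> : root (map_poly (ratr : rat -> K) q) (a 0 i) by rewrite mulr0.
  have : root (char_poly (map_mx (ratr : rat -> K) A)) (a 0 i).
    rewrite -eigenvalue_root_char; apply/eigenvalueP.
    exists (row i (invmx P)); last first.
      apply/eqP => /(congr1 (fun v => v *m P)); rewrite -row_mul mulVmx // mul0mx.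
      by move/rowP/(_ i)/eqP; rewrite !mxE eqxx oner_eq0.
    apply: (can_inj (mulmxK Pu)); rewrite -mulmxA eA mulmxA -scalemxAl -row_mul mulVmx //.
    by rewrite row1 -rowE row_diag_mx.
  rewrite -map_char_poly pE rmorphM rmorphXn /= map_polyXsubC rmorph0 subr0.
  rewrite rootM => /orP[//|]; rewrite /root hornerXn expf_eq0 (negPf ai).
  by rewrite andbF.
have eF : map_mx ratr F *m P = P *m diag_mx fa.
  by rewrite map_horner_mx; apply: horner_mx_diagr.
split.
  exists (\tr (F *m B)); rewrite -trace_map_mx map_mxM.
  have e : map_mx ratr F *m map_mx ratr B *m P = P *m diag_mx (\row_i (fa 0 i * b 0 i)).
    by rewrite -mulmxA eB mulmxA eF -mulmxA mulmx_diag.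
  rewrite (eq_trace_diag Pu e) big_mkcond; apply: eq_bigr => i _.
  by rewrite mxE fq; case: eqP; rewrite ?mul1r ?mul0r.
(* This matrix has the eigenvalues [b] on the kernel of [A] and 1 on the other eigenvectors. *)
exists (\det (F *m B + (1%:M - F))); rewrite -det_map_mx !(map_mxD, map_mxM, map_mxN) map_mx1.
have e : (map_mx ratr F *m map_mx ratr B + (1%:M - map_mx ratr F)) *m P =
    P *m diag_mx (\row_i (fa 0 i * b 0 i + (1 - fa 0 i))).
  rewrite !mulmxDl mulNmx -mulmxA eB mulmxA eF -mulmxA mulmx_diag mul1mx.
  rewrite -[X in _ + (X - _)]mulmx1 -mulmxBr -mulmxDr; congr (_ *m _).
  rewrite -diag_const_mx -linearB -linearD; congr diag_mx; apply/rowP => i.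
  by rewrite !mxE.
rewrite (eq_det_diag Pu e) [LHS]big_mkcond; apply: eq_bigr => i _.
by rewrite mxE fq; case: eqP => _; rewrite ?mul1r ?subrr ?addr0 // mul0r add0r subr0.
Qed.

Lemma integral_eigenvalue n (A : 'M[int]_n) (v : 'cV[K]_n) x :
  v != 0 -> map_mx intr A *m v = x *: v -> integralOver (intr : int -> K) x.
Proof.
move=> v0 e; exists (char_poly A); first exact: char_poly_monic.
rewrite map_char_poly -eigenvalue_root_char.
have -> : eigenvalue (map_mx intr A : 'M[K]_n) x = eigenvalue (map_mx intr A)^T x.
  by rewrite !eigenvalue_root_char char_poly_trmx.
by apply/eigenvalueP; exists v^T; rewrite ?trmx_eq0 // -trmx_mul e linearZ.
Qed.

(** The equation has rational coefficients and a rational root, so it can be moved from [K] to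
    [algC], where rational algebraic integers are integers. *)
Lemma rat_integral (q : rat) : integralOver (intr : int -> K) (ratr q) -> q \is a Num.int.
Proof.
move=> [p mp rp].
have rq : root (map_poly (intr : int -> rat) p) q.
  rewrite -(fmorph_root (ratr : rat -> K)) -map_poly_comp.
  by rewrite (eq_map_poly (g := intr)) // => z /=; rewrite ratr_int.
have := @Cint_rat_Aint (ratr q) (Crat_rat q); rewrite Cint_rat; apply.
apply: (@root_monic_Aint (map_poly intr p)).
- rewrite (_ : map_poly intr p = map_poly ratr (map_poly intr p)) ?fmorph_root //.
  by rewrite -map_poly_comp; apply: eq_map_poly => z /=; rewrite ratr_int.
- exact: monic_map.
- by apply/polyOverP => i; rewrite coef_map /= intr_int.
Qed.

Lemma integral_sumr (J : Type) (s : seq J) (P : pred J) (F : J -> K) :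
  (forall j, P j -> integralOver (intr : int -> K) (F j)) ->
  integralOver (intr : int -> K) (\sum_(j <- s | P j) F j).
Proof.
move=> h; apply: (big_ind (integralOver (intr : int -> K))) => //; first exact: integral0.
exact: integral_add.
Qed.

Lemma integral_prodr (J : Type) (s : seq J) (P : pred J) (F : J -> K) :
  (forall j, P j -> integralOver (intr : int -> K) (F j)) ->
  integralOver (intr : int -> K) (\prod_(j <- s | P j) F j).
Proof.
move=> h; apply: (big_ind (integralOver (intr : int -> K))) => //; first exact: integral1.
exact: integral_mul.
Qed.

Lemma integral_ratr_int (q : rat) : integralOver (intr : int -> K) (ratr q) ->
  exists z : int, ratr q = z%:~R :> K.
Proof. by move/rat_integral/intrP => [z ->]; exists z; rewrite ratr_int. Qed.

End RationalSpectrum.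

(** * Prime ideals of the algebraic integers *)

Section PrimeAbove.
Context {K : numClosedFieldType}.
Local Notation aint := (integralOver (intr : int -> K)).

(** A prime ideal over [p] of the ring of all integral elements of [K], kept as a subset of [K] with
    integrality as a side condition. *)
Definition prime_above (p : nat) (P : set K) : Prop :=
  [/\ [/\ forall x, P x -> aint x,
          forall x y, P x -> P y -> P (x + y)
        & forall a x, aint a -> P x -> P (a * x)],
      P p%:R, ~ P 1
    & forall x y, aint x -> aint y -> P (x * y) -> P x \/ P y].

Lemma inv_prime_not_integral p (a : K) : prime p -> aint a -> p%:R * a <> 1.
Proof.
move=> pr_p ai pa; have p0 : p%:R != 0 :> K by rewrite pnatr_eq0 -lt0n prime_gt0.
have aE : a = ratr (p%:R^-1).
  by rewrite fmorphV /= ratr_nat; apply: (mulfI p0); rewrite pa mulfV.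
have [z zE] : exists z : int, ratr (p%:R^-1) = z%:~R :> K.
  by apply: integral_ratr_int; rewrite -aE.
have : (p%:Z * z)%:~R == 1%:~R :> K by rewrite intrM -pmulrn -zE -aE pa.
rewrite eqr_int => /eqP/(congr1 absz); rewrite abszM => /eqP.
by rewrite muln_eq1 => /andP[/eqP p1 _]; move: pr_p; rewrite -[p]absz_nat p1.
Qed.

(** Zorn's lemma for the ideals [S] such that 1 is not in the sum of [S] and the multiples of [p]; a
    maximal one contains [p] and is prime. *)
Lemma prime_above_exists p : prime p -> exists P, prime_above p P.
Proof.
move=> pr_p.
pose ideal (S : set K) := [/\ forall x, S x -> aint x,
          forall x y, S x -> S y -> S (x + y)
        & forall a x, aint a -> S x -> S (a * x)].
pose Q (S : set K) := ideal S /\ forall x a, S x \/ x = 0 -> aint a -> x + p%:R * a <> 1.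
have [F FQ tot|A [[[Aint Aadd Amul] A1] Amax]] := @Zorn_bigcup K Q.
  split; first split.
  - by move=> x [S FS Sx]; have [[h _ _] _] := FQ S FS; apply: h.
  - move=> x y [S FS Sx] [T FT Ty].
    have [ST|TS] := tot S T FS FT.
      by exists T => //; have [[_ h _] _] := FQ T FT; apply: h => //; apply: ST.
    by exists S => //; have [[_ h _] _] := FQ S FS; apply: h => //; apply: TS.
  - by move=> a x ai [S FS Sx]; exists S => //; have [[_ _ h] _] := FQ S FS; apply: h.
  - move=> x a [[S FS Sx]|->] ai; last by rewrite add0r; apply: inv_prime_not_integral.
    by have [_ h] := FQ S FS; apply: h => //; left.
have pint : aint p%:R := integral_nat _ _.
have Ap : A p%:R.
  apply: contrapT => nAp.
  (* Adjoining the multiples of [p] keeps [Q], so maximality puts [p] in [A]. *)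
  pose B : set K := fun y => exists x a, [/\ A x \/ x = 0, aint a & y = x + p%:R * a].
  have AB : (A `<=` B)%classic by move=> x Ax; exists x, 0; split; [left|exact: integral0|rewrite mulr0 addr0].
  apply: (Amax B).
    split=> [|eqAB] //; apply: nAp; apply: eqAB.
    by exists 0, 1; split; [right|exact: integral1|rewrite add0r mulr1].
  have A0add x y : A x \/ x = 0 -> A y \/ y = 0 -> A (x + y) \/ x + y = 0.
    move=> [Ax|->] [Ay|->]; rewrite ?addr0 ?add0r; [|by left|by left|by right].
    by left; apply: Aadd.
  have A0mul a x : aint a -> A x \/ x = 0 -> A (a * x) \/ a * x = 0.
    by move=> ai [Ax|->]; [left; apply: Amul|right; rewrite mulr0].
  split; first split.
  - move=> y [x [a [Ax ai ->]]]; apply: integral_add; last exact: integral_mul.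
    by case: Ax => [/Aint//|->]; exact: integral0.
  - move=> y y' [x [a [Ax ai ->]]] [x' [a' [Ax' ai' ->]]].
    by exists (x + x'), (a + a'); split; [exact: A0add|exact: integral_add|ring].
  - move=> b y bi [x [a [Ax ai ->]]].
    by exists (b * x), (b * a); split; [exact: A0mul|exact: integral_mul|ring].
  - move=> y b [[x [a [Ax ai ->]]]|->] bi; last by rewrite add0r; apply: inv_prime_not_integral.
    by rewrite -addrA -mulrDr; apply: A1 => //; apply: integral_add.
have A0 : A 0 by rewrite -[0](mul0r p%:R); apply: Amul => //; apply: integral0.
exists A; split=> // [A11|x y xi yi Axy].
  by apply: (A1 1 0); [left|exact: integral0|rewrite mulr0 addr0].
apply: contrapT => /not_orP[nAx nAy].
(* Adjoining [x] must break [Q]: otherwise [A] would not be maximal. A relation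
   [u + x * a + p * b = 1] multiplied by [y] would put [y] in [A]. *)
pose B : set K := fun z => exists u a, [/\ A u, aint a & z = u + x * a].
have AB : (A `<=` B)%classic by move=> u Au; exists u, 0; split; [|exact: integral0|rewrite mulr0 addr0].
have B0 : B 0 by apply: AB.
have nQB := Amax B; apply: nQB.
  split=> [|eqAB] //; apply: nAx; apply: eqAB.
  by exists 0, 1; split; [|exact: integral1|rewrite add0r mulr1].
split; first split.
- by move=> z [u [a [Au ai ->]]]; apply: integral_add; [exact: Aint|exact: integral_mul].
- move=> z z' [u [a [Au ai ->]]] [u' [a' [Au' ai' ->]]].
  by exists (u + u'), (a + a'); split; [exact: Aadd|exact: integral_add|ring].
- move=> b z bi [u [a [Au ai ->]]].
  by exists (b * u), (b * a); split; [exact: Amul|exact: integral_mul|ring].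
- move=> z b Bz bi e.
  have {Bz} [u [a [Au ai zE]]] : B z by case: Bz => // ->.
  apply: nAy; have -> : y = y * u + (a * (x * y) + (y * b) * p%:R).
    by have e' : y = y * (z + p%:R * b) by [rewrite e mulr1]; rewrite {1}e' zE; ring.
  apply: (Aadd); first exact: Amul.
  by apply: Aadd; apply: Amul => //; apply: integral_mul.
Qed.

Variables (p : nat) (P : set K).
Hypothesis PP : prime_above p P.
Hypothesis pr_p : prime p.

Lemma P_add x y : P x -> P y -> P (x + y).
Proof. by have [[_ h _] _ _ _] := PP; apply: h. Qed.
Lemma P_mul a x : aint a -> P x -> P (a * x).
Proof. by have [[_ _ h] _ _ _] := PP; apply: h. Qed.
Lemma P_p : P p%:R. Proof. by have [_ h _ _] := PP. Qed.
Lemma P_1 : ~ P 1. Proof. by have [_ _ h _] := PP. Qed.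
Lemma P_prime x y : aint x -> aint y -> P (x * y) -> P x \/ P y.
Proof. by have [_ _ _ h] := PP; apply: h. Qed.
Lemma P_0 : P 0. Proof. by rewrite -[0](mul0r p%:R); apply/P_mul/P_p/integral0. Qed.
Lemma P_opp x : P x -> P (- x).
Proof. by rewrite -mulN1r; apply/P_mul/integral_opp/integral1. Qed.
Lemma P_sub x y : P x -> P y -> P (x - y).
Proof. by move=> Px /P_opp; apply: P_add. Qed.

Lemma P_sum (I : Type) (s : seq I) (Q : pred I) F :
  (forall i, Q i -> P (F i)) -> P (\sum_(i <- s | Q i) F i).
Proof. by move=> h; apply: (big_ind P) => //; [exact: P_0|exact: P_add]. Qed.

Lemma P_prod (I : Type) (s : seq I) (Q : pred I) F :
  (forall i, Q i -> aint (F i)) -> (forall i, Q i -> ~ P (F i)) ->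
  ~ P (\prod_(i <- s | Q i) F i).
Proof.
move=> Fi h; suff [] : aint (\prod_(i <- s | Q i) F i) /\ ~ P (\prod_(i <- s | Q i) F i) by [].
apply: (big_ind (fun x => aint x /\ ~ P x)) => [|x y [xi nx] [yi ny]|i Qi].
- by split; [exact: integral1|exact: P_1].
- by split; [exact: integral_mul|case/P_prime].
- by split; [exact: Fi|exact: h].
Qed.

Lemma P_exp x n : aint x -> P (x ^+ n) -> P x.
Proof.
move=> xi; elim: n => [/P_1//|n IH]; rewrite exprS => /P_prime[] //.
by elim: n {IH} => [|n IH]; [rewrite expr0; exact: integral1|rewrite exprS; exact: integral_mul].
Qed.

Lemma P_nat k : P k%:R -> (p %| k)%N.
Proof.
move=> Pk; apply/negPn/negP; rewrite -prime_coprime // coprime_sym => cop.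
have k0 : (0 < k)%N.
  by rewrite lt0n; apply: contraL cop => /eqP ->; rewrite /coprime gcd0n; case: p pr_p => [|[]].
case: (egcdnP p k0) => a b e _; move: e; rewrite (eqP cop) => e.
apply: P_1; have -> : 1 = a%:R * k%:R - b%:R * p%:R :> K.
  by rewrite -!natrM e natrD addrAC subrr add0r.
by apply: P_sub; apply: P_mul; [exact: integral_nat| |exact: integral_nat|exact: P_p].
Qed.

End PrimeAbove.

(** * Dimensions of simple objects *)

Lemma prod_le1_eq1 (K : numDomainType) (I : finType) (P : pred I) (F : I -> K) :
  (forall i, P i -> 0 < F i <= 1) -> 1 <= \prod_(i | P i) F i ->
  forall i, P i -> F i = 1.
Proof.
move=> F01 ge1 i Pi; have /andP[Fi0 Fi1] := F01 i Pi.
apply/eqP; rewrite eq_le Fi1 /=; apply: le_trans ge1 _.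
rewrite (bigD1 i) //= ler_piMr ?(ltW Fi0) //; apply: prodr_ile1 => j /andP[Pj _].
by have /andP[Fj0 Fj1] := F01 j Pj; rewrite (ltW Fj0).
Qed.

Lemma psumr_eq_le (K : numDomainType) (I : finType) (P : pred I) (F G : I -> K) :
  (forall i, P i -> F i <= G i) -> \sum_(i | P i) F i = \sum_(i | P i) G i ->
  forall i, P i -> F i = G i.
Proof.
move=> le e i Pi; apply/esym/eqP; rewrite -subr_eq0.
have : \sum_(j | P j) (G j - F j) == 0 by rewrite sumrB e subrr.
rewrite psumr_eq0 => [/allP/(_ i)|j Pj]; last by rewrite subr_ge0 le.
by rewrite mem_index_enum Pi => /(_ isT).
Qed.

Section ModularNumbers.
Context {K : numClosedFieldType} {r : nat}.
Local Notation I := 'I_r.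
(** Unit, fusion coefficients, duality, and the value [chi i j] on the simple object [j] of the
    character attached to [i]. In [chi_sym], which is the symmetry of the S-matrix, [chi o i] is the
    dimension of [i] up to a common factor. *)
Variables (o : I) (N : I -> I -> I -> nat) (st : I -> I) (chi : I -> I -> K).
Hypothesis N1 : forall i j, N o i j = (i == j).
Hypothesis NC : forall i j k, N i j k = N j i k.
Hypothesis ND : forall i j k, N i j k = N (st i) k j.
Hypothesis chi1 : forall i, chi i o = 1.
Hypothesis chiM : forall i j k, chi i j * chi i k = \sum_l (N j k l)%:R * chi i l.
Hypothesis chi_sym : forall i j, chi i j * chi o i = chi j i * chi o j.
Hypothesis chi_inj : forall i j, chi i =1 chi j -> i = j.
Hypothesis chi_o_neq0 : forall i, chi o i != 0.

Lemma N_unit i j : N i j o = (j == st i).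
Proof. by rewrite ND NC N1 eq_sym. Qed.

Lemma stK : involutive st.
Proof.
move=> i; have := N_unit i (st i); rewrite eqxx NC N_unit.
by case: eqP.
Qed.

(** Multiplication by [st j] is adjoint to multiplication by [j] when the simple objects are
    orthonormal, and [chi i] is an eigenvector of both; compare the two on its positive norm [n]. *)
Lemma chi_st i j : chi i (st j) = (chi i j)^*.
Proof.
pose n := \sum_k chi i k * (chi i k)^*.
have n0 : n != 0.
  rewrite /n (bigD1 o) //= chi1 conjC1 mulr1 gt_eqF // ltr_wpDr //.
  by apply: sumr_ge0 => k _; apply: mul_conjC_ge0.
apply: (mulIf n0); rewrite /n !mulr_sumr.
transitivity (\sum_k \sum_l (N (st j) k l)%:R * chi i l * (chi i k)^*).
  by apply: eq_bigr => k _; rewrite mulrA chiM mulr_suml.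
rewrite exchange_big; apply: eq_bigr => l _ /=.
have -> : chi i l * (chi i l)^* = (chi i l)^* * chi i l by rewrite mulrC.
rewrite mulrA -rmorphM /= chiM rmorph_sum mulr_suml; apply: eq_bigr => k _ /=.
by rewrite rmorphM /= conjC_nat ND stK mulrAC.
Qed.

Lemma chi_orth i j : i != j -> \sum_k chi i k * (chi j k)^* = 0.
Proof.
move=> nij; set n := \sum_k _.
have e m : chi i m * n = chi j m * n.
  transitivity (\sum_k \sum_l (N m k l)%:R * chi i l * (chi j k)^*).
    by rewrite mulr_sumr; apply: eq_bigr => k _; rewrite mulrA chiM mulr_suml.
  rewrite exchange_big mulr_sumr; apply: eq_bigr => l _ /=.
  rewrite [RHS]mulrCA; transitivity (chi i l * (chi j (st m) * chi j l)^*).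
    rewrite chiM rmorph_sum mulr_sumr; apply: eq_bigr => k _ /=.
    by rewrite rmorphM /= conjC_nat ND mulrCA mulrA.
  by rewrite rmorphM /= chi_st conjCK.
apply/eqP/negPn/negP => n0; case/eqP: nij; apply: chi_inj => m.
exact: mulIf n0 _ _ (e m).
Qed.

(** The formal codegree of the character [chi i]. *)
Definition codeg i : K := \sum_k `|chi i k| ^+ 2.

Lemma codegE i : codeg i = \sum_k chi i k * (chi i k)^*.
Proof. by apply: eq_bigr => k _; rewrite normCK. Qed.

Lemma codeg_gt0 i : 0 < codeg i.
Proof.
rewrite /codeg (bigD1 o) //= chi1 normr1 expr1n ltr_wpDr //.
by apply: sumr_ge0 => k _; rewrite exprn_ge0.
Qed.

Lemma chi_orthE i j : \sum_k chi i k * (chi j k)^* = (i == j)%:R * codeg i.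
Proof. by case: eqP => [<-|/eqP/chi_orth ->]; rewrite ?mul0r // mul1r codegE. Qed.

(** Row orthogonality says that [Y] is a right inverse of the square matrix [X]; it is then also a
    left inverse. *)
Lemma chi_orth2 k l : \sum_j (chi j k)^* * chi j l / codeg j = (k == l)%:R.
Proof.
pose X := \matrix_(i, j) chi i j; pose Y := \matrix_(k, i) ((chi i k)^* / codeg i).
have : X *m Y = 1%:M.
  apply/matrixP => i j; rewrite !mxE.
  transitivity ((\sum_k chi i k * (chi j k)^*) / codeg j).
    by rewrite mulr_suml; apply: eq_bigr => m _; rewrite !mxE mulrA.
  rewrite chi_orthE; case: eqP => [->|_]; last by rewrite !mul0r.
  by rewrite mul1r divff // gt_eqF ?codeg_gt0.
move/mulmx1C/matrixP/(_ k l); rewrite !mxE => <-.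
by apply: eq_bigr => j _; rewrite !mxE mulrAC.
Qed.

Definition sqd i : K := `|chi o i| ^+ 2.
Definition gdim : K := codeg o.

Lemma sqd_gt0 i : 0 < sqd i.
Proof. by rewrite exprn_gt0 // normr_gt0. Qed.

(** With [s] the symmetric rescaling of the character table and [T] its adjoint, both [S *m T] and
    [T *m S] equal the diagonal matrix [U], by row and column orthogonality. So [U] commutes with
    [S], and a row of [S] without zeros makes [U] constant. *)
Lemma sqd_codeg i : sqd i * codeg i = gdim.
Proof.
pose s i j := chi i j * chi o i.
have s_sym i' j : s i' j = s j i' by apply: chi_sym.
pose u i := sqd i * codeg i.
have u0 j : u j != 0 by rewrite gt_eqF // mulr_gt0 ?sqd_gt0 ?codeg_gt0.
pose S := \matrix_(i, j) s i j; pose T := \matrix_(i, j) (s j i)^*.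
pose U := \row_i u i; pose V := \row_i (u i)^-1.
have ST : S *m T = diag_mx U.
  apply/matrixP => i' j; rewrite !mxE.
  transitivity (chi o i' * (chi o j)^* * \sum_k chi i' k * (chi j k)^*).
    rewrite mulr_sumr; apply: eq_bigr => k _; rewrite !mxE /s rmorphM /=.
    by rewrite mulrACA mulrC.
  rewrite chi_orthE; case: eqP => [->|_]; last by rewrite mul0r mulr0 mulr0n.
  by rewrite mul1r mulr1n /u /sqd normCK.
have SVT : S *m (diag_mx V *m T) = 1%:M.
  apply/matrixP => i' j; rewrite !mxE eq_sym -(chi_orth2 j i').
  apply: eq_bigr => k _; rewrite mul_diag_mx !mxE (s_sym i' k) (s_sym j k) /s /u /sqd normCK.
  rewrite rmorphM /=; have := chi_o_neq0 k; move: (codeg_gt0 k).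
  move=> /lt0r_neq0 c0 d0; have d0' : (chi o k)^* != 0 by rewrite conjC_eq0.
  by field; rewrite c0 d0 d0'.
have TS : T *m S = diag_mx U.
  have VU : diag_mx U *m diag_mx V = 1%:M.
    rewrite mulmx_diag -diag_const_mx; congr diag_mx; apply/rowP => k.
    by rewrite !mxE divff.
  by rewrite -[LHS]mul1mx -VU -!mulmxA [X in _ *m X]mulmxA (mulmx1C SVT) mulmx1.
have /matrixP/(_ o i) : S *m diag_mx U = diag_mx U *m S by rewrite -{1}TS mulmxA ST.
rewrite mul_mx_diag mul_diag_mx !mxE mulrC /s chi1 mulr1 => /(mulIf (chi_o_neq0 i)).
by rewrite /u /sqd chi1 normr1 expr1n mul1r.
Qed.

Lemma exists_max_norm (F : I -> K) : exists i0, forall i, `|F i| <= `|F i0|.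
Proof.
suff [i0 i0P] : exists i0, forall i, i \in enum I -> `|F i| <= `|F i0|.
  by exists i0 => i; apply: i0P; rewrite mem_enum.
elim: (enum I) => [|j e [i0 i0P]]; first by exists o.
have [le|le] := real_leP (normr_real (F i0)) (normr_real (F j)).
  exists j => i; rewrite inE => /orP[/eqP->//|/i0P h].
  exact: le_trans h le.
by exists i0 => i; rewrite inE => /orP[/eqP->|/i0P //]; apply: ltW.
Qed.

(** The characters are an orthogonal eigenbasis, with eigenvalues [e]; expanding [v] in it gives the
    bound. *)
Lemma form_bound (A : I -> I -> nat) (e : I -> K) (v : I -> K) mu :
  (forall i k, \sum_l (A k l)%:R * chi i l = e i * chi i k) ->
  (forall i, `|e i| <= mu) ->
  `|\sum_k (v k)^* * \sum_l (A k l)%:R * v l| <= mu * \sum_k `|v k| ^+ 2.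
Proof.
move=> eA le_mu.
pose a i := (\sum_k (chi i k)^* * v k) / codeg i.
have vE k : v k = \sum_i a i * chi i k.
  transitivity (\sum_l (\sum_i (chi i l)^* * chi i k / codeg i) * v l).
    rewrite (bigD1 k) //= chi_orth2 eqxx mul1r big1 ?addr0 // => l nlk.
    by rewrite chi_orth2 (negPf nlk) mul0r.
  under eq_bigr => l _ do rewrite mulr_suml.
  rewrite exchange_big; apply: eq_bigr => i _ /=; rewrite /a !mulr_suml.
  by apply: eq_bigr => l _; rewrite mulrAC [RHS]mulrAC; congr (_ / _); rewrite mulrAC.
clearbody a; have vv (b c : I -> K) : \sum_k (\sum_i b i * chi i k)^* * (\sum_i c i * chi i k) =
    \sum_i (b i)^* * c i * codeg i.
  transitivity (\sum_k \sum_i \sum_j (b i)^* * c j * (chi j k * (chi i k)^*)).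
    apply: eq_bigr => k _; rewrite rmorph_sum mulr_suml; apply: eq_bigr => i _.
    rewrite mulr_sumr; apply: eq_bigr => j _; rewrite rmorphM /=.
    by rewrite mulrACA [chi j k * _]mulrC.
  rewrite exchange_big; apply: eq_bigr => i _; rewrite exchange_big /=.
  under eq_bigr => j _ do rewrite -mulr_sumr chi_orthE.
  rewrite (bigD1 i) //= eqxx mul1r big1 ?addr0 // => j /negPf ->.
  by rewrite mul0r mulr0.
have -> : \sum_k (v k)^* * (\sum_l (A k l)%:R * v l) =
    \sum_i (a i)^* * (e i * a i) * codeg i.
  rewrite -vv; apply: eq_bigr => k _; rewrite -vE; congr (_ * _).
  under eq_bigr => l _ do rewrite vE mulr_sumr.
  rewrite exchange_big; apply: eq_bigr => i _ /=.
  rewrite mulrAC -eA mulr_suml; apply: eq_bigr => l _.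
  by rewrite mulrA mulrAC.
have -> : \sum_k `|v k| ^+ 2 = \sum_i `|a i| ^+ 2 * codeg i.
  transitivity (\sum_k (v k)^* * v k).
    by apply: eq_bigr => k _; rewrite normCK mulrC.
  under eq_bigr => k _ do rewrite (vE k).
  by rewrite vv; apply: eq_bigr => i _; congr (_ * _); rewrite normCK mulrC.
rewrite mulr_sumr; apply: le_trans (ler_norm_sum _ _ _) _.
apply: ler_sum => i _; rewrite !normrM norm_conjC (gtr0_norm (codeg_gt0 i)).
rewrite [mu * _]mulrA ler_wpM2r ?(ltW (codeg_gt0 i)) // mulrCA -expr2.
by rewrite ler_wpM2r ?exprn_ge0.
Qed.

(* Among the characters, the one maximising the absolute value of the sum of all
   the simple objects is positive: the matrix of that sum is hermitian with
   positive entries. *)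
Lemma positive_chi : exists i0, forall l, 0 < chi i0 l.
Proof.
pose A k l := (\sum_m N m k l)%N.
pose e i := \sum_k chi i k.
have eA i k : \sum_l (A k l)%:R * chi i l = e i * chi i k.
  rewrite /e mulr_suml; under [RHS]eq_bigr => m _ do rewrite chiM.
  rewrite exchange_big; apply: eq_bigr => l _.
  by rewrite natr_sum mulr_suml.
have [i0 i0P] := exists_max_norm e; exists i0.
pose mu := `|e i0|; pose a k := `|chi i0 k|.
have := form_bound a eA i0P.
have le1 k : mu * a k <= \sum_l (A k l)%:R * a l.
  rewrite /mu -normrM -eA; apply: le_trans (ler_norm_sum _ _ _) _.
  by apply: ler_sum => l _; rewrite normrM normr_nat.
have a0 k : 0 <= a k by apply: normr_ge0.
have an k : `|a k| = a k by rewrite ger0_norm.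
rewrite ger0_norm; last first.
  apply: sumr_ge0 => k _; rewrite conj_normC mulr_ge0 //.
  by apply: sumr_ge0 => l _; rewrite mulr_ge0 // ler0n.
rewrite mulr_sumr -subr_ge0 -sumrB => le2.
have ge0 k : 0 <= (a k)^* * (\sum_l (A k l)%:R * a l) - mu * `|a k| ^+ 2.
  rewrite an conj_normC expr2 mulrA [mu * _ * _]mulrC -mulrBr mulr_ge0 //.
  by rewrite subr_ge0.
have {le2} eq0 : (a o)^* * (\sum_l (A o l)%:R * a l) - mu * `|a o| ^+ 2 = 0.
  apply/eqP; have : \sum_k ((a k)^* * (\sum_l (A k l)%:R * a l) - mu * `|a k| ^+ 2) == 0.
    rewrite eq_le -oppr_ge0 -sumrN; apply/andP; split; last by apply: sumr_ge0.
    by move: le2; congr (0 <= _); apply: eq_bigr => k _; rewrite opprB.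
  by rewrite psumr_eq0 // => /allP/(_ o); rewrite mem_index_enum => /(_ isT).
have A1 l : A o l = 1%N.
  rewrite /A (bigD1 l) //= NC N1 eqxx big1 // => m nml.
  by rewrite NC N1 (negPf nml).
have ao : a o = 1 by rewrite /a chi1 normr1.
(* The matrix has only ones in row [o], so equality there is equality in the triangle inequality:
   all values point in the direction of [chi i0 o], which is 1. *)
have : `|\sum_l chi i0 l| = \sum_l `|chi i0 l|.
  move/eqP: eq0; rewrite ao conjC1 mul1r normr1 expr1n mulr1 subr_eq0 => /eqP.
  by under eq_bigr => l _ do rewrite A1 mul1r.
move/normC_sum_eq => [t _ tP].
have t1 : t = 1 by have := tP o isT; rewrite chi1 normr1 mul1r.
move=> l; have -> : chi i0 l = `|chi i0 l| by rewrite {1}(tP l isT) t1 mulr1.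
rewrite normr_gt0; apply/negP => /eqP cl.
(* A zero value would kill a sum of nonnegative terms to which the unit contributes 1. *)
have := chiM i0 l (st l); rewrite cl mul0r => /esym/eqP.
rewrite psumr_eq0 => [/allP/(_ o)|m _]; last first.
  by rewrite (tP m isT) t1 mulr1 mulr_ge0 // ler0n.
rewrite mem_index_enum => /(_ isT); rewrite /= N_unit eqxx chi1 mulr1.
by rewrite oner_eq0.
Qed.

Lemma chi_unitmx : \matrix_(k, i) chi i k \in unitmx.
Proof.
have : (\matrix_(k, i) chi i k)^T *m (\matrix_(k, i) ((chi i k)^* / codeg i)) = 1%:M.
  apply/matrixP => i j; rewrite !mxE.
  transitivity ((\sum_k chi i k * (chi j k)^*) / codeg j).
    by rewrite mulr_suml; apply: eq_bigr => m _; rewrite !mxE mulrA.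
  rewrite chi_orthE; case: eqP => [->|_]; last by rewrite !mul0r.
  by rewrite mul1r divff // gt_eqF ?codeg_gt0.
by move=> /mulmx1_unit[]; rewrite unitmx_tr.
Qed.

(** The character [chi i] on the element of the fusion ring with coordinates [b]. *)
Definition val i (b : I -> int) : K := \sum_k (b k)%:~R * chi i k.

Lemma val_eigen (b : I -> int) i k :
  \sum_m (\sum_l b l * (N l k m)%:Z)%:~R * chi i m = val i b * chi i k.
Proof.
rewrite /val mulr_suml; under [RHS]eq_bigr => l _ do rewrite -mulrA chiM mulr_sumr.
rewrite exchange_big; apply: eq_bigr => m _; rewrite rmorph_sum mulr_suml.
by apply: eq_bigr => l _; rewrite rmorphM /= -pmulrn mulrA.
Qed.

Lemma val_integral i b : integralOver (intr : int -> K) (val i b).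
Proof.
apply: (@integral_eigenvalue _ _ (\matrix_(k, m) \sum_l b l * (N l k m)%:Z) (\col_k chi i k)).
  by apply/eqP => /colP/(_ o)/eqP; rewrite !mxE chi1 oner_eq0.
apply/colP => k; rewrite !mxE -val_eigen; apply: eq_bigr => m _; rewrite !mxE.
by [].
Qed.

Lemma val_delta i k : val i (fun l => (l == k)%:Z) = chi i k.
Proof.
rewrite /val (bigD1 k) //= eqxx mul1r big1 ?addr0 // => l /negPf ->.
by rewrite mul0r.
Qed.

Lemma chi_integral i k : integralOver (intr : int -> K) (chi i k).
Proof. by rewrite -val_delta; apply: val_integral. Qed.

(** [M c] is the rational matrix of multiplication by [c], and the characters diagonalise all of
    these at once. [kernel_spectrum] gives rational numbers, and integrality of the values makes
    them integers. *)
Lemma val_spectrum (a b : I -> int) :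
  (exists z : int, \sum_(i | val i a == 0) val i b = z%:~R) /\
  (exists z : int, \prod_(i | val i a == 0) val i b = z%:~R).
Proof.
pose M (c : I -> int) : 'M[rat]_r := \matrix_(k, m) \sum_l (c l)%:~R * (N l k m)%:R.
have eM c : map_mx ratr (M c) *m (\matrix_(k, i) chi i k) =
    (\matrix_(k, i) chi i k) *m diag_mx (\row_i val i c).
  apply/matrixP => k i; rewrite mul_mx_diag !mxE mulrC -val_eigen.
  apply: eq_bigr => m _; rewrite !mxE; congr (_ * _).
  rewrite !rmorph_sum; apply: eq_bigr => l _; rewrite !rmorphM /= ratr_int ratr_nat.
  by rewrite -pmulrn.
have [[q qE] [q' q'E]] := kernel_spectrum chi_unitmx (eM a) (eM b).
have {}qE : \sum_(i | val i a == 0) val i b = ratr q.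
  by rewrite -qE; apply: eq_big => i; rewrite mxE.
have {}q'E : \prod_(i | val i a == 0) val i b = ratr q'.
  by rewrite -q'E; apply: eq_big => i; rewrite mxE.
split.
  rewrite qE; apply: integral_ratr_int; rewrite -qE.
  by apply: integral_sumr => i _; apply: val_integral.
rewrite q'E; apply: integral_ratr_int; rewrite -q'E.
by apply: integral_prodr => i _; apply: val_integral.
Qed.

Definition sqel k : I -> int := fun m => (N k (st k) m)%:Z.

Lemma val_sqel i k : val i (sqel k) = `|chi i k| ^+ 2.
Proof. by rewrite normCK -chi_st chiM. Qed.

Lemma val_lin i (x y : int) (a b : I -> int) :
  val i (fun k => x * a k + y * b k) = x%:~R * val i a + y%:~R * val i b.
Proof.
rewrite /val !mulr_sumr -big_split /=; apply: eq_bigr => k _.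
by rewrite rmorphD !rmorphM /= mulrDl !mulrA.
Qed.

(** The Casimir element, the sum of all products of a simple object with its dual; its values are
    the codegrees. *)
Definition casel : I -> int := fun m => \sum_k sqel k m.

Lemma val_casel i : val i casel = codeg i.
Proof.
rewrite /codeg; under [RHS]eq_bigr => k _ do rewrite -val_sqel.
rewrite exchange_big; apply: eq_bigr => m _.
by rewrite rmorph_sum mulr_suml.
Qed.

Section Perron.
Variables (i0 : I) (n : nat).
Hypothesis f_gt0 : forall l, 0 < chi i0 l.
Hypothesis sum_f : \sum_l chi i0 l ^+ 2 = n%:R.
Let f l := chi i0 l.

(** Perron's comparison: choose [m] maximising the ratio [rho] of [|chi i m|] to [f m], and estimate
    the product of the values at [l] and [m] by multiplicativity of both characters. *)
Lemma chi_le i l : `|chi i l| <= f l.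
Proof.
have [m mP] := exists_max_norm (fun m => chi i m / f m).
set rho := `|_| in mP.
have le k : `|chi i k| <= rho * f k.
  by have := mP k; rewrite normrM normfV (gtr0_norm (f_gt0 k)) ler_pdivrMr ?f_gt0.
have rho0 : rho != 0.
  rewrite gt_eqF // (lt_le_trans _ (mP o)) // normr_gt0 /f !chi1 divr1.
  exact: oner_neq0.
have mE : `|chi i m| = rho * f m.
  by rewrite /rho normrM normfV (gtr0_norm (f_gt0 m)) divfK // gt_eqF ?f_gt0.
rewrite -(ler_pM2r (_ : 0 < `|chi i m|)); last first.
  by rewrite mE mulr_gt0 ?f_gt0 // lt_def rho0 normr_ge0.
rewrite -normrM chiM mE mulrCA [f l * _]chiM mulr_sumr; apply: le_trans (ler_norm_sum _ _ _) _.
by apply: ler_sum => k _; rewrite normrM normr_nat mulrCA ler_wpM2l ?ler0n.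
Qed.

Lemma sq_le i l : `|chi i l| ^+ 2 <= f l ^+ 2.
Proof. by rewrite ler_pXn2r ?nnegrE ?normr_ge0 ?(ltW (f_gt0 l)) ?chi_le. Qed.

Lemma codeg_i0 : codeg i0 = n%:R.
Proof. by rewrite -sum_f; apply: eq_bigr => l _; rewrite gtr0_norm. Qed.

Lemma codeg_le i : codeg i <= n%:R.
Proof. by rewrite -sum_f; apply: ler_sum => l _; apply: sq_le. Qed.

Lemma n_gt0 : 0 < n%:R :> K.
Proof. by rewrite -codeg_i0 codeg_gt0. Qed.

(* [codeg i / n] is an algebraic integer in the interval ]0, 1] whenever it equals
   [|chi i i0|^2], which holds for a set of [i] stable under conjugation. *)
Lemma gdimE : gdim = n%:R.
Proof.
have gn : gdim = sqd i0 * n%:R by rewrite -codeg_i0 sqd_codeg.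
(* This element vanishes at [i] exactly when [n%:R * |chi i i0|^2 = codeg i]. The unit is such an
   [i] by [sqd_codeg], and on all of them the factor [|chi i i0|^2] is at most 1 because [codeg i]
   is at most [n]. *)
pose a k := n%:Z * sqel i0 k + (- 1) * casel k.
have aE i : (val i a == 0) = (n%:R * `|chi i i0| ^+ 2 == codeg i).
  by rewrite val_lin val_sqel val_casel rmorphN1 mulN1r subr_eq0.
have [_ [z zE]] := val_spectrum a (sqel i0).
have F01 i : val i a == 0 -> 0 < val i (sqel i0) <= 1.
  rewrite aE val_sqel => /eqP e; have c0 := codeg_gt0 i.
  rewrite -(pmulr_rgt0 _ n_gt0) e c0 /=.
  by rewrite -(ler_pM2l n_gt0) e mulr1 codeg_le.
have ge1 : 1 <= \prod_(i | val i a == 0) val i (sqel i0).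
  have : 0 < \prod_(i | val i a == 0) val i (sqel i0).
    by apply: prodr_gt0 => i /F01/andP[].
  by rewrite zE ltr0z (ler1z K).
have vo : val o a == 0 by rewrite aE mulrC -/(sqd i0) -gn.
have := prod_le1_eq1 F01 ge1 vo; rewrite val_sqel -/(sqd i0) gn => ->.
exact: mul1r.
Qed.

Lemma sqd_f l : sqd l = f l ^+ 2.
Proof.
apply: (psumr_eq_le (P := predT) (fun l _ => sq_le o l)) => //.
by rewrite -/(codeg o) -/gdim gdimE -sum_f.
Qed.

(** On the characters of largest codegree [n], termwise comparison makes [|chi i l|^2] equal to
    [f l ^+ 2]. Its sum over these [c] characters is an integer, so [f l ^+ 2] is rational, and it
    is an algebraic integer. *)
Lemma sqd_nat l : exists k : nat, sqd l = k%:R.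
Proof.
pose a k := (- n%:Z) * (k == o)%:Z + 1 * casel k.
have aE i : (val i a == 0) = (codeg i == n%:R).
  rewrite val_lin val_delta chi1 val_casel mulr1 mul1r rmorphN /= addrC.
  by rewrite subr_eq0.
have [[z zE] _] := val_spectrum a (sqel l).
have Jf i : val i a == 0 -> val i (sqel l) = f l ^+ 2.
  rewrite aE val_sqel => /eqP e.
  apply: (psumr_eq_le (P := predT) (fun l _ => sq_le i l)) => //.
  by rewrite -/(codeg i) e -sum_f.
move: zE; rewrite (eq_bigr _ Jf) sumr_const; set c := #|_| => zE.
have c0 : (0 < c)%N.
  suff h : val i0 a == 0 by apply/card_gt0P; exists i0.
  by rewrite aE codeg_i0.
have fE : f l ^+ 2 = ratr (z%:~R / c%:R).
  rewrite fmorph_div /= ratr_int ratr_nat -zE -(mulr_natr (f l ^+ 2)) mulfK //.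
  by rewrite pnatr_eq0 -lt0n.
have [|y yE] := @integral_ratr_int K (z%:~R / c%:R).
  by rewrite -fE expr2; apply: integral_mul; apply: chi_integral.
rewrite sqd_f fE yE; move: (exprn_gt0 2 (f_gt0 l)).
rewrite -/(f l) fE yE ltr0z; case: y {yE} => // k _; exists k.
by rewrite -pmulrn.
Qed.

Definition kk l : nat := sval (cid (sqd_nat l)).
Lemma kkE l : sqd l = (kk l)%:R. Proof. exact: svalP (cid (sqd_nat l)). Qed.

Lemma kk_gt0 l : (0 < kk l)%N.
Proof. by rewrite -(ltr0n K) -kkE sqd_gt0. Qed.

Lemma f_kk l : f l ^+ 2 = (kk l)%:R. Proof. by rewrite -kkE sqd_f. Qed.

Lemma kk_o : kk o = 1%N.
Proof. by apply/eqP; rewrite -(eqr_nat K) -f_kk /f chi1 expr1n. Qed.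

Lemma kk_codeg l : (kk l)%:R * codeg l = n%:R.
Proof. by rewrite -kkE sqd_codeg gdimE. Qed.

Lemma sum_kk : (\sum_l kk l = n)%N.
Proof.
by apply/eqP; rewrite -(eqr_nat K) natr_sum -sum_f; apply/eqP/eq_bigr => l _; rewrite f_kk.
Qed.

Lemma sum_kk_chi2 k l : \sum_j (kk j)%:R * ((chi j k)^* * chi j l) = n%:R * (k == l)%:R.
Proof.
rewrite -chi_orth2 mulr_sumr; apply: eq_bigr => j _.
rewrite -(kk_codeg j); have c0 : codeg j != 0 by rewrite gt_eqF ?codeg_gt0.
by field.
Qed.

Lemma sum_kk_chi k : \sum_j (kk j)%:R * chi j k = n%:R * (k == o)%:R.
Proof.
rewrite eq_sym -sum_kk_chi2; apply: eq_bigr => j _.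
by rewrite chi1 conjC1 mul1r.
Qed.

Lemma sum_kk_norm l : \sum_j (kk j)%:R * `|chi j l| ^+ 2 = n%:R.
Proof.
transitivity (n%:R * (l == l)%:R : K); last by rewrite eqxx mulr1.
rewrite -sum_kk_chi2; apply: eq_bigr => j _; congr (_ * _).
by rewrite normCK mulrC.
Qed.

Lemma chi_col_inj k l : chi^~ k =1 chi^~ l -> k = l.
Proof.
move=> e; apply/eqP/negPn/negP => nkl.
have := sum_kk_chi2 k l; rewrite (negPf nkl) mulr0 => /eqP.
have -> : \sum_j (kk j)%:R * ((chi j k)^* * chi j l) = \sum_j (kk j)%:R * ((chi j k)^* * chi j k).
  by apply: eq_bigr => j _; rewrite -(e j).
by rewrite sum_kk_chi2 eqxx mulr1 gt_eqF ?n_gt0.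
Qed.

(* The arithmetic-geometric mean inequality, applied to each set of characters
   of a given degree, on which the product of the values is an integer. *)
Lemma nonvanishing_invertible l : (forall j, chi j l != 0) -> kk l = 1%N.
Proof.
move=> nz.
pose E j := `|chi j l| ^+ 2; pose A v := [pred j | kk j == v].
have E0 j : 0 < E j by rewrite exprn_gt0 // normr_gt0.
have sumE : \sum_j (kk j)%:R * E j = n%:R by apply: sum_kk_norm.
have prodE v : 1 <= \prod_(j in A v) E j.
  (* Since [kk j] times the codegree of [j] is [n], this element vanishes exactly at the [j] with
     [kk j = v]. *)
  have [_ [z zE]] := val_spectrum (fun m => (- n%:Z) * (m == o)%:Z + v%:Z * casel m) (sqel l).
  have h : \prod_(j in A v) E j = z%:~R.
    rewrite -zE; apply: eq_big => j; last by rewrite val_sqel.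
    rewrite inE val_lin val_delta chi1 val_casel mulr1 rmorphN /= addrC subr_eq0 -!pmulrn.
    have c0 : codeg j != 0 by rewrite gt_eqF ?codeg_gt0.
    by rewrite -(kk_codeg j) (inj_eq (mulIf c0)) eqr_nat eq_sym.
  have : 0 < \prod_(j in A v) E j by apply: prodr_gt0.
  by rewrite h ltr0z ler1z.
have agm v := leif_AGM (A := A v) (E := E) (fun j _ => ltW (E0 j)).
have meanE v : (0 < #|A v|)%N -> 1 <= (\sum_(j in A v) E j) / #|A v|%:R.
  move=> c0; rewrite -(ler_pXn2r c0) ?nnegrE ?ler01 //; last first.
    by rewrite divr_ge0 ?ler0n // sumr_ge0 // => j _; apply: ltW.
  by rewrite expr1n; apply: le_trans (prodE v) (agm v).1.
have geE v : #|A v|%:R <= \sum_(j in A v) E j.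
  have [c0|] := posnP #|A v|.
    by rewrite c0; apply: sumr_ge0 => j _; apply: ltW.
  by move=> c0; have := meanE v c0; rewrite ler_pdivlMr ?ltr0n // mul1r.
pose m := (\max_j kk j).+1.
have kkm j : (kk j < m)%N by rewrite ltnS leq_bigmax.
have part (F : I -> K) : \sum_j (kk j)%:R * F j = \sum_(v < m) v%:R * \sum_(j in A v) F j.
  rewrite (partition_big (fun j => Ordinal (kkm j)) predT) //=; apply: eq_bigr => v _.
  by rewrite mulr_sumr; apply: eq_big => j; rewrite ?inE // => /eqP <-.
(* Weighted by [v], the cardinals and the sums of [E] over the classes [A v] have the same total
   [n], so the inequalities [geE] are equalities; the class of [v = 1] is used, since it contains
   [o]. *)
have eqv := psumr_eq_le (P := predT) (F := fun v : 'I_m => v%:R * #|A v|%:R)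
  (G := fun v : 'I_m => v%:R * \sum_(j in A v) E j).
have {eqv} e1 : #|A 1%N|%:R = \sum_(j in A 1%N) E j.
  have := eqv _ _ (Ordinal (kkm o)) isT; rewrite /= kk_o !mul1r => -> //.
    by move=> v _; rewrite ler_wpM2l ?ler0n.
  rewrite -part sumE -sum_kk natr_sum.
  transitivity (\sum_j (kk j)%:R * (1 : K)); last by apply: eq_bigr => j _; rewrite mulr1.
  by rewrite part; apply: eq_bigr => v _; rewrite sumr_const.
have oA : o \in A 1%N by rewrite inE kk_o.
have c0 : (0 < #|A 1%N|)%N by apply/card_gt0P; exists o.
(* Mean and product over [A 1] are both 1: the equality case makes [E] constant there, so [E o],
   which is [kk l], is 1. *)
have [le1] := agm 1%N; rewrite -e1 divff ?pnatr_eq0 -?lt0n // expr1n in le1 *.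
have -> : \prod_(i in A 1%N) E i = 1 by apply/eqP; rewrite eq_le le1 prodE.
rewrite eqxx => /esym/forall_inP all_eq.
have Ec j : j \in A 1%N -> E j = E o.
  by move=> jA; have /forall_inP/(_ o oA)/eqP := all_eq j jA.
move: e1; rewrite (eq_bigr _ Ec) sumr_const -[E o *+ _]mulr_natr => e1.
have : E o = 1.
  apply: (@mulIf _ #|A 1%N|%:R); first by rewrite pnatr_eq0 -lt0n.
  by rewrite -e1 mul1r.
by move/eqP; rewrite /E -/(sqd l) kkE pnatr_eq1 => /eqP.
Qed.

(** * Blocks and the group of invertible objects *)

Local Notation aint := (integralOver (intr : int -> K)).

(** The functions on characters given by elements of the fusion ring with algebraic integers as
    coefficients. *)
Definition regular (F : I -> K) : Prop :=
  exists b : I -> K, (forall k, aint (b k)) /\ forall j, F j = \sum_k b k * chi j k.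

Lemma regular_chi k : regular (chi^~ k).
Proof.
exists (fun l => (l == k)%:R); split=> [l|j]; first exact: integral_nat.
by rewrite (bigD1 k) //= eqxx mul1r big1 ?addr0 // => l /negPf->; rewrite mul0r.
Qed.

Lemma regular_cst c : aint c -> regular (fun=> c).
Proof.
move=> ci; exists (fun l => c * (l == o)%:R); split=> [l|j].
  by apply: integral_mul => //; apply: integral_nat.
rewrite (bigD1 o) //= eqxx chi1 !mulr1 big1 ?addr0 // => l /negPf->.
by rewrite mulr0 mul0r.
Qed.

Lemma regular_sub F G : regular F -> regular G -> regular (fun j => F j - G j).
Proof.
move=> [b [bi bE]] [c [ci cE]]; exists (fun k => b k - c k); split=> [k|j].
  exact: integral_sub.
by rewrite bE cE -sumrB; apply: eq_bigr => k _; rewrite mulrBl.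
Qed.

Lemma regular_mul F G : regular F -> regular G -> regular (fun j => F j * G j).
Proof.
move=> [b [bi bE]] [c [ci cE]].
exists (fun m => \sum_k \sum_l b k * c l * (N k l m)%:R); split=> [m|j].
  apply: integral_sumr => k _; apply: integral_sumr => l _.
  by apply: integral_mul; [exact: integral_mul|exact: integral_nat].
rewrite bE cE mulr_suml; under [RHS]eq_bigr => m _ do rewrite mulr_suml.
rewrite exchange_big; apply: eq_bigr => k _; rewrite mulr_sumr /=.
under [RHS]eq_bigr => m _ do rewrite mulr_suml.
rewrite exchange_big; apply: eq_bigr => l _; rewrite mulrACA chiM mulr_sumr /=.
by apply: eq_bigr => m _; rewrite mulrA.
Qed.

Lemma regular_prod (J : Type) (s : seq J) (Q : pred J) (F : J -> I -> K) :
  (forall i, Q i -> regular (F i)) -> regular (fun j => \prod_(i <- s | Q i) F i j).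
Proof.
move=> FQ; elim: s => [|i s IH].
  have [b [bi bE]] := regular_cst (integral1 _); exists b; split=> // j.
  by rewrite big_nil (bE j).
case Qi: (Q i); last first.
  by have [b [bi bE]] := IH; exists b; split=> // j; rewrite big_cons Qi bE.
have [b [bi bE]] := regular_mul (FQ i Qi) IH.
by exists b; split=> // j; rewrite big_cons Qi bE.
Qed.

(** The weighted sum over characters extracts the coefficient of the unit, multiplied by [n]. *)
Lemma sum_regular F : regular F -> exists2 x, aint x & \sum_j (kk j)%:R * F j = n%:R * x.
Proof.
move=> [b [bi bE]]; exists (b o) => //.
transitivity (\sum_k b k * \sum_j (kk j)%:R * chi j k).
  under eq_bigr => j _ do rewrite bE mulr_sumr.
  rewrite exchange_big; apply: eq_bigr => k _; rewrite mulr_sumr.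
  by apply: eq_bigr => j _; rewrite mulrCA.
rewrite (bigD1 o) //= [X in _ + X]big1 => [|k /negPf nk].
  by rewrite sum_kk_chi eqxx mulr1 addr0 mulrC.
by rewrite sum_kk_chi nk !mulr0.
Qed.

(** Each [|chi j g|] is at most 1, yet the weighted sum of their squares equals the sum [n] of the
    weights. *)
Lemma norm_chi_invertible g j : kk g = 1%N -> `|chi j g| = 1.
Proof.
move=> g1; suff : (kk j)%:R * `|chi j g| ^+ 2 = (kk j)%:R :> K.
  move/(canRL (mulKf _)); rewrite pnatr_eq0 -lt0n kk_gt0 mulVf ?pnatr_eq0 -?lt0n ?kk_gt0 //.
  by move=> /(_ isT)/eqP; rewrite expr2 -normrM -expr2 normrX sqrp_eq1 ?normr_ge0 // => /eqP.
apply: (psumr_eq_le (P := predT) (F := fun j => (kk j)%:R * `|chi j g| ^+ 2)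
  (G := fun j => (kk j)%:R)) => // [i _|].
  by rewrite -[leRHS]mulr1 ler_wpM2l ?ler0n // (le_trans (sq_le i g)) // f_kk g1.
by rewrite sum_kk_norm -natr_sum sum_kk.
Qed.

Lemma chi_inv_conj g j : kk g = 1%N -> chi j g * (chi j g)^* = 1.
Proof. by move=> g1; rewrite -normCK norm_chi_invertible // expr1n. Qed.

Section AtPrime.
Variables (p n' : nat) (P : set K).
Hypotheses (PP : prime_above p P) (pr_p : prime p).
Hypotheses (nE : n = (p * n')%N) (p_kk : forall l, ~~ (p %| kk l)%N).

Lemma P_ndvd k : ~~ (p %| k)%N -> ~ P k%:R.
Proof. by move=> npk /(P_nat PP pr_p); apply/negP. Qed.

Lemma chi_o_unit l : ~ P (chi o l).
Proof.
move=> Pl; apply: (P_ndvd (p_kk l)); rewrite -kkE /sqd normCK -chi_st mulrC.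
by apply: (P_mul PP) => //; apply: chi_integral.
Qed.

(* The classes of this relation are the blocks at the prime [p]. *)
Definition eqv i j : Prop := forall k, P (chi i k - chi j k).

Lemma eqv_refl i : eqv i i.
Proof. by move=> k; rewrite subrr; apply: P_0 PP. Qed.
Lemma eqv_sym i j : eqv i j -> eqv j i.
Proof. by move=> e k; rewrite -opprB; apply: (P_opp PP). Qed.
Lemma eqv_trans j i k : eqv i j -> eqv j k -> eqv i k.
Proof.
move=> e e' l; have -> : chi i l - chi k l = (chi i l - chi j l) + (chi j l - chi k l).
  by ring.
by apply: (P_add PP).
Qed.

Lemma regular_eqv F i j : regular F -> eqv i j -> P (F i - F j).
Proof.
move=> [b [bi bE]] e; rewrite !bE -sumrB; apply: (P_sum PP) => k _.
by rewrite -mulrBr; apply: (P_mul PP).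
Qed.

(** For each [j] outside the block of [j0], take a factor that vanishes at [j] and lies outside [P]
    at [j0]; primality keeps the product outside [P] at [j0]. *)
Lemma separator j0 : exists2 y : I -> K, regular y &
  ~ P (y j0) /\ forall j, ~ eqv j0 j -> y j = 0.
Proof.
have ex j : exists k, ~ eqv j0 j -> ~ P (chi j0 k - chi j k).
  have [e|ne] := pselect (eqv j0 j); first by exists o.
  by have [k nk] := contrapT (fun h => ne (fun k => contrapT (fun nk => h (ex_intro _ k nk)))); exists k.
have [k kP] := choice ex.
exists (fun j' => \prod_(j | ~~ `[< eqv j0 j >]) (chi j' (k j) - chi j (k j))).
  apply: regular_prod => j _; apply: regular_sub; first exact: regular_chi.
  by apply/regular_cst/chi_integral.
split=> [|j nj]; last first.
  by rewrite (bigD1 j) /=; [rewrite subrr mul0r|apply/asboolPn].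
apply: (P_prod PP) => j /asboolPn nj; last exact: kP.
by apply: integral_sub; apply: chi_integral.
Qed.

(** The weighted sum of a separator [y] lies in [P] because [p] divides [n]. Modulo [P] it is [y j0]
    times the block sum, and [y j0] is outside [P]. *)
Lemma block_sum j0 : P (\sum_(j | `[< eqv j0 j >]) (kk j)%:R).
Proof.
have [y yreg [y0 yn]] := separator j0; have [x xi sE] := sum_regular yreg.
have : P (\sum_j (kk j)%:R * y j).
  rewrite sE nE natrM -mulrA mulrC; apply: (P_mul PP); last exact: P_p PP.
  by apply: integral_mul => //; apply: integral_nat.
rewrite (bigID (fun j => `[< eqv j0 j >])) /= [X in _ + X]big1 => [|j /asboolPn nj]; last first.
  by rewrite yn ?mulr0.
rewrite addr0 => Py.
have : P ((\sum_(j | `[< eqv j0 j >]) (kk j)%:R) * y j0).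
  rewrite -[_ * _](subrK (\sum_(j | `[< eqv j0 j >]) (kk j)%:R * y j)).
  apply: (P_add PP) => //; rewrite mulr_suml -sumrB; apply: (P_sum PP) => j /asboolP e.
  by rewrite -mulrBr; apply: (P_mul PP); [exact: integral_nat|exact: regular_eqv].
have yi : aint (y j0).
  have [b [bi ->]] := yreg; apply: integral_sumr => k _.
  by apply: integral_mul => //; apply: chi_integral.
case/(P_prime PP) => //; apply: integral_sumr => j _; exact: integral_nat.
Qed.

Lemma closed_sum (A : pred I) : (forall i j, eqv i j -> A i -> A j) ->
  (p %| \sum_(j | A j) kk j)%N.
Proof.
move=> cA; apply: (P_nat PP pr_p); rewrite natr_sum.
pose rep j := odflt j [pick i | `[< eqv j i >]].
have repP j : eqv j (rep j).
  rewrite /rep; case: pickP => [i /asboolP //|/(_ j)].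
  by move/asboolP: (eqv_refl j) => ->.
have repE i j : eqv i j -> rep i = rep j.
  move=> e; rewrite /rep (eq_pick (Q := fun k => `[< eqv j k >])).
    case: pickP => // /(_ j); by move/asboolP: (eqv_refl j) => ->.
  move=> k; apply/asboolP/asboolP => h; first exact: eqv_trans (eqv_sym e) h.
  exact: eqv_trans h.
rewrite (partition_big rep predT) //=; apply: (P_sum PP) => i _.
have [[j0 /andP[Aj0 /eqP r0]]|nj] := pselect (exists j, A j && (rep j == i)); last first.
  rewrite big_pred0 => [|j]; first exact: (P_0 PP).
  by apply/negP => h; apply: nj; exists j.
rewrite (eq_bigl (fun j => `[< eqv j0 j >])); first exact: block_sum.
move=> j; apply/andP/asboolP => [[Aj /eqP rj]|e].
  by apply: eqv_trans (eqv_sym (repP j)); rewrite rj -r0; apply: repP.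
by split; [exact: cA e Aj0|rewrite -r0 (repE _ _ e)].
Qed.

(** If some character vanished on [i], then [chi i k] would vanish by symmetry, so [chi g k] and
    hence [chi k g] would lie in [P]; but [chi k g] has absolute value 1, with inverse its
    conjugate. *)
Lemma eqv_invertible g i : kk g = 1%N -> eqv g i -> kk i = 1%N.
Proof.
move=> g1 e; apply: nonvanishing_invertible => k; apply/eqP => ki.
have ik : chi i k = 0.
  have := chi_sym i k; rewrite ki mul0r => /eqP.
  by rewrite mulf_eq0 (negPf (chi_o_neq0 _)) orbF => /eqP.
have Pgk : P (chi g k) by have := e k; rewrite ik subr0.
have : P (chi k g * chi o k).
  by rewrite -chi_sym mulrC; apply: (P_mul PP) => //; apply: chi_integral.
case/(P_prime PP); [exact: chi_integral|exact: chi_integral| |exact: chi_o_unit].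
move=> Pkg; apply: (P_1 PP); rewrite -(chi_inv_conj k g1) mulrC.
by apply: (P_mul PP) => //; rewrite -chi_st; apply: chi_integral.
Qed.

Lemma dvd_invertibles : (p %| #|[pred g | kk g == 1%N]|)%N.
Proof.
have := @closed_sum [pred g | kk g == 1%N]; rewrite (eq_bigr (fun=> 1%N)) => [|j /eqP //].
rewrite sum1_card; apply => i j e; rewrite !inE => /eqP i1.
by rewrite (eqv_invertible i1 e).
Qed.

End AtPrime.

(** As [chi j g] has absolute value 1, the product of [g] and [l] has the same weighted norm as [l].
    By column orthogonality the squares of its multiplicities then sum to 1. *)
Lemma invertible_mul g l : kk g = 1%N -> exists k,
  (forall i, chi i k = chi i g * chi i l) /\ forall k', N g l k' = (k' == k).
Proof.
move=> g1.
have s1 : (\sum_k N g l k ^ 2 = 1)%N.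
  apply/eqP; rewrite -(eqr_nat K); apply/eqP.
  apply: (@mulfI _ n%:R); first by rewrite gt_eqF ?n_gt0.
  rewrite mulr1 -[RHS](sum_kk_norm l).
  transitivity (\sum_j (kk j)%:R * ((chi j g * chi j l)^* * (chi j g * chi j l))); last first.
    apply: eq_bigr => j _; rewrite rmorphM /= mulrACA [_^* * _]mulrC chi_inv_conj // mul1r.
    by congr (_ * _); rewrite normCK mulrC.
  transitivity (\sum_j \sum_k \sum_k' (N g l k)%:R * (N g l k')%:R *
      ((kk j)%:R * ((chi j k)^* * chi j k'))); last first.
    apply: eq_bigr => j _; rewrite chiM rmorph_sum mulr_suml mulr_sumr.
    apply: eq_bigr => k _; rewrite !mulr_sumr; apply: eq_bigr => k' _.
    by rewrite rmorphM /= conjC_nat; ring.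
  rewrite exchange_big natr_sum mulr_sumr; apply: eq_bigr => k _ /=.
  rewrite exchange_big (bigD1 k) //= [X in _ + X]big1 => [|k' nk'].
    by rewrite -mulr_sumr sum_kk_chi2 eqxx mulr1 addr0 natrX; ring.
  by rewrite -mulr_sumr sum_kk_chi2 eq_sym (negPf nk') !mulr0.
have [k Nk] : exists k, (0 < N g l k)%N.
  apply: contrapT => nex; move: s1; rewrite big1 // => k _.
  by case E : (N g l k) => [//|m]; exfalso; apply: nex; exists k; rewrite E.
have Nk1 : N g l k = 1%N.
  apply/eqP; rewrite eqn_leq Nk andbT -(@leq_exp2r _ _ 2) // exp1n -[leqRHS]s1.
  by rewrite (bigD1 k) //= leq_addr.
have N0 k' : k' != k -> N g l k' = 0%N.
  move=> nk; have := s1; rewrite (bigD1 k) //= Nk1 exp1n => -[/eqP].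
  by rewrite sum_nat_eq0 => /forallP/(_ k'); rewrite nk expn_eq0 /= andbT => /eqP.
exists k; split=> [i|k'].
  rewrite chiM (bigD1 k) //= Nk1 mul1r big1 ?addr0 // => k' /N0 ->.
  by rewrite mul0r.
by case: eqP => [->|/eqP/N0 //].
Qed.

Lemma kk_norm l : (kk l)%:R = `|chi o l| ^+ 2 :> K. Proof. by rewrite -kkE. Qed.

(** The group of invertible objects, each encoded as the permutation of simple objects by which it
    multiplies; the object itself is [s o]. *)
Definition Ginv : {set {perm I}} :=
  [set s : {perm I} | (kk (s o) == 1%N) && [forall l, forall i, chi i (s l) == chi i (s o) * chi i l]].

Implicit Types s t : {perm I}.

Lemma GinvP s : reflect (kk (s o) = 1%N /\ forall l i, chi i (s l) = chi i (s o) * chi i l)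
  (s \in Ginv).
Proof.
rewrite inE; apply: (iffP andP) => [[/eqP s1 /forallP h]|[-> h]].
  by split=> // l i; have /forallP/(_ i)/eqP := h l.
by split=> //; apply/forallP => l; apply/forallP => i; rewrite h.
Qed.

Lemma Ginv_group_set : group_set Ginv.
Proof.
apply/group_setP; split=> [|s t /GinvP[s1 sP] /GinvP[t1 tP]].
  by apply/GinvP; split=> [|l i]; rewrite !perm1 ?kk_o // chi1 mul1r.
apply/GinvP; rewrite !permM; split=> [|l i]; last by rewrite !permM (tP (s l)) (tP (s o)) (sP l) mulrA.
apply/eqP; rewrite -(eqr_nat K) kk_norm tP normrM !norm_chi_invertible //.
by rewrite mulr1 expr1n.
Qed.
Canonical Ginv_group := Group Ginv_group_set.

Lemma Ginv_o_inj : {in Ginv &, injective (fun s : {perm I} => s o)}.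
Proof.
move=> s t /GinvP[_ sP] /GinvP[_ tP] e; apply/permP => l; apply: chi_col_inj => i.
by rewrite sP tP e.
Qed.

Lemma Ginv_exists g : kk g = 1%N -> exists2 s : {perm I}, s \in Ginv & s o = g.
Proof.
move=> g1; have [m mP] := choice (fun l => invertible_mul l g1).
have mE l i : chi i (m l) = chi i g * chi i l by have [h _] := mP l.
have mo : m o = g by apply: chi_col_inj => i; rewrite mE chi1 mulr1.
have minj : injective m.
  move=> l l' e; apply: chi_col_inj => i.
  have := mE l i; rewrite e mE => /mulfI -> //.
  by rewrite -normr_eq0 norm_chi_invertible ?oner_eq0.
exists (perm minj); last by rewrite permE.
by apply/GinvP; split=> [|l i]; rewrite !permE ?mo ?mE ?mo.
Qed.

Lemma card_Ginv : #|Ginv| = #|[pred g | kk g == 1%N]|.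
Proof.
rewrite -(card_in_imset Ginv_o_inj); apply: eq_card => g; rewrite inE.
apply/imsetP/eqP => [[s /GinvP[s1 _] ->]|/Ginv_exists[s sG <-]] //.
by exists s.
Qed.

Lemma Ginv_abelian : fingroup.abelian Ginv.
Proof.
apply/centsP => s sG t tG; apply: Ginv_o_inj; rewrite ?groupM //.
move: sG tG => /GinvP[_ sP] /GinvP[_ tP]; apply: chi_col_inj => i.
by rewrite !permM sP tP mulrC.
Qed.

Lemma N_Ginv s l k : s \in Ginv -> N (s o) l k = (k == s l).
Proof.
move=> /GinvP[s1 sP]; have [m [mP ->]] := invertible_mul l s1.
by suff -> : m = s l by []; apply: chi_col_inj => i; rewrite mP (sP l).
Qed.

Lemma kk_Ginv s l : s \in Ginv -> kk (s l) = kk l.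
Proof.
move=> /GinvP[s1 sP]; apply/eqP; rewrite -(eqr_nat K) !kk_norm (sP l) normrM.
by rewrite (norm_chi_invertible _ s1) mul1r.
Qed.

(* The double braiding of the invertible object [s o] with [j]. *)
Definition wt (s : {perm I}) j : K := chi j (s o) / chi o (s o).

Lemma chi_Ginv_neq0 s i : s \in Ginv -> chi i (s o) != 0.
Proof. by move=> /GinvP[s1 _]; rewrite -normr_eq0 norm_chi_invertible ?oner_eq0. Qed.

Lemma wtE s j : s \in Ginv -> wt s j = chi (s o) j / chi o j.
Proof.
move=> sG; apply: (mulIf (chi_Ginv_neq0 o sG)); rewrite /wt divfK ?chi_Ginv_neq0 //.
apply: (mulIf (chi_o_neq0 j)); rewrite chi_sym mulrAC divfK ?chi_o_neq0 //.
Qed.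

Lemma wtM s t j : s \in Ginv -> t \in Ginv -> wt (s * t)%g j = wt s j * wt t j.
Proof.
move=> sG /GinvP[_ tP]; rewrite /wt permM !(tP (s o)) invfM mulrACA mulrC.
by [].
Qed.

Lemma wt1 j : wt 1%g j = 1. Proof. by rewrite /wt perm1 !chi1 divr1. Qed.

Lemma wtX s k j : s \in Ginv -> wt (s ^+ k)%g j = wt s j ^+ k.
Proof.
move=> sG; elim: k => [|k IH]; first by rewrite expg0 wt1 expr0.
by rewrite expgS wtM ?groupX // IH exprS.
Qed.

Lemma wt_mul s t l : s \in Ginv -> t \in Ginv -> wt s (t l) = wt s (t o) * wt s l.
Proof.
by move=> sG tG; have /GinvP[_ tP] := tG; rewrite !wtE // !(tP l) mulf_div.
Qed.

Lemma norm_wt s j : s \in Ginv -> `|wt s j| = 1.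
Proof. by move=> /GinvP[s1 _]; rewrite normrM normfV !norm_chi_invertible // divr1. Qed.

Lemma wt_eq1 s : s \in Ginv -> (forall j, wt s j = 1) -> s = 1%g.
Proof.
move=> sG h; apply: Ginv_o_inj; rewrite ?group1 // perm1.
apply: chi_inj => j; have := h j; rewrite wtE // => /(congr1 (fun x => x * chi o j)).
by rewrite divfK // mul1r.
Qed.

Lemma sum_kk_wt s : s \in Ginv -> \sum_j (kk j)%:R * wt s j = n%:R * (s == 1%g)%:R.
Proof.
move=> sG; transitivity ((n%:R * (s o == o)%:R) / chi o (s o)).
  by rewrite -sum_kk_chi mulr_suml; apply: eq_bigr => j _; rewrite mulrA.
have -> : (s o == o) = (s == 1%g).
  apply/eqP/eqP => [e|->]; last exact: perm1.
  by apply: Ginv_o_inj; rewrite ?group1 // perm1.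
by case: eqP => [->|_]; rewrite ?perm1 ?chi1 ?divr1 // mulr0 mul0r.
Qed.

Definition cent (H : {set {perm I}}) : pred I := [pred j | [forall s in H, wt s j == 1]].

Lemma sum_wt_group (H : {group {perm I}}) j : H \subset Ginv ->
  \sum_(s in H) wt s j = (cent H j)%:R * #|H|%:R.
Proof.
move=> sHG; case: (boolP (cent H j)) => [/forall_inP h|].
  by rewrite mul1r (eq_bigr (fun=> 1)) ?sumr_const // => s /h/eqP.
rewrite negb_forall_in => /exists_inP[t tH nt]; rewrite mul0r.
apply/eqP; have : \sum_(s in H) wt s j == wt t j * \sum_(s in H) wt s j.
  apply/eqP; rewrite mulr_sumr (reindex_inj (mulgI t)) /=.
  apply: eq_big => s; first by rewrite groupMl.
  by rewrite groupMl // => sH; rewrite wtM // (fintype.subsetP sHG).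
rewrite -subr_eq0 -{1}[\sum_(_ in _) _]mul1r -mulrBl mulf_eq0 => /orP[|//].
by rewrite subr_eq0 eq_sym (negPf nt).
Qed.

(** The dimension formula for a subgroup and its centraliser: count the weighted sum of [wt s j]
    over [s] and [j] in both orders. *)
Lemma card_cent (H : {group {perm I}}) : H \subset Ginv ->
  (#|H| * \sum_(j | cent H j) kk j = n)%N.
Proof.
move=> sHG; apply/eqP; rewrite -(eqr_nat K) natrM natr_sum mulr_sumr; apply/eqP.
transitivity (\sum_j (kk j)%:R * \sum_(s in H) wt s j).
  rewrite [LHS]big_mkcond; apply: eq_bigr => j _; rewrite sum_wt_group //.
  by case: (cent H j); rewrite ?mul0r ?mulr0 // mul1r mulrC.
under eq_bigr => j _ do rewrite mulr_sumr.
rewrite exchange_big (bigD1 1%g) //= sum_kk_wt ?group1 // eqxx mulr1 big1 ?addr0 // => s.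
by move=> /andP[sH /negPf ns]; rewrite sum_kk_wt ?ns ?mulr0 // (fintype.subsetP sHG).
Qed.

Lemma dvd_card_Ginv : (#|Ginv| %| n)%N.
Proof. by rewrite -(card_cent (subxx Ginv_group)) dvdn_mulr. Qed.

Lemma wt_integral s j : s \in Ginv -> aint (wt s j).
Proof.
move=> sG; have /GinvP[s1 _] := sG.
have -> : wt s j = chi j (s o) * chi o (st (s o)).
  rewrite /wt chi_st; congr (_ * _); apply: (mulfI (chi_Ginv_neq0 o sG)).
  by rewrite chi_inv_conj // divff // chi_Ginv_neq0.
by apply: integral_mul; apply: chi_integral.
Qed.

Lemma integral_exp (x : K) k : aint x -> aint (x ^+ k).
Proof.
move=> xi; elim: k => [|k IH]; first by rewrite expr0; apply: integral1.
by rewrite exprS; apply: integral_mul.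
Qed.

Lemma st_fix_mul s i j : s \in Ginv -> N i (st j) (s o) = (i == s j).
Proof. by move=> sG; rewrite NC ND stK NC N_Ginv. Qed.

(** * An invertible object of order p does not centralise itself *)

Section Nondegenerate.
(** The use made of the twist: when [g] fixes [j], balancing expresses the twist of [j] as itself
    times that of [g] times the double braiding of the two. *)
Variables (tw : I -> K).
Hypothesis tw_fix : forall g j, kk g = 1%N -> N g j j = 1%N ->
  tw g * (chi j g / chi o g) = 1.
Variables (p n' : nat) (P : set K).
Hypotheses (PP : prime_above p P) (pr_p : prime p).
Hypotheses (nE : n = (p * n')%N) (p_n' : ~~ (p %| n')%N).
Hypothesis (p_kk : forall l, ~~ (p %| kk l)%N).

Lemma p2_ndvd_G : ~~ (p ^ 2 %| #|Ginv|)%N.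
Proof.
apply/negP => h; have := dvdn_trans h dvd_card_Ginv.
by rewrite nE expnS expn1 dvdn_pmul2l ?prime_gt0 // (negPf p_n').
Qed.

Lemma order_expp s : s \in Ginv -> ~~ (p %| #[s ^+ p]%g)%N.
Proof.
move=> sG; have [ps|nps] := boolP (p %| #[s]%g)%N; last first.
  by apply: contra nps => h; apply: dvdn_trans h (orderXdvd _ _).
rewrite orderXdiv //; apply/negP => h; case/negP: p2_ndvd_G.
apply: dvdn_trans (order_dvdG sG).
by rewrite -(divnK ps) expnS expn1 dvdn_pmul2r ?prime_gt0.
Qed.

Lemma P_wt_exp x k : aint x -> P (x - 1) -> P (x ^+ k - 1).
Proof.
move=> xi Px; rewrite subrX1 mulrC; apply: (P_mul PP) => //.
by apply: integral_sumr => i _; apply: integral_exp.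
Qed.

(** If [x] is not 1, its first [q] powers sum to 0; modulo [P] that sum is [q]. *)
Lemma P_root1 x q : aint x -> ~~ (p %| q)%N -> x ^+ q = 1 -> P (x - 1) -> x = 1.
Proof.
move=> xi npq xq Px; apply/eqP; rewrite -subr_eq0; apply/negPn/negP => nx.
have := subrX1 x q; rewrite xq subrr => /esym/eqP; rewrite mulf_eq0 (negPf nx) /= => /eqP s0.
apply: (P_ndvd PP pr_p npq); have -> : q%:R = - \sum_(i < q) (x ^+ i - 1).
  by rewrite sumrB s0 sub0r opprK sumr_const card_ord.
by apply: (P_opp PP); apply: (P_sum PP) => i _; apply: P_wt_exp.
Qed.

(** Expanding [(y + 1) ^+ p = 1] leaves [y ^+ p] equal to minus the middle binomial terms, all
    divisible by [p]. *)
Lemma P_rootp x : aint x -> x ^+ p = 1 -> P (x - 1).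
Proof.
move=> xi xp; pose y := x - 1.
have yi : aint y by apply: integral_sub => //; apply: integral1.
apply: (P_exp PP (n := p)) => //; rewrite -/y.
have : (y + 1) ^+ p = 1 by rewrite subrK.
rewrite exprDn; case: p pr_p PP => [//|q] pr_q PQ.
rewrite big_ord_recl big_ord_recr /= subn0 bin0 subnn binn !expr1n expr0 !mulr1 !mulr1n.
move/eqP; rewrite addrA -subr_eq0 addrK addr_eq0 => /eqP ->.
apply: (P_opp PQ); apply: (P_sum PQ) => i _; rewrite expr1n mulr1 -mulr_natr.
apply: (P_mul PQ); first exact: integral_exp.
have /dvdnP[c ->] : (q.+1 %| 'C(q.+1, bump 0 i))%N.
  by apply: prime_dvd_bin => //; rewrite /bump leq0n add1n /=; exact: (ltn_ord i).
by rewrite natrM; apply: (P_mul PQ); [exact: integral_nat|exact: P_p PQ].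
Qed.

Lemma eqv_wt s : s \in Ginv -> eqv P o (s o) <-> forall k, P (wt s k - 1).
Proof.
move=> sG; have e k : chi o k - chi (s o) k = chi o k * (- (wt s k - 1)).
  by rewrite wtE //; field; apply: chi_o_neq0.
have wi k : aint (- (wt s k - 1)).
  by apply/integral_opp/integral_sub; [exact: wt_integral|exact: integral1].
split=> [h k|h k]; last first.
  by rewrite e; apply: (P_mul PP); [exact: chi_integral|exact: (P_opp PP)].
have Pe : P (chi o k * (- (wt s k - 1))) by rewrite -e.
have [/(chi_o_unit PP pr_p p_kk)//|Pw] := P_prime PP (chi_integral o k) (wi k) Pe.
by rewrite -[_ - _]opprK; apply: (P_opp PP).
Qed.

(** Congruence to the unit means that all roots of unity [wt s k] are 1 modulo [P]. Those of
    [s ^+ p] have order prime to [p], because the square of [p] does not divide the order of [Ginv],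
    and must then be 1. *)
Lemma eqv_torsion s : s \in Ginv -> eqv P o (s o) <-> (s ^+ p = 1)%g.
Proof.
move=> sG; rewrite eqv_wt //; split=> [h|sp k]; last first.
  by apply: P_rootp; [exact: wt_integral|rewrite -wtX // sp wt1].
apply: wt_eq1; first exact: groupX.
move=> k; apply: (P_root1 (q := #[s ^+ p]%g)).
- by apply: wt_integral; apply: groupX.
- exact: order_expp.
- by rewrite -wtX ?groupX // expg_order wt1.
- by rewrite wtX //; apply: P_wt_exp; [exact: wt_integral|exact: h].
Qed.

Section OrderP.
Variable s : {perm I}.
Hypotheses (sG : s \in Ginv) (os : #[s]%g = p).

Lemma cycle_Sylow : (p.-Sylow(Ginv) <[s]>)%g.
Proof.
rewrite pHallE cycle_subG sG /= -orderE os p_part.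
have h1 : (0 < logn p #|Ginv|)%N.
  by rewrite logn_gt0 mem_primes pr_p cardG_gt0 -os order_dvdG.
have := p2_ndvd_G; rewrite pfactor_dvdn ?cardG_gt0 // -ltnNge => h2.
by have /eqP -> : logn p #|Ginv| == 1%N by rewrite eqn_leq h1 -ltnS h2.
Qed.

Lemma eqv_o_cycle i : eqv P o i -> exists2 t, t \in <[s]>%g & i = t o.
Proof.
move=> e; have i1 : kk i = 1%N by apply: (eqv_invertible PP pr_p p_kk kk_o e).
have [t tG ti] := Ginv_exists i1; exists t => //; rewrite -ti in e.
have nS : (<[s]> <| Ginv)%g.
  by rewrite /normal cycle_subG sG (sub_abelian_norm Ginv_abelian) // cycle_subG.
rewrite (mem_normal_Hall cycle_Sylow nS tG).
have /eqv_torsion := e; move=> /(_ tG)/eqP; rewrite -order_dvdn => d.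
exact: pnat_dvd d (pnat_id pr_p).
Qed.

(** If [j] is not a translate of [i], an element [w] of the fusion ring with all values in [P] has,
    on the block of the unit, only a unit coefficient outside [P]; a separator isolates it. *)
Lemma eqv_free i j : eqv P i j -> s i != i -> exists2 t, t \in <[s]>%g & j = t i.
Proof.
move=> eij si; apply: contrapT => nj.
have [y [b [bi yE]] [yo yn]] := separator PP o.
(* The product of [i] with a combination of [st i] and [st j], normalised so that symmetry turns its
   value at [k] into a multiple of [chi i (st k) - chi j (st k)]. *)
pose w l := (N i (st i) l)%:R * chi o (st j) - (N i (st j) l)%:R * chi o (st i).
have PW k : P (\sum_l w l * chi k l).
  have -> : \sum_l w l * chi k l = chi k i * (chi k (st i) * chi o (st j) - chi k (st j) * chi o (st i)).
    rewrite mulrBr !mulrA !chiM !mulr_suml -sumrB; apply: eq_bigr => l _.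
    by rewrite /w; ring.
  apply: (P_mul PP); first exact: chi_integral.
  have : P (chi o (st k) * (chi k (st i) * chi o (st j) - chi k (st j) * chi o (st i))).
    have cs l : chi k (st l) * chi o (st k) = chi l (st k) * chi o (st l).
      by rewrite !chi_st -!rmorphM /= chi_sym.
    have -> : chi o (st k) * (chi k (st i) * chi o (st j) - chi k (st j) * chi o (st i)) =
        (chi o (st i) * chi o (st j)) * (chi i (st k) - chi j (st k)).
      transitivity (chi k (st i) * chi o (st k) * chi o (st j) - chi k (st j) * chi o (st k) * chi o (st i)).
        by ring.
      by rewrite !cs; ring.
    by apply: (P_mul PP) => //; apply: integral_mul; apply: chi_integral.
  case/(P_prime PP) => //; [exact: chi_integral| |by move/(chi_o_unit PP pr_p p_kk)].
  by apply: integral_sub; apply: integral_mul; apply: chi_integral.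
(* Expand [y] and exchange indices with [chi_sym]: the sum combines the values of [w]. *)
have : P (\sum_l w l * chi o l * y l).
  have -> : \sum_l w l * chi o l * y l = \sum_m b m * chi o m * \sum_l w l * chi m l.
    under eq_bigr => l _ do rewrite yE mulr_sumr.
    rewrite exchange_big; apply: eq_bigr => m _; rewrite mulr_sumr; apply: eq_bigr => l _ /=.
    transitivity (w l * b m * (chi l m * chi o l)); first by ring.
    by rewrite chi_sym; ring.
  apply: (P_sum PP) => m _; apply: (P_mul PP) => //.
  by apply: integral_mul => //; apply: chi_integral.
(* Other terms vanish: outside the block [y] does, and inside it [l] is [t o] with [t] in the cycle.
   This occurs in the product of [i] and [st j] only if [i = t j], and in that of [i] and [st i]
   only if [t] fixes [i]; a nontrivial such [t] generates the cycle, so [s] would fix [i]. *)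
rewrite (bigD1 o) //= big1 => [|l nlo]; last first.
  have [el|nel] := pselect (eqv P o l); last by rewrite yn ?mulr0.
  have [t tS lE] := eqv_o_cycle el.
  have tG : t \in Ginv by apply: fintype.subsetP tS; rewrite cycle_subG.
  rewrite /w lE !st_fix_mul //.
  have [e|_] := eqVneq i (t j).
    by case: nj; exists t^-1%g; rewrite ?groupV // e permK.
  have [e|_] := eqVneq i (t i); last by rewrite !mul0r subrr !mul0r.
  case/eqP: si; have t1 : t != 1%g.
    by apply: contraNneq nlo => t1; rewrite lE t1 perm1.
  have cyc : <[s]>%g = <[t]>%g.
    apply/esym/eqP; rewrite eqEcard cycle_subG tS -!orderE os /=.
    have := order_dvdG tS; rewrite -orderE os => /(prime_nt_dvdP pr_p) -> //.
    by rewrite order_eq1.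
  have /cycleP[k ->] : s \in <[t]>%g by rewrite -cyc cycle_id.
  by rewrite permX; elim: k => [//|k IH]; rewrite iterS IH -e.
rewrite addr0 chi1 mulr1.
have nji : j != i by apply/eqP => e; apply: nj; exists 1%g; rewrite ?group1 ?perm1.
rewrite /w !N_unit eqxx (inj_eq (can_inj stK)) (negPf nji) mul0r subr0 mul1r.
case/(P_prime PP) => //; [exact: chi_integral| |exact: (chi_o_unit PP pr_p p_kk)].
rewrite yE; apply: integral_sumr => k _.
by apply: integral_mul => //; apply: chi_integral.
Qed.

Lemma wt_cycle_self t : t \in <[s]>%g -> wt s (s o) = 1 -> wt s (t o) = 1.
Proof.
move=> /cycleP[k ->] w1; have [sGk sXG] : s \in Ginv /\ (s ^+ k)%g \in Ginv.
  by rewrite groupX.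
have -> : wt s ((s ^+ k)%g o) = wt (s ^+ k)%g (s o).
  by rewrite wtE // /wt; congr (_ / _); have := chi_sym (s o) o.
by rewrite wtX // w1 expr1n.
Qed.

Lemma wt_fix i : s i = i -> tw (s o) * wt s i = 1.
Proof.
move=> si; apply: tw_fix; first by have /GinvP[] := sG.
by rewrite N_Ginv // si eqxx.
Qed.

(* Otherwise the objects centralising [s o] would form a union of blocks, and [p]
   would divide [n / p]. *)
Lemma wt_self_neq1 : wt s (s o) != 1.
Proof.
apply/negP => /eqP w1.
have closed i j : eqv P i j -> wt s i == 1 -> wt s j == 1.
  move=> e /eqP wi; have [si|si] := eqVneq (s i) i; last first.
    have [t tS ->] := eqv_free e si; have tG : t \in Ginv.
      by apply: fintype.subsetP tS; rewrite cycle_subG.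
    by rewrite wt_mul // wt_cycle_self // wi mulr1.
  (* When [s] fixes both, [wt s i] and [wt s j] are both the inverse of the twist of [s o]. *)
  have [sj|sj] := eqVneq (s j) j.
    have tw0 : tw (s o) != 0.
      by apply/eqP => z; have /eqP := wt_fix si; rewrite z mul0r eq_sym oner_eq0.
    by have := wt_fix sj; rewrite -{1}(wt_fix si) => /(mulfI tw0) ->; rewrite wi.
  (* The remaining case is impossible: [i] would be a translate of [j] by a power of [s], so [s]
     would fix [j] along with [i]. *)
  have [t /cycleP[k tE] iE] := eqv_free (eqv_sym PP e) sj.
  case/eqP: sj; apply: (@perm_inj _ t); rewrite -iE -[in RHS]si iE -!permM tE.
  by rewrite -expgS -expgSr.
have := closed_sum PP pr_p nE closed; rewrite /= => d.
have sS : (<[s]> \subset Ginv)%g by rewrite cycle_subG.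
have := card_cent sS; rewrite -orderE os nE => /eqP.
rewrite eqn_pmul2l ?prime_gt0 // => /eqP e; case/negP: p_n'; rewrite -e.
rewrite (eq_bigl (fun j => wt s j == 1)) // => j.
apply/forall_inP/idP => [h|/eqP wj t /cycleP[k ->]]; first exact/h/cycle_id.
by rewrite wtX // wj expr1n.
Qed.

End OrderP.
End Nondegenerate.

Section Decomposition.
Variables (tw : I -> K) (d m : nat).
Hypothesis tw_fix : forall g j, kk g = 1%N -> N g j j = 1%N ->
  tw g * (chi j g / chi o g) = 1.
Hypotheses (nE : n = (d * m)%N) (sf : square_free d) (cop : coprime d m).
Hypothesis cop_kk : forall l, coprime d (kk l).

Lemma d_gt0 : (0 < d)%N.
Proof.
by have := n_gt0; rewrite nE ltr0n muln_gt0 => /andP[].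
Qed.

Lemma prime_dvd_d p : prime p -> (p %| d)%N ->
  [/\ n = (p * (d %/ p * m))%N, ~~ (p %| d %/ p * m)%N & forall l, ~~ (p %| kk l)%N].
Proof.
move=> pr_p pd; have ncop c : coprime d c -> ~~ (p %| c)%N.
  by move=> h; rewrite -prime_coprime // (coprime_dvdl pd).
split=> [||l]; first by rewrite mulnA [(p * _)%N]mulnC divnK.
- rewrite Euclid_dvdM // negb_or (ncop m) // andbT; apply: contra (sf pr_p) => h.
  by rewrite -(divnK pd) expnS expn1 dvdn_mul.
- exact: ncop.
Qed.

Lemma dvd_d_card_Ginv : (d %| #|Ginv|)%N.
Proof.
apply/(dvdn_partP _ d_gt0) => p; rewrite mem_primes => /and3P[pr_p _ pd].
have [e1 e2 e3] := prime_dvd_d pr_p pd.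
have [P PP] := prime_above_exists (K := K) pr_p.
have -> : (d`_p = p)%N.
  rewrite p_part; suff -> : logn p d = 1%N by rewrite expn1.
  apply/eqP; rewrite eqn_leq; apply/andP; split.
    by rewrite leqNgt -pfactor_dvdn ?d_gt0 // sf.
  by rewrite logn_gt0 mem_primes pr_p d_gt0.
by rewrite card_Ginv; apply: (dvd_invertibles PP pr_p e1 e3).
Qed.

(** In an abelian group this core is the Hall subgroup. Its order is [d] because the order of [Ginv]
    is [d] times a divisor of [m]. *)
Definition Hd : {group {perm I}} := 'O_\pi(d)(Ginv)%G.

Lemma sub_Hd : Hd \subset Ginv. Proof. exact: pcore_sub. Qed.

Lemma card_Hd : #|Hd| = d.
Proof.
have /card_Hall -> := nilpotent_pcore_Hall \pi(d) (abelian_nil Ginv_abelian).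
have /dvdnP[e eE] := dvd_d_card_Ginv.
have := dvd_card_Ginv; rewrite nE eE mulnC dvdn_pmul2l ?d_gt0 // => em.
have e0 : (0 < e)%N by have := cardG_gt0 Ginv_group; rewrite /= eE muln_gt0 => /andP[].
rewrite partnM ?d_gt0 // part_pnat_id ?pnat_pi ?d_gt0 // part_p'nat ?muln1 //.
by rewrite -coprime_pi' ?d_gt0 // (coprime_dvdr em).
Qed.

(** A nontrivial [s] in the radical has a power [t] of prime order dividing [d], and [t] would
    centralise itself. *)
Lemma Hd_nondegenerate s : s \in Hd -> (forall t, t \in Hd -> wt s (t o) = 1) -> s = 1%g.
Proof.
move=> sH h; apply/eqP; rewrite -order_eq1; apply/negPn/negP => os.
pose p := pdiv #[s]%g.
have pr_p : prime p by apply: pdiv_prime; rewrite ltn_neqAle eq_sym os order_gt0.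
have ps : (p %| #[s]%g)%N := pdiv_dvd _.
have pd : (p %| d)%N by rewrite -card_Hd (dvdn_trans ps) // order_dvdG.
have [e1 e2 e3] := prime_dvd_d pr_p pd.
have [P PP] := prime_above_exists (K := K) pr_p.
pose t := (s ^+ (#[s]%g %/ p)%N)%g.
have tH : t \in Hd by apply: groupX.
have ot : #[t]%g = p.
  by rewrite /t orderXdiv ?dvdn_div // divnA // mulKn ?order_gt0.
have tG := fintype.subsetP sub_Hd t tH.
have := wt_self_neq1 tw_fix PP pr_p e1 e2 e3 tG ot.
by rewrite /t wtX ?(fintype.subsetP sub_Hd) // h // expr1n eqxx.
Qed.

Lemma sum_cent_Hd : (\sum_(j | cent Hd j) kk j = m)%N.
Proof.
have := card_cent sub_Hd; rewrite card_Hd nE => /eqP.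
by rewrite eqn_pmul2l ?d_gt0 // => /eqP.
Qed.

Lemma centP (H : {group {perm I}}) j : reflect (forall s, s \in H -> wt s j = 1) (cent H j).
Proof.
by apply: (iffP forall_inP) => h s sH; [apply/eqP|apply/eqP]; rewrite h.
Qed.

Lemma Hd_cent_inj s t j k : s \in Hd -> t \in Hd -> cent Hd j -> cent Hd k ->
  s j = t k -> s = t /\ j = k.
Proof.
move=> sH tH /centP cj /centP ck e.
have sub u : u \in Hd -> u \in Ginv := fintype.subsetP sub_Hd u.
have wu u : u \in Hd -> wt u (s o) = wt u (t o).
  move=> uH; have /(congr1 (wt u)) := e.
  rewrite (wt_mul _ (sub u uH) (sub s sH)) (wt_mul _ (sub u uH) (sub t tH)).
  by rewrite cj // ck // !mulr1.
have wsym (a b : {perm I}) : a \in Ginv -> b \in Ginv -> wt a (b o) = wt b (a o).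
  by move=> aG bG; rewrite wtE // /wt; congr (_ / _); have := chi_sym (a o) o.
have /eqP : (s * t^-1 = 1)%g.
  apply: Hd_nondegenerate => [|u uH]; first by rewrite groupM ?groupV.
  have nt : wt t (u o) != 0 by rewrite -normr_eq0 norm_wt ?oner_eq0 ?sub.
  apply: (mulIf nt); rewrite -wtM ?groupM ?groupV ?sub // mulgKV mul1r.
  by rewrite wsym ?sub // wu // wsym ?sub.
rewrite -eq_mulgV1 => /eqP e'; split=> //.
by apply: (@perm_inj _ t); rewrite -e e'.
Qed.

(** By injectivity, the squared dimensions of the products [s j] sum to [d * m = n], which leaves
    nothing for any other simple object. *)
Lemma Hd_cent_surj i : exists s j, [/\ s \in Hd, cent Hd j & i = s j].
Proof.
apply: contrapT => nex.
pose A := finset.setX Hd [set j | cent Hd j].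
pose g (x : {perm I} * I) := x.1 x.2.
have ginj : {in A &, injective g}.
  move=> [s j] [t k]; rewrite !inE /= => /andP[sH cj] /andP[tH ck] e.
  by have [-> ->] := Hd_cent_inj sH tH cj ck e.
have : (\sum_(l in g @: A) kk l = n)%N.
  rewrite big_imset //= (eq_bigr (fun x => kk x.2)); last first.
    by move=> [s j]; rewrite inE /= => /andP[sH _]; rewrite kk_Ginv // (fintype.subsetP sub_Hd).
  rewrite (eq_bigl (fun x => (x.1 \in Hd) && (cent Hd x.2))); last first.
    by move=> [s j]; rewrite !inE.
  rewrite -(pair_big (mem Hd) (cent Hd) (fun _ j => kk j)) /= sum_cent_Hd sum_nat_const.
  by rewrite card_Hd nE.
have : (kk i + \sum_(l in g @: A) kk l <= n)%N.
  rewrite -sum_kk [leqRHS](bigD1 i) //= leq_add2l [leqLHS]big_mkcond [leqRHS]big_mkcond /=.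
  apply: leq_sum => l _; case: imsetP => [[[s j] /[!inE] /= /andP[sH cj] ->]|//].
  case: eqP => // e; case: nex; exists s, j; split=> //.
by move=> le e; move: le; rewrite e -[X in (_ <= X)%N]add0n leq_add2r leqNgt kk_gt0.
Qed.

Lemma cent_st j : cent Hd j -> cent Hd (st j).
Proof.
move=> /centP h; apply/centP => s sH; have sG := fintype.subsetP sub_Hd s sH.
by rewrite wtE // !chi_st -fmorph_div /= -wtE // h // rmorph1.
Qed.

Lemma cent_o : cent Hd o.
Proof.
apply/centP => s sH; have sG := fintype.subsetP sub_Hd s sH.
by rewrite wtE // !chi1 divr1.
Qed.

(** The characters of [s o] and of [o] agree on [j] and [k], where their absolute values are
    maximal. Equality in the triangle inequality ([phase]) determines their values on every
    constituent of the product. *)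
Lemma cent_N j k l : cent Hd j -> cent Hd k -> (0 < N j k l)%N -> cent Hd l.
Proof.
move=> /centP cj /centP ck Nl; apply/centP => s sH.
have sG := fintype.subsetP sub_Hd s sH.
have phase i : `|chi i j| = f j -> `|chi i k| = f k ->
    forall l', (N j k l')%:R * chi i l' = (N j k l')%:R * f l' * (chi i j * chi i k / (f j * f k)).
  move=> ej ek.
  have le l' : `|(N j k l')%:R * chi i l'| <= (N j k l')%:R * f l'.
    by rewrite normrM normr_nat ler_wpM2l ?ler0n ?chi_le.
  have e0 : `|\sum_l' (N j k l')%:R * chi i l'| = \sum_l' (N j k l')%:R * f l'.
    by rewrite -!chiM normrM ej ek.
  have e1 l' : `|(N j k l')%:R * chi i l'| = (N j k l')%:R * f l'.
    apply: (psumr_eq_le (P := predT) (F := fun l => `|(N j k l)%:R * chi i l|)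
      (G := fun l => (N j k l)%:R * f l)) => //.
    by apply/eqP; rewrite eq_le ler_sum //= -e0 ler_norm_sum.
  have /normC_sum_eq[t _ tP] : `|\sum_l' (N j k l')%:R * chi i l'| =
      \sum_l' `|(N j k l')%:R * chi i l'|.
    by rewrite e0; apply: eq_bigr => l' _; rewrite e1.
  have fjk : f j * f k != 0 by rewrite mulf_neq0 // gt_eqF ?f_gt0.
  move=> l'; rewrite tP // e1; congr (_ * _); apply: (mulIf fjk); rewrite divfK //.
  rewrite !chiM mulr_sumr; apply: eq_bigr => l'' _.
  by rewrite [RHS]tP // e1 mulrC.
have fo i : `|chi o i| = f i.
  by apply/eqP; rewrite -(@eqrXn2 _ 2) ?normr_ge0 ?(ltW (f_gt0 i)) // -sqd_f.
have chi_so i : wt s i = 1 -> chi (s o) i = chi o i.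
  by rewrite wtE // => /(congr1 (fun x => x * chi o i)); rewrite divfK // mul1r.
have ej := chi_so j (cj s sH); have ek := chi_so k (ck s sH).
have p1 := phase o (fo j) (fo k) l.
have p2 := phase (s o); rewrite ej ek !fo in p2; have {p2} p2 := p2 erefl erefl l.
rewrite wtE //; apply: (mulIf (chi_o_neq0 l)); rewrite divfK // mul1r.
have Nl0 : (N j k l)%:R != 0 :> K by rewrite pnatr_eq0 -lt0n.
by apply: (mulfI Nl0); rewrite p2 p1.
Qed.

(* The fusion subcategories of [D] and [D'] are given by the sets [A] and [B]
   of indices of simple objects. *)
Lemma numbers_decomposition : (d %| #|[pred g | kk g == 1%N]|)%N /\
  exists A B : pred I,
  [/\ [/\ #|A| = d, A o, (forall i, A i -> A (st i)),
           forall i j k, A i -> A j -> (0 < N i j k)%N -> A k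
         & forall i, A i -> kk i = 1%N],
      [/\ B o, (forall i, B i -> B (st i)),
           forall i j k, B i -> B j -> (0 < N i j k)%N -> B k
         & (\sum_(j | B j) kk j = m)%N],
      forall g j, A g -> B j -> chi j g / chi o g = 1,
      forall g j, A g -> exists k, forall k', N g j k' = (k' == k)
    & (forall i, exists g j, [/\ A g, B j & N g j i = 1%N]) /\
      forall g j g' j' i, A g -> B j -> A g' -> B j' ->
        (0 < N g j i)%N -> (0 < N g' j' i)%N -> g = g' /\ j = j'].
Proof.
split; first by rewrite -card_Ginv dvd_d_card_Ginv.
have sub u : u \in Hd -> u \in Ginv := fintype.subsetP sub_Hd u.
pose A := [pred g | g \in (fun s : {perm I} => s o) @: Hd].
have AP g : A g -> exists2 s : {perm I}, s \in Hd & g = s o by move=> /imsetP.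
have PA (s : {perm I}) : s \in Hd -> A (s o) by move=> sH; apply/imsetP; exists s.
exists A, (cent Hd); split.
- split.
  + rewrite (card_in_imset (fun s t sH tH => Ginv_o_inj (sub s sH) (sub t tH))).
    exact: card_Hd.
  + by have := PA 1%g (group1 _); rewrite perm1.
  + move=> i /AP[s sH ->]; suff -> : st (s o) = (s^-1)%g o by rewrite PA ?groupV.
    have := N_unit (s o) (st (s o)); rewrite eqxx N_Ginv ?sub //.
    by case: eqP => // e _; apply: (@perm_inj _ s); rewrite permKV -e.
  + move=> i j k /AP[s sH ->] /AP[t tH ->]; rewrite N_Ginv ?sub // lt0b => /eqP ->.
    by rewrite -permM PA ?groupM.
  + by move=> i /AP[s sH ->]; have /GinvP[] := sub s sH.
- split; [exact: cent_o|exact: cent_st|exact: cent_N|exact: sum_cent_Hd].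
- by move=> g j /AP[s sH ->] /centP/(_ s sH).
- by move=> g j /AP[s sH ->]; exists (s j) => k'; rewrite N_Ginv ?sub.
- split=> [i|g j g' j' i].
    have [s [j [sH cj ->]]] := Hd_cent_surj i; exists (s o), j; split=> //.
      exact: PA.
    by rewrite N_Ginv ?sub // eqxx.
  move=> /AP[s sH ->] cj /AP[t tH ->] cj'; rewrite !N_Ginv ?sub // !lt0b.
  move=> /eqP-> /eqP e; have [-> ->] := Hd_cent_inj sH tH cj cj' e.
  by [].
Qed.

End Decomposition.

End Perron.

(** The same result in terms of [chi i0] alone, since [kk] takes the positivity of [chi i0] and its
    sum of squares as arguments. *)
Theorem modular_numbers (tw : I -> K) (d m : nat) (i0 : I) :
  (forall l, 0 < chi i0 l) ->
  \sum_l chi i0 l ^+ 2 = (d * m)%:R ->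
  square_free d -> coprime d m ->
  (forall l k, chi i0 l ^+ 2 = k%:R -> coprime d k) ->
  (forall g j, chi i0 g = 1 -> N g j j = 1%N -> tw g * (chi j g / chi o g) = 1) ->
  (d %| #|[pred g | chi i0 g == 1%R]|)%N /\
  exists A B : pred I,
  [/\ [/\ #|A| = d, A o, (forall i, A i -> A (st i)),
           forall i j k, A i -> A j -> (0 < N i j k)%N -> A k
         & forall i, A i -> chi i0 i = 1],
      [/\ B o, (forall i, B i -> B (st i)),
           forall i j k, B i -> B j -> (0 < N i j k)%N -> B k
         & \sum_(j | B j) chi i0 j ^+ 2 = m%:R],
      forall g j, A g -> B j -> chi j g / chi o g = 1,
      forall g j, A g -> exists k, forall k', N g j k' = (k' == k)
    & (forall i, exists g j, [/\ A g, B j & N g j i = 1%N]) /\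
      forall g j g' j' i, A g -> B j -> A g' -> B j' ->
        (0 < N g j i)%N -> (0 < N g' j' i)%N -> g = g' /\ j = j'].
Proof.
move=> f0 sf sq cop copf twf.
have kf l : chi i0 l ^+ 2 = (kk f0 sf l)%:R by apply: f_kk.
have k1 l : (kk f0 sf l == 1%N) = (chi i0 l == 1).
  by rewrite -(eqr_nat K) -kf expr2 -expr2 sqrp_eq1 // ltW.
have ck l : coprime d (kk f0 sf l) by apply: (copf l); rewrite kf.
have tk g j : kk f0 sf g = 1%N -> N g j j = 1%N -> tw g * (chi j g / chi o g) = 1.
  by move=> /eqP; rewrite k1 => /eqP; apply: twf.
have [dG [A [B [[cA Ao As AN A1] [Bo Bs BN sB] AB Am bij]]]] :=
  numbers_decomposition tk erefl sq cop ck.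
split; first by rewrite (eq_card (B := [pred g | kk f0 sf g == 1%N])) // => l; rewrite !inE k1.
exists A, B; split=> //; split=> //.
  by move=> i /A1/eqP; rewrite k1 => /eqP.
by rewrite -sB natr_sum; apply: eq_bigr => l _; rewrite kf.
Qed.

End ModularNumbers.

(** * Frobenius-Perron dimensions *)

Section FrobeniusPerron.
Context {R : realType} {K : numClosedFieldType} {C : fusion K}.
Local Notation I := 'I_(rank C).
Variable phi : I -> R.
Hypothesis phi_gt0 : forall a, 0 < phi a.
Hypothesis phiM : forall a b, phi a * phi b = \sum_c (Nf a b c)%:R * phi c.

Lemma eigenvalue_right n (A : 'M[R]_n) x :
  eigenvalue A x <-> exists2 v : 'cV[R]_n, A *m v = x *: v & v != 0.
Proof.
have -> : eigenvalue A x = eigenvalue A^T x.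
  by rewrite !eigenvalue_root_char char_poly_trmx.
split=> [/eigenvalueP[v e v0]|[v e v0]].
  exists v^T; last by rewrite trmx_eq0.
  by apply: trmx_inj; rewrite trmx_mul trmxK e linearZ /= trmxK.
by apply/eigenvalueP; exists v^T; rewrite ?trmx_eq0 // -trmx_mul e linearZ.
Qed.

(** Compare an eigenvector with the positive eigenvector [phi] at an index where their ratio is
    largest. *)
Lemma fusion_mx_le a x : eigenvalue (fusion_mx R (irr C a)) x -> `|x| <= phi a.
Proof.
move=> /eigenvalue_right[v e v0].
have [i0 i0P] : exists i0, v i0 0 != 0.
  apply: contrapT => nex; case/eqP: v0; apply/colP => i; rewrite mxE.
  by apply/eqP/negPn/negP => h; apply: nex; exists i.
pose F i := `|v i 0| / phi i.
case: (arg_maxP F (erefl : predT i0)) => m _ mP.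
set rho := F m.
have mF i : F i <= rho by exact: mP.
have le i : `|v i 0| <= rho * phi i by rewrite -ler_pdivrMr ?phi_gt0 //; apply: mF.
have vm : `|v m 0| = rho * phi m by rewrite /rho /F divfK // gt_eqF.
have rho_gt0 : 0 < rho.
  by apply: lt_le_trans (mF i0); rewrite divr_gt0 ?normr_gt0.
have vm0 : 0 < `|v m 0| by rewrite vm mulr_gt0.
rewrite -(ler_pM2r vm0) -normrM.
have -> : x * v m 0 = \sum_c (Nf a m c)%:R * v c 0.
  by move/colP/(_ m): e; rewrite !mxE => <-; apply: eq_bigr => c _; rewrite mxE.
rewrite vm mulrCA phiM mulr_sumr; apply: le_trans (ler_norm_sum _ _ _) _.
by apply: ler_sum => c _; rewrite normrM normr_nat mulrCA ler_wpM2l ?ler0n.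
Qed.

Lemma FPdimE a : FPdim R (irr C a) = phi a.
Proof.
have ea : eigenvalue (fusion_mx R (irr C a)) (phi a).
  apply/eigenvalue_right; exists (\col_i phi i).
    by apply/colP => i; rewrite !mxE phiM; apply: eq_bigr => c _; rewrite !mxE.
  by apply/eqP => /colP/(_ a)/eqP; rewrite !mxE gt_eqF.
have ub x : (0 <= x /\ eigenvalue (fusion_mx R (irr C a)) x) -> x <= phi a.
  by move=> [_ /fusion_mx_le]; apply: le_trans; apply: ler_norm.
have mem : (0 <= phi a /\ eigenvalue (fusion_mx R (irr C a)) (phi a)).
  by split=> //; apply: ltW.
apply/eqP; rewrite eq_le; apply/andP; split.
  by apply: ge_sup => [|x hx]; [exists (phi a)|apply: ub].
by apply: ub_le_sup => //; exists (phi a) => x hx; apply: ub.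
Qed.

End FrobeniusPerron.

Section SimpleTensor.
Context {K : numClosedFieldType} {C : fusion K}.
Local Notation I := 'I_(rank C).

Lemma mult_unique_iso (X : C) j : (forall k, mult (irr C k) X = (k == j)) ->
  isomorphic X (irr C j).
Proof.
move=> h; have [n [a [u [v b]]]] := irr_sysP X.
have aj t : a t = j.
  have := h (a t); rewrite (mult_sys b); case: eqP => // _ /card0_eq/(_ t).
  by rewrite inE eqxx.
have n1 : n = 1%N.
  have <- : #|[pred t | a t == j]| = 1%N by rewrite -(mult_sys b) h eqxx.
  by rewrite -[LHS]card_ord; apply: eq_card => t; rewrite !inE aj eqxx.
move: a u v b aj; rewrite n1 => a u v [vu _ uv] aj.
rewrite -(aj ord0); exists (v ord0), (u ord0); split; last exact: vu.
by rewrite -uv big_ord1.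
Qed.

End SimpleTensor.

Section ModularCharacters.
Context {K : numClosedFieldType} {C : modular K}.
Local Notation I := 'I_(rank C).

Definition mchi (i j : I) : K := hch i (irr C j).
Definition mdim (i : I) : K := tr (idm (irr C i)).

Lemma NfC i j k : Nf (C := C) i j k = Nf j i k.
Proof. by apply: mult_iso; exists (braid (irr C i) (irr C j)); apply: braid_iso. Qed.

Lemma SE i j : S_mx (@twist K C) i j = mchi i j * mdim i.
Proof. exact: S_hch. Qed.

Lemma S_row_neq0 i : exists j, S_mx (@twist K C) i j != 0.
Proof.
apply: contrapT => nex; have := S_nondegenerate C; rewrite unitmxE.
rewrite (_ : \det _ = 0) ?unitr0 // (expand_det_row _ i) big1 // => j _.
suff -> : S_mx (@twist K C) i j = 0 by rewrite mul0r.
by apply/eqP/negPn/negP => h; apply: nex; exists j.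
Qed.

Lemma mdim_neq0 i : mdim i != 0.
Proof.
have [j] := S_row_neq0 i; rewrite SE; apply: contraNneq => ->.
by rewrite mulr0.
Qed.

Lemma mchi1 i : mchi i iunit = 1.
Proof.
have e j : mchi i iunit * mchi i j = mchi i j.
  by rewrite /mchi hchM (bigD1 j) //= Nf1l eqxx mul1r big1 ?addr0 // => l nl;
    rewrite Nf1l eq_sym (negPf nl) mul0r.
have [j] := S_row_neq0 i; rewrite SE mulf_eq0 negb_or => /andP[nz _].
by apply: (mulIf nz); rewrite e mul1r.
Qed.

Lemma mdimE i : mdim i = mchi iunit i * mdim iunit.
Proof. by rewrite -SE S_sym SE mchi1 mul1r. Qed.

Lemma mchi_o_neq0 i : mchi iunit i != 0.
Proof. by have := mdim_neq0 i; rewrite mdimE; apply: contraNneq => ->; rewrite mul0r. Qed.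

Lemma mchi_sym i j : mchi i j * mchi iunit i = mchi j i * mchi iunit j.
Proof.
apply: (mulIf (mdim_neq0 iunit)); rewrite -!mulrA -!mdimE -!SE.
exact: S_sym.
Qed.

(** Equal characters make two rows of the invertible S-matrix proportional. *)
Lemma mchi_inj i j : mchi i =1 mchi j -> i = j.
Proof.
move=> e; apply/eqP/negPn/negP => nij.
pose v : 'rV[K]_(rank C) := mdim j *: delta_mx 0 i - mdim i *: delta_mx 0 j.
have : v *m S_mx (@twist K C) = 0.
  apply/rowP => k; rewrite mulmxBl -!scalemxAl -!rowE !mxE -!/(S_mx _ _ _).
  have rE l : scalar_of (qtrace (@twist K C) (braid (irr C k) (irr C l) \oc braid (irr C l) (irr C k))) =
     mchi l k * mdim l by rewrite -SE mxE.
  by rewrite !rE e; ring.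
move/(congr1 (fun w => w *m invmx (S_mx (@twist K C)))).
rewrite mul0mx mulmxK ?S_nondegenerate // => /rowP/(_ i)/eqP.
by rewrite !mxE !eqxx (negPf nij) /= mulr1 mulr0 subr0 (negPf (mdim_neq0 j)).
Qed.

Lemma twist_scalar i : exists t, twist (irr C i) = t *: idm (irr C i).
Proof. exact: schur_end (irr_simple i). Qed.
Definition mtw i : K := sval (cid (twist_scalar i)).
Lemma mtwE i : twist (irr C i) = mtw i *: idm (irr C i).
Proof. exact: svalP (cid (twist_scalar i)). Qed.

Lemma mtw_neq0 i : mtw i != 0.
Proof.
apply/eqP => t0; have [f [_ h]] := twist_iso (irr C i).
have := simple_id_neq0 (irr_simple i).
by rewrite -h mtwE t0 scale0r comp0m eqxx.
Qed.

Lemma trZ (X : C) c (f : hom X X) : tr (c *: f) = c * tr f.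
Proof.
have e : trw (cpair X) (c *: f) munit = c *: trw (cpair X) f munit.
  by rewrite /trw rwZ compZm compmZ.
by apply: (@munit_inj _ C); move: e; rewrite !trwE scalerA.
Qed.

(** The product is simple, so the double braiding is a scalar. Its trace, an entry of the S-matrix,
    determines the scalar, and the balancing axiom then relates the twists. *)
Lemma braid_scalar g j k : isomorphic (irr C g \ot irr C j) (irr C k) ->
  braid (irr C j) (irr C g) \oc braid (irr C g) (irr C j) =
    (mchi j g / mchi iunit g) *: idm (irr C g \ot irr C j) /\
  mtw k = mtw g * mtw j * (mchi j g / mchi iunit g).
Proof.
move=> iso; have sgj := simple_iso (iso_sym iso) (irr_simple k).
have [l lE] := schur_end (braid (irr C j) (irr C g) \oc braid (irr C g) (irr C j)) sgj.
have [f [f' [f'f ff']]] := iso.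
have dk : mchi iunit k = mchi iunit g * mchi iunit j.
  by rewrite /mchi -(hch_iso _ iso) hch_tens.
have lambda : l = mchi j g / mchi iunit g.
  have : S_mx (@twist K C) g j = l * mdim k.
    rewrite S_mxE lE.
    have -> : l *: idm (irr C g \ot irr C j) = f' \oc (l *: f) by rewrite compmZ f'f.
    by rewrite tr_cyc compZm ff' trZ.
  rewrite SE (mdimE k) (mdimE g) dk => e.
  have {}e : mchi g j * mchi iunit g = l * (mchi iunit g * mchi iunit j).
    by apply: (mulIf (mdim_neq0 iunit)); rewrite -!mulrA e !mulrA.
  move: e; rewrite mchi_sym mulrA => /(mulIf (mchi_o_neq0 j)) ->.
  by rewrite mulfK // mchi_o_neq0.
split; first by rewrite lE lambda.
have : twist (irr C k) = (mtw g * mtw j * l) *: idm (irr C k).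
  rewrite -[LHS]hcompm1 -ff' hcompA twist_nat -hcompA twist_tens.
  rewrite -[(_ \otm _) \oc _ \oc _]hcompA lE !mtwE otmE rwZ rw1 lwZ lw1.
  rewrite !(compmZ, compZm, hcompm1, hcomp1m) ff' !scalerA; congr (_ *: _); ring.
rewrite mtwE lambda => e; apply/eqP; rewrite -subr_eq0.
have /eqP : (mtw k - mtw g * mtw j * (mchi j g / mchi iunit g)) *: idm (irr C k) = 0.
  by rewrite scalerBl e subrr.
by rewrite scaler_eq0 (negPf (simple_id_neq0 (irr_simple k))) orbF.
Qed.

End ModularCharacters.

(** * Subcategories spanned by simple objects *)

Lemma has_dim_gt0 (K : fieldType) (V : lmodType K) n : has_dim V n ->
  (0 < n)%N <-> exists v : V, v != 0.
Proof.
case: n => [|n] /has_dimP[e [c [le lc ec ce]]]; split=> //.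
  by case=> v; rewrite -[v]ce (_ : c v = 0) ?(linear_zero le) ?eqxx //; apply/rowP => -[].
move=> _; exists (e (const_mx 1)); apply/eqP => /(congr1 c).
rewrite ec (linear_zero lc) => /rowP/(_ ord0)/eqP.
by rewrite !mxE oner_eq0.
Qed.

Section FullSubcategory.
Context {K : fieldType} {C : lin_cat K}.
Variable E : C -> Prop.

Definition full_sub : lin_cat K := @LinCat K {X : C | E X}
  (fun X Y => hom (sval X) (sval Y)) (fun X => idm (sval X))
  (fun X Y Z g f => g \oc f)
  (fun W X Y Z h g f => hcompA h g f)
  (fun X Y f => hcomp1m f) (fun X Y f => hcompm1 f)
  (fun X Y Z f => hcomp_linearl f) (fun X Y Z g => hcomp_linearr g).

Hypothesis abC : abelian C.
Hypothesis E_biproduct : forall n (X : 'I_n -> C) S,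
  (forall k, E (X k)) -> is_biproduct X S -> E S.
Hypothesis E_mono : forall X Y (f : hom X Y), mono f -> E Y -> E X.
Hypothesis E_epi : forall X Y (f : hom X Y), epi f -> E X -> E Y.

Lemma full_sub_zero (X : full_sub) : is_zero X <-> is_zero (sval X).
Proof. by split=> /zeroP h; apply/zeroP. Qed.

(** The kernel taken in [C] lies in the subcategory, so testing against it is allowed there. *)
Lemma full_sub_mono (X Y : full_sub) (f : hom X Y) :
  mono f -> @mono K C (sval X) (sval Y) f.
Proof.
move=> mf; have [_ ker _ _ _] := abC.
have [Z [k kk]] := ker _ _ (f : @hom K C (sval X) (sval Y)).
pose Z' : full_sub := exist _ Z (E_mono (kernel_mono kk) (svalP X)).
have k0 : k = 0.
  by apply: (mf Z' k 0); rewrite [RHS]compm0; apply: kk.1.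
move=> W g h e; apply/subr0_eq.
have [|l [<- _]] := kk.2 W (g - h); first by rewrite compmD compmN e subrr.
by rewrite k0 comp0m.
Qed.

Lemma full_sub_epi (X Y : full_sub) (f : hom X Y) :
  epi f -> @epi K C (sval X) (sval Y) f.
Proof.
move=> ef; have [_ _ cok _ _] := abC.
have [Z [q qq]] := cok _ _ (f : @hom K C (sval X) (sval Y)).
pose Z' : full_sub := exist _ Z (E_epi (cokernel_epi qq) (svalP Y)).
have q0 : q = 0.
  by apply: (ef Z' q 0); rewrite [RHS]comp0m; apply: qq.1.
move=> W g h e; apply/subr0_eq.
have [|l [<- _]] := qq.2 W (g - h); first by rewrite compDm compNm e subrr.
by rewrite q0 compm0.
Qed.

Lemma full_sub_abelian : abelian full_sub.
Proof.
have [bip ker cok nmono nepi] := abC; split.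
- move=> n X; have [S [i [p b]]] := bip n (fun k => sval (X k)).
  have ES : E S by apply: E_biproduct (fun k => svalP (X k)) _; exists i, p; apply: b.
  by exists (exist _ S ES), i, p.
- move=> X Y f; have [Z [k kk]] := ker (sval X) (sval Y) f.
  exists (exist _ Z (E_mono (kernel_mono kk) (svalP X))), k.
  by split=> [|W g]; [apply: kk.1|apply: kk.2].
- move=> X Y f; have [Z [q qq]] := cok (sval X) (sval Y) f.
  exists (exist _ Z (E_epi (cokernel_epi qq) (svalP Y))), q.
  by split=> [|W g]; [apply: qq.1|apply: qq.2].
- move=> X Y f /full_sub_mono/nmono[V [g [gf fu]]].
  have [Z [q qq]] := cok (sval X) (sval Y) f.
  exists (exist _ Z (E_epi (cokernel_epi qq) (svalP Y))), q.
  split=> [|W h /= qh]; first by apply: qq.1.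
  have [g' [g'q _]] := qq.2 _ g gf.
  by apply: fu; rewrite -g'q -hcompA qh compm0.
- move=> X Y f /full_sub_epi/nepi[V [g [fg fu]]].
  have [Z [k kk]] := ker (sval X) (sval Y) f.
  exists (exist _ Z (E_mono (kernel_mono kk) (svalP X))), k.
  split=> [|W h /= hk]; first by apply: kk.1.
  have [g' [kg' _]] := kk.2 _ g fg.
  by apply: fu; rewrite -kg' hcompA hk comp0m.
Qed.

Lemma full_sub_simple (X : full_sub) : simple X <-> simple (sval X).
Proof.
split=> [[nz sX]|[nz sX]]; split=> [/full_sub_zero//|Y f mf].
- have [||] := sX (exist _ Y (E_mono mf (svalP X))) f.
  + by move=> W g h; apply: mf.
  + by move=> /full_sub_zero; left.
  + by right.
- have [|] := sX _ _ (full_sub_mono mf); first by move=> z; left; apply/full_sub_zero.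
  by right.
Qed.

End FullSubcategory.

Section FusionSubcategory.
Context {K : numClosedFieldType} {C : fusion K}.
Local Notation I := 'I_(rank C).

Lemma mult_gt0 j (X : C) : (0 < mult (irr C j) X)%N <-> exists f : hom (irr C j) X, f != 0.
Proof. exact: has_dim_gt0 (mult_has_dim j X). Qed.

Lemma mult_gt0r j (X : C) : (0 < mult (irr C j) X)%N <-> exists f : hom X (irr C j), f != 0.
Proof.
have [n [a [u [v b]]]] := irr_sysP X.
by rewrite (mult_sys b); apply: has_dim_gt0 (sys_has_dimr b j).
Qed.

Variable J : pred I.

(** Membership by simple constituents gives a replete subcategory, closed under subobjects and
    quotients. *)
Definition supported (X : C) : Prop := forall k, (0 < mult (irr C k) X)%N -> J k.

Lemma supported_irr k : supported (irr C k) <-> J k.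
Proof.
split=> [/(_ k)|Jk l]; first by rewrite mult_irr eqxx; apply.
by rewrite mult_irr; case: eqP => // <-.
Qed.

Lemma supported_iso X Y : isomorphic X Y -> supported X -> supported Y.
Proof. by move=> XY h k; rewrite -(mult_iso k XY); apply: h. Qed.

Lemma supported_mono X Y (f : hom X Y) : mono f -> supported Y -> supported X.
Proof.
move=> mf h k /mult_gt0[g g0]; apply/h/mult_gt0; exists (f \oc g).
by apply: contraNneq g0 => e; apply/eqP/mf; rewrite e compm0.
Qed.

Lemma supported_epi X Y (f : hom X Y) : epi f -> supported X -> supported Y.
Proof.
move=> ef h k /mult_gt0r[g g0]; apply/h/mult_gt0r; exists (g \oc f).
by apply: contraNneq g0 => e; apply/eqP/ef; rewrite e comp0m.
Qed.

Lemma supported_biproduct n (X : 'I_n -> C) S :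
  (forall k, supported (X k)) -> is_biproduct X S -> supported S.
Proof.
move=> h [i [p b]] k; rewrite (mult_bisys k b) lt0n sum_nat_eq0 negb_forall.
by case/existsP=> t /=; rewrite -lt0n; apply: h.
Qed.

Hypothesis J1 : J iunit.
Hypothesis Jdual : forall i, J i -> J (idual i).
Hypothesis JN : forall i j k, J i -> J j -> (0 < Nf i j k)%N -> J k.

Lemma supported_unit : supported munit.
Proof. exact: supported_iso (iso_sym iunitP) ((supported_irr _).2 J1). Qed.

Lemma supported_tens X Y : supported X -> supported Y -> supported (X \ot Y).
Proof.
move=> hX hY k; rewrite mult_tensl lt0n sum_nat_eq0 negb_forall => /existsP[i /=].
rewrite muln_eq0 negb_or -lt0n => /andP[/hX Ji].
rewrite mult_tensr sum_nat_eq0 negb_forall => /existsP[j /=].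
rewrite muln_eq0 negb_or -!lt0n => /andP[/hY Jj]; exact: JN.
Qed.

Lemma mult_ldual k X : (0 < mult (irr C k) (ldual X))%N ->
  exists2 i, k = idual i & (0 < mult (irr C i) X)%N.
Proof.
rewrite -(mult_iso k (iso_runit (ldual X))) (mult_iso k (iso_otm (iso_refl _) iunitP)).
rewrite (dual_mult _ _ (ldualP X)) -/(mult _ _) mult_tensl lt0n sum_nat_eq0 negb_forall.
move=> /existsP[i /=]; rewrite muln_eq0 negb_or -lt0n => /andP[Xi].
by rewrite -/(Nf _ _ _) Nf_unit; case: (k =P idual i) => // -> _; exists i.
Qed.

Lemma mult_rdual k X : (0 < mult (irr C k) (rdual X))%N ->
  exists2 i, k = idual i & (0 < mult (irr C i) X)%N.
Proof.
rewrite -(mult_iso k (iso_runit (rdual X))) (mult_iso k (iso_otm (iso_refl _) iunitP)).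
rewrite [mult _ _](esym (dual_mult (irr C k) iunit (rdualP X))) mult_tensl.
rewrite lt0n sum_nat_eq0 negb_forall.
move=> /existsP[i /=]; rewrite muln_eq0 negb_or -lt0n => /andP[Xi].
by rewrite -/(Nf _ _ _) Nf_unit; case: (k =P idual i) => // -> _; exists i.
Qed.

Lemma supported_ldual X : supported X -> supported (ldual X).
Proof. by move=> h k /mult_ldual[i -> /h]; apply: Jdual. Qed.

Lemma supported_rdual X : supported X -> supported (rdual X).
Proof. by move=> h k /mult_rdual[i -> /h]; apply: Jdual. Qed.

Lemma supported_fusion_subcat : fusion_subcat supported.
Proof.
split; first exact: supported_unit.
- exact: supported_tens.
- by move=> X h; split; [apply: supported_ldual|apply: supported_rdual].
- exact: supported_biproduct.
- move=> X Y i p pi; apply: (@supported_mono _ _ i) => W g h e.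
  by rewrite -(hcomp1m g) -(hcomp1m h) -pi -!hcompA e.
Qed.

Local Notation sub := (full_sub supported).

Definition sub_tens : bifunctor sub sub sub := @Bifunctor K sub sub sub
  (fun X Y => exist _ (sval X \ot sval Y) (supported_tens (svalP X) (svalP Y)))
  (fun X X' Y Y' => @bmap K C C C (tens C) (sval X) (sval X') (sval Y) (sval Y'))
  (fun X Y => bmap1 _ (sval X) (sval Y))
  (fun X X' X'' Y Y' Y'' => @bmapM K C C C (tens C) (sval X) (sval X') (sval X'')
     (sval Y) (sval Y') (sval Y''))
  (fun X X' Y Y' g => @bmap_linearl K _ _ _ _ (sval X) (sval X') (sval Y) (sval Y') g)
  (fun X X' Y Y' f => @bmap_linearr K _ _ _ _ (sval X) (sval X') (sval Y) (sval Y') f).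

Definition sub_monoidal : monoidal K := @Monoidal K sub sub_tens
  (exist _ munit supported_unit)
  (fun X Y Z => assoc (sval X) (sval Y) (sval Z))
  (fun X Y Z => associ (sval X) (sval Y) (sval Z))
  (fun X => lunit (sval X)) (fun X => luniti (sval X))
  (fun X => runit (sval X)) (fun X => runiti (sval X))
  (fun X Y Z => assocK _ _ _) (fun X => lunitK _) (fun X => runitK _)
  (fun X X' Y Y' Z Z' => @assoc_nat K C (sval X) (sval X') (sval Y) (sval Y') (sval Z) (sval Z'))
  (fun X X' => @lunit_nat K C (sval X) (sval X'))
  (fun X X' => @runit_nat K C (sval X) (sval X'))
  (fun W X Y Z => pentagon _ _ _ _) (fun X Y => triangle _ _).

Definition sub_irr (i : 'I_#|J|) : sub :=
  exist _ (irr C (enum_val i)) ((supported_irr _).2 (enum_valP i)).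

Lemma sub_semisimple : semisimple sub.
Proof.
move=> X; have [n [a [u [v b]]]] := irr_sysP (sval X).
have Ja t : J (a t).
  by apply: (svalP X); rewrite (mult_sys b); apply/card_gt0P; exists t; rewrite inE.
exists n, (fun t => exist _ (irr C (a t)) ((supported_irr _).2 (Ja t))); split.
  move=> t; apply/full_sub_simple; last exact: irr_simple.
  - exact: fus_abelian.
  - exact: supported_mono.
by exists u, v.
Qed.

Lemma sub_simple (X : sub) : simple X <-> simple (sval X).
Proof. by apply: full_sub_simple; [exact: fus_abelian|exact: supported_mono]. Qed.

Lemma sub_irr_surj (X : sub) : simple X -> exists i, isomorphic X (sub_irr i).
Proof.
move=> /sub_simple/irr_surj[k iso].
have Jk : k \in J by apply/(supported_irr k)/(supported_iso iso)/svalP.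
exists (enum_rank_in Jk k).
have [f [g fg]] : isomorphic (sval X) (irr C (enum_val (enum_rank_in Jk k))).
  by rewrite enum_rankK_in.
by exists f, g.
Qed.

Lemma sub_irr_inj i j : isomorphic (sub_irr i) (sub_irr j) -> i = j.
Proof.
move=> [f [g fg]]; apply/enum_val_inj/irr_inj; by exists f, g.
Qed.

Lemma sub_hom_finite : hom_finite sub.
Proof. by move=> X Y; exact: fus_hom_finite. Qed.

Lemma sub_abelian : abelian sub.
Proof.
apply: full_sub_abelian; first exact: fus_abelian.
- exact: supported_biproduct.
- exact: supported_mono.
- exact: supported_epi.
Qed.

Definition sub_fusion : fusion K := @Fusion K sub_monoidal sub_abelian sub_semisimple
  sub_hom_finite ((sub_simple (munit : sub_monoidal)).2 (@fus_one_simple _ C))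
  #|J| sub_irr (fun i => (sub_simple (sub_irr i)).2 (irr_simple (enum_val i)))
  sub_irr_inj sub_irr_surj
  (fun X => exist _ (ldual (sval X)) (supported_ldual (svalP X)))
  (fun X => ldual_ev (sval X)) (fun X => ldual_coev (sval X)) (fun X => ldualP (sval X))
  (fun X => exist _ (rdual (sval X)) (supported_rdual (svalP X)))
  (fun X => rdual_ev (sval X)) (fun X => rdual_coev (sval X)) (fun X => rdualP (sval X)).

Section Dimension.
Variables (R : realType) (phi : I -> R).
Hypothesis phi_gt0 : forall a, 0 < phi a.
Hypothesis phiM : forall a b, phi a * phi b = \sum_c (Nf a b c)%:R * phi c.

Lemma FPdim_sub_irr (i : 'I_(rank sub_fusion)) : FPdim R (irr sub_fusion i) = phi (enum_val i).
Proof.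
apply: (@FPdimE R K sub_fusion (fun i => phi (enum_val i))) => [a|a b] //.
rewrite phiM (bigID J) /= [X in _ + X]big1 ?addr0 /= => [|k nJk]; last first.
  case: (posnP (Nf (enum_val a) (enum_val b) k)) => [->|h]; first by rewrite mul0r.
  by case/negP: nJk; apply: JN h; apply: enum_valP.
by rewrite big_enum_val.
Qed.

Lemma FPdim_cat_sub : FPdim_cat R sub_fusion = \sum_(i | J i) phi i ^+ 2.
Proof.
by rewrite [RHS]big_enum_val /=; apply: eq_bigr => i _; rewrite FPdim_sub_irr.
Qed.

End Dimension.

End FusionSubcategory.

Section BraidedSubcategory.
Context {K : numClosedFieldType} {C : braided_fusion K}.
Local Notation I := 'I_(rank C).
Variable J : pred I.
Hypothesis J1 : J iunit.
Hypothesis Jdual : forall i, J i -> J (idual i).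
Hypothesis JN : forall i j k, J i -> J j -> (0 < Nf i j k)%N -> J k.

Definition sub_braided : braided_fusion K := @BraidedFusion K (sub_fusion J1 Jdual JN)
  (fun X Y => braid (sval X) (sval Y))
  (fun X Y => braid_iso (sval X) (sval Y))
  (fun X X' Y Y' => @braid_nat K C (sval X) (sval X') (sval Y) (sval Y'))
  (fun X Y Z => hexagon1 (sval X) (sval Y) (sval Z))
  (fun X Y Z => hexagon2 (sval X) (sval Y) (sval Z)).

End BraidedSubcategory.

(** On the rows of [J] every column of [A] is a multiple of a column indexed by [J], so a relation
    between the rows of [B] is one between rows of [A]. *)
Lemma unitmx_principal (F : fieldType) n (J : pred 'I_n) (A : 'M[F]_n) (B : 'M[F]_#|J|) :
  (forall i j, B i j = A (enum_val i) (enum_val j)) -> A \in unitmx ->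
  (forall k, exists2 g, J g & exists c, forall j, J j -> A j k = c * A j g) ->
  B \in unitmx.
Proof.
move=> BE uA AJ.
rewrite -row_free_unit -kermx_eq0; apply/rowV0P => v /sub_kermxP vB.
pose w : 'rV[F]_n := \sum_i v 0 i *: delta_mx 0 (enum_val i).
have wA : w *m A = 0.
  apply/rowP => k; have [g Jg [c cP]] := AJ k.
  rewrite /w mulmx_suml summxE [RHS]mxE.
  rewrite (eq_bigr (fun i => c * (v 0 i * A (enum_val i) g))) => [|i _]; last first.
    rewrite -scalemxAl -rowE !mxE (cP _ (enum_valP i)); exact: mulrCA.
  rewrite -mulr_sumr; have /rowP/(_ (enum_rank_in Jg g)) := vB.
  rewrite !mxE (eq_bigr (fun i => v 0 i * A (enum_val i) g)) => [->|i _].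
    by rewrite mulr0.
  by rewrite BE enum_rankK_in.
have w0 : w = 0 by rewrite -[w](mulmxK uA) wA mul0mx.
apply/rowP => i; have /rowP/(_ (enum_val i)) := w0.
rewrite /w summxE (bigD1 i) //= big1 => [|j nji].
  by rewrite !mxE !eqxx mulr1 addr0.
by rewrite !mxE eqxx (inj_eq enum_val_inj) eq_sym (negPf nji) mulr0.
Qed.

Section ModularSubcategory.
Context {K : numClosedFieldType} {C : modular K}.
Local Notation I := 'I_(rank C).
Local Notation S := (S_mx (@twist K C)).
Variable J : pred I.
Hypothesis J1 : J iunit.
Hypothesis Jdual : forall i, J i -> J (idual i).
Hypothesis JN : forall i j k, J i -> J j -> (0 < Nf i j k)%N -> J k.
Hypothesis JS : forall k, exists2 g, J g & exists c, forall j, J j -> S j k = c * S j g.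

Local Notation sub := (sub_braided J1 Jdual JN).
Definition sub_twist (X : sub) : hom X X := twist (sval X).

Lemma sub_S_nondegenerate : S_mx sub_twist \in unitmx.
Proof.
apply: unitmx_principal (S_nondegenerate C) JS => i j.
by rewrite [LHS]mxE [RHS]mxE.
Qed.

Definition sub_modular : modular K := @Modular K sub sub_twist
  (fun X => twist_iso (sval X))
  (fun X Y => @twist_nat K C (sval X) (sval Y))
  (fun X Y => twist_tens (sval X) (sval Y))
  (fun X => twist_dual (sval X)) sub_S_nondegenerate.

End ModularSubcategory.

Section Invertible.
Context {K : numClosedFieldType} {C : fusion K}.
Local Notation I := 'I_(rank C).

Lemma left_dual_neq0 (X Xs : C) ev coev : @is_left_dual _ C X Xs ev coev -> simple X ->
  ev != 0 /\ coev != 0.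
Proof.
move=> [z _] sX; have := simple_id_neq0 sX; rewrite -z => nz.
split; apply: contraNneq nz => ->; rewrite -/(lwhisk _ _) -/(rwhisk _ _).
  by rewrite (linear_zero (@lw_linear _ C _ _ _)) compm0 !comp0m.
by rewrite (linear_zero (@rw_linear _ C _ _ _)) compm0 !comp0m.
Qed.

Lemma iso_ldual (i : I) (X : C) : isomorphic X (irr C i) ->
  isomorphic (ldual X) (irr C (idual i)).
Proof.
move=> iso; apply: mult_unique_iso => k; rewrite -(mult_iso k (iso_runit (ldual X))).
rewrite (mult_iso k (iso_otm (iso_refl _) iunitP)) (dual_mult _ _ (ldualP X)).
by rewrite -/(mult _ _) (mult_iso _ (iso_otm iso (iso_refl _))) -/(Nf _ _ _) Nf_unit.
Qed.

Lemma invertible_irr (i : I) (X : C) : isomorphic X (irr C i) ->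
  (forall k, Nf i (idual i) k = (k == iunit)) ->
  (forall k, Nf (idual i) i k = (k == iunit)) -> invertible X.
Proof.
move=> iso h1 h2; have sX := simple_iso (iso_sym iso) (irr_simple i).
have [ev0 coev0] := left_dual_neq0 (ldualP X) sX.
have s1 := fus_one_simple C; have ab := fus_abelian C.
have sim Y Z k : isomorphic Y Z -> (forall l, mult (irr C l) Z = (l == k)) -> simple Y.
  move=> YZ mZ; apply: simple_iso (irr_simple k).
  exact/iso_sym/(iso_trans YZ)/mult_unique_iso.
split; apply: schur_iso => //.
  by apply: (sim _ _ iunit (iso_otm (iso_ldual iso) iso)).
by apply: (sim _ _ iunit (iso_otm iso (iso_ldual iso))).
Qed.

End Invertible.

(** * The Deligne product *)

Lemma linear_sub (K : fieldType) (V W : lmodType K) (f : V -> W) u v :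
  linear f -> f (u - v) = f u - f v.
Proof. by move=> lf; have := lf (-1) v u; rewrite !scaleN1r !(addrC (- _)). Qed.

Section BiproductMaps.
Context {K : fieldType} {C : lin_cat K}.

Lemma bisys_ext (T T' : finType) (S : T -> C) (S' : T' -> C) X X' u v u' v'
    (g h : hom X X') :
  @bisys _ C T S X u v -> @bisys _ C T' S' X' u' v' ->
  (forall t t', v' t' \oc (g \oc u t) = v' t' \oc (h \oc u t)) -> g = h.
Proof.
move=> b b' e; rewrite (bisys_expand g b') (bisys_expand h b').
apply: eq_bigr => t' _; congr (_ \oc _).
rewrite (bisys_expandr (v' t' \oc g) b) (bisys_expandr (v' t' \oc h) b).
by apply: eq_bigr => t _; congr (_ \oc _); rewrite -!hcompA; apply: e.
Qed.

Lemma bisys_insert (T : finType) (S : T -> C) X u v Y Z (g : hom X Z) (f : hom Y X) :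
  @bisys _ C T S X u v -> g \oc f = \sum_t ((g \oc u t) \oc (v t \oc f)).
Proof.
move=> [_ _ e]; rewrite -{1}[f]hcomp1m -e comp_suml comp_sumr.
by apply: eq_bigr => t _; rewrite !hcompA.
Qed.

End BiproductMaps.

Section Regularity.
Context {K : numClosedFieldType} {C : fusion K}.
Local Notation I := 'I_(rank C).

Lemma eirr_compr (i j k : I) : j = k -> eirr j k \oc eirr i j = eirr i k.
Proof. by move=> <-; rewrite eirr_id hcomp1m. Qed.

Lemma von_neumann_regular (X Y : C) (f : hom X Y) : exists r : hom Y X, f \oc (r \oc f) = f.
Proof.
have [n [a [u [v bX]]]] := irr_sysP X; have [m [b [w [z bY]]]] := irr_sysP Y.
(* Between different simple objects [eirr] is 0 and [coef] is an arbitrary choice, so those entries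
   are set to 0. The morphism [r] is then read off the pseudo-inverse of this matrix. *)
pose M : 'M[K]_(m, n) := \matrix_(s, t) (coef (z s \oc (f \oc u t)) *+ (a t == b s)).
pose N := pinvmx M.
have Mn s t : a t != b s -> M s t = 0 by move=> ne; rewrite mxE (negPf ne).
have ME s t : z s \oc (f \oc u t) = M s t *: eirr (a t) (b s).
  have [e|ne] := eqVneq (a t) (b s); last by rewrite eirr_ne // scaler0; apply: irr_schur.
  by rewrite {1}(coefE (z s \oc _)) mxE (introT eqP e).
pose r := \sum_t \sum_s N t s *: (u t \oc (eirr (b s) (a t) \oc z s)).
have rE t s : v t \oc (r \oc w s) = N t s *: eirr (b s) (a t).
  have [vu vu0 _] := bX; have [zw zw0 _] := bY.
  rewrite /r comp_suml comp_sumr (bigD1 t) //= [X in _ + X]big1 ?addr0 => [|t' nt]; last first.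
    rewrite comp_suml comp_sumr big1 // => s' _.
    by rewrite compZm compmZ -hcompA hcompA vu0 1?eq_sym // comp0m scaler0.
  rewrite comp_suml comp_sumr (bigD1 s) //= [X in _ + X]big1 ?addr0 => [|s' ns]; last first.
    by rewrite compZm compmZ -!hcompA zw0 ?compm0 ?scaler0.
  by rewrite compZm compmZ -!hcompA zw (comp_eq (vu t)) hcomp1m hcompm1.
exists r; apply: (bisys_ext bX bY) => t s.
have -> : z s \oc (f \oc (r \oc f) \oc u t) = \sum_t1 \sum_s1
    ((M s t1 * N t1 s1 * M s1 t) *: eirr (a t) (b s)).
  have -> : z s \oc (f \oc (r \oc f) \oc u t) = (z s \oc f) \oc (r \oc (f \oc u t)).
    by rewrite -!hcompA.
  rewrite (bisys_insert _ _ bX); apply: eq_bigr => t1 _.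
  rewrite -[z s \oc f \oc _]hcompA ME [v t1 \oc _]hcompA (bisys_insert _ _ bY) comp_sumr.
  apply: eq_bigr => s1 _; rewrite -[v t1 \oc r \oc _]hcompA rE ME.
  have [e1|/Mn->] := eqVneq (a t1) (b s); last by rewrite !mul0r !scale0r comp0m.
  have [e2|/Mn->] := eqVneq (a t) (b s1); last by rewrite mulr0 !scale0r !compm0.
  rewrite !(compZm, compmZ, scalerA).
  by rewrite (eirr_comp _ e2) (eirr_compr _ e1).
rewrite ME -[in RHS](mulmxKpV (submx_refl M)) -/N.
rewrite [(_ *m M) s t]mxE scaler_suml exchange_big /=; apply: eq_bigr => s1 _.
by rewrite [(M *m N) s s1]mxE mulr_suml scaler_suml.
Qed.

(** A cokernel witnessed by equations between morphisms is preserved by every linear functor. *)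
Lemma cokernel_split (X Y Z : C) (f : hom X Y) (q : hom Y Z) : is_cokernel f q ->
  exists (s : hom Z Y) (r : hom Y X), q \oc s = idm Z /\ idm Y - (s \oc q) = f \oc r.
Proof.
move=> cq; have [qf uq] := cq; have [r rf] := von_neumann_regular f.
have [|s [sq _]] := uq _ (idm Y - (f \oc r)).
  by rewrite compDm compNm hcomp1m -hcompA rf subrr.
exists s, r; split; last by rewrite sq subKr.
apply: (cokernel_epi cq); rewrite -hcompA sq compmD compmN hcompm1 hcompA qf.
by rewrite comp0m subr0 hcomp1m.
Qed.

Lemma split_cokernel (A : lin_cat K) (X Y Z : A) (f : hom X Y) (q : hom Y Z) s r :
  q \oc f = 0 -> q \oc s = idm Z -> idm Y - (s \oc q) = f \oc r -> is_cokernel f q.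
Proof.
move=> qf qs e; split=> // W g gf; exists (g \oc s); split=> [|h <-]; last first.
  by rewrite -hcompA qs hcompm1.
have : g \oc (idm Y - (s \oc q)) = 0 by rewrite e hcompA gf comp0m.
by rewrite compmD compmN hcompm1 hcompA => /subr0_eq.
Qed.

Lemma fusion_right_exact (A : lin_cat K) (F : lin_functor C A) : right_exact F.
Proof.
move=> X Y Z f q cq; have [s [r [qs e]]] := cokernel_split cq.
apply: (@split_cokernel _ _ _ _ _ _ (fmap F s) (fmap F r)).
- by rewrite -fmapM cq.1 (linear_zero (@fmap_linear _ _ _ F _ _)).
- by rewrite -fmapM qs fmap1.
- by rewrite -!fmapM -e (linear_sub _ _ (@fmap_linear _ _ _ F _ _)) fmap1.
Qed.

End Regularity.

Section BifunctorExactness.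
Context {K : numClosedFieldType} {D D' : fusion K} {A : lin_cat K}.

Definition bifunctor_l (F : bifunctor D D' A) (Y : D') : lin_functor D A :=
  @LinFunctor K D A (fun X => F X Y) (fun X X' f => bmap F f (idm Y))
    (fun X => bmap1 F X Y)
    (fun X X' X'' g f => etrans (congr1 (bmap F (g \oc f)) (esym (hcomp1m (idm Y))))
      (bmapM F g f (idm Y) (idm Y)))
    (fun X X' => @bmap_linearl K D D' A F X X' Y Y (idm Y)).

Definition bifunctor_r (F : bifunctor D D' A) (X : D) : lin_functor D' A :=
  @LinFunctor K D' A (fun Y => F X Y) (fun Y Y' g => bmap F (idm X) g)
    (fun Y => bmap1 F X Y)
    (fun Y Y' Y'' g f => etrans (congr1 (fun i => bmap F i (g \oc f)) (esym (hcomp1m (idm X))))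
      (bmapM F (idm X) (idm X) g f))
    (fun Y Y' => @bmap_linearr K D D' A F X X Y Y' (idm X)).

Lemma fusion_biright_exact (F : bifunctor D D' A) : biright_exact F.
Proof.
split=> [Y X X' X'' f q|X Y Y' Y'' g q].
  exact: (@fusion_right_exact _ _ _ (bifunctor_l F Y)).
exact: (@fusion_right_exact _ _ _ (bifunctor_r F X)).
Qed.

End BifunctorExactness.

Section BifunctorSums.
Context {K : fieldType} {C D A : lin_cat K}.
Variable F : bifunctor C D A.

Lemma bmapZl X X' Y Y' c (f : hom X X') (g : hom Y Y') :
  bmap F (c *: f) g = c *: bmap F f g.
Proof. exact: (linear_scale c f (@bmap_linearl _ _ _ _ F X X' Y Y' g)). Qed.

Lemma bmapZr X X' Y Y' c (f : hom X X') (g : hom Y Y') :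
  bmap F f (c *: g) = c *: bmap F f g.
Proof. exact: (linear_scale c g (@bmap_linearr _ _ _ _ F X X' Y Y' f)). Qed.

Lemma bmap0l X X' Y Y' (g : hom Y Y') : bmap F (0 : hom X X') g = 0.
Proof. exact: (linear_zero (@bmap_linearl _ _ _ _ F X X' Y Y' g)). Qed.

Lemma bmap0r X X' Y Y' (f : hom X X') : bmap F f (0 : hom Y Y') = 0.
Proof. exact: (linear_zero (@bmap_linearr _ _ _ _ F X X' Y Y' f)). Qed.

Lemma bisys_bmap (T T' : finType) (S : T -> C) (S' : T' -> D) X Y u v u' v' :
  @bisys _ C T S X u v -> @bisys _ D T' S' Y u' v' ->
  @bisys _ A (T * T')%type (fun t => F (S t.1) (S' t.2)) (F X Y)
    (fun t => bmap F (u t.1) (u' t.2)) (fun t => bmap F (v t.1) (v' t.2)).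
Proof.
move=> [vu vu0 uv] [vu' vu0' uv']; split=> [[t t']|[t t'] [s s'] ne|] /=.
- by rewrite -bmapM vu vu' bmap1.
- rewrite -bmapM; have [e|nts] := eqVneq t s; last by rewrite vu0 // bmap0l.
  have nts' : t' != s' by apply: contraNneq ne => ->; rewrite e.
  by rewrite vu0' // bmap0r.
- rewrite -(pair_bigA _ (fun t t' => bmap F (u t) (u' t') \oc bmap F (v t) (v' t'))) /=.
  rewrite -bmap1 -uv (linear_sum _ _ _ (@bmap_linearl _ _ _ _ F _ _ _ _ _)).
  apply: eq_bigr => t _; rewrite -uv' (linear_sum _ _ _ (@bmap_linearr _ _ _ _ F _ _ _ _ _)).
  by apply: eq_bigr => t' _; rewrite bmapM.
Qed.

End BifunctorSums.

Section Universality.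
Context {K : numClosedFieldType} {D D' P : fusion K}.
Variable T : bifunctor D D' P.
Local Notation I := ('I_(rank D) * 'I_(rank D'))%type.
Local Notation TT a := (T (irr D a.1) (irr D' a.2)).
Hypothesis T_simple : forall a : I, simple (TT a).
Hypothesis T_inj : forall a b : I, isomorphic (TT a) (TT b) -> a = b.
Hypothesis T_surj : forall k, exists a : I, isomorphic (irr P k) (TT a).

Lemma T_schur (a b : I) (h : hom (TT a) (TT b)) : a != b -> h = 0.
Proof.
move=> nab; apply/eqP/negPn/negP => h0; case/eqP: nab; apply: T_inj; exists h.
exact: (schur_iso (@fus_abelian _ P) (T_simple a) (T_simple b) h0).
Qed.

Local Notation e1 a b := (eirr a.1 b.1).
Local Notation e2 a b := (eirr a.2 b.2).

Lemma T_homP (a b : I) (h : hom (TT a) (TT b)) :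
  exists c, h = c *: bmap T (e1 a b) (e2 a b).
Proof.
have [e|ne] := eqVneq a b; last by exists 0; rewrite scale0r; apply: T_schur.
case: _ / e h => h; have [c ->] := schur_end h (T_simple a).
by exists c; rewrite !eirr_id bmap1.
Qed.

Lemma T_sysP (Z : P) : exists n (a : 'I_n -> I) u v,
  @bisys _ P 'I_n (fun t => TT (a t)) Z u v.
Proof.
have [n [c [u [v b]]]] := irr_sysP Z.
have [a aP] := choice (fun t => T_surj (c t)).
by exists n, a; apply: (@bisys_rename _ _ _ _ _ _ _ _ a (fun a : I => TT a) b aP).
Qed.

(** Naturality on products of morphisms, which the universal property supplies, thus extends to all
    morphisms between products. *)
Lemma T_full (X X' : D) (Y Y' : D') (h : hom (T X Y) (T X' Y')) :
  exists (S : finType) (f : S -> hom X X') (g : S -> hom Y Y'), h = \sum_s bmap T (f s) (g s).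
Proof.
have [n [a [u [v bX]]]] := irr_sysP X; have [n' [a' [u' [v' bX']]]] := irr_sysP X'.
have [m [b [w [z bY]]]] := irr_sysP Y; have [m' [b' [w' [z' bY']]]] := irr_sysP Y'.
have B := bisys_bmap T bX bY; have B' := bisys_bmap T bX' bY'.
have [c cP] := dep_choice (fun t : 'I_n * 'I_m => dep_choice (fun s : 'I_n' * 'I_m' =>
  T_homP (a := (a t.1, b t.2)) (b := (a' s.1, b' s.2))
    (bmap T (v' s.1) (z' s.2) \oc (h \oc bmap T (u t.1) (w t.2))))).
exists (('I_n * 'I_m) * ('I_n' * 'I_m'))%type.
exists (fun x => c x.1 x.2 *: (u' x.2.1 \oc (eirr (a x.1.1) (a' x.2.1) \oc v x.1.1))).
exists (fun x => w' x.2.2 \oc (eirr (b x.1.2) (b' x.2.2) \oc z x.1.2)).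
rewrite -(pair_bigA _ (fun t s => bmap T (c t s *: (u' s.1 \oc (eirr (a t.1) (a' s.1) \oc v t.1)))
  (w' s.2 \oc (eirr (b t.2) (b' s.2) \oc z t.2)))) /=.
rewrite {1}(bisys_expandr h B); apply: eq_bigr => t _.
rewrite (bisys_expand (h \oc _) B') comp_suml; apply: eq_bigr => s _.
by rewrite cP bmapZl !bmapM compmZ compZm -hcompA.
Qed.

Section Extension.
Variable A : lin_cat K.
Hypothesis abA : abelian A.

Section Naturality.
Variables G G' : lin_functor P A.
Variable a : forall X Y, hom (G (T X Y)) (G' (T X Y)).
Hypothesis aT : forall (X X' : D) (Y Y' : D') (f : hom X X') (g : hom Y Y'),
  a X' Y' \oc fmap G (bmap T f g) = fmap G' (bmap T f g) \oc a X Y.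

Lemma T_nat X X' Y Y' (h : hom (T X Y) (T X' Y')) :
  a X' Y' \oc fmap G h = fmap G' h \oc a X Y.
Proof.
have [S [f [g ->]]] := T_full h.
rewrite (linear_sum _ _ _ (@fmap_linear _ _ _ G _ _)).
rewrite (linear_sum _ _ _ (@fmap_linear _ _ _ G' _ _)) comp_suml comp_sumr.
by apply: eq_bigr => s _; apply: aT.
Qed.

Lemma fmap_expandr (H : lin_functor P A) Z (S : finType) (Q : S -> P) u v W
    (f : hom (H Z) W) : @bisys _ P S Q Z u v ->
  f = \sum_s ((f \oc fmap H (u s)) \oc fmap H (v s)).
Proof.
move=> [_ _ e]; rewrite -{1}[f]hcompm1 -fmap1 -e.
rewrite (linear_sum _ _ _ (@fmap_linear _ _ _ H _ _)) comp_sumr.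
by apply: eq_bigr => s _; rewrite fmapM hcompA.
Qed.

(** Naturality along a decomposition of [Z] into products of simple objects forces the formula for
    [b Z]; [T_nat] shows that this formula is natural and extends [a]. *)
Lemma extension_unique : exists! b : forall Z, hom (G Z) (G' Z),
  (forall (Z Z' : P) (f : hom Z Z'), b Z' \oc fmap G f = fmap G' f \oc b Z) /\
  forall X Y, b (T X Y) = a X Y.
Proof.
have [n nP] := choice T_sysP; have [al alP] := dep_choice nP.
have [u uP] := dep_choice alP; have [v vP] := dep_choice uP.
pose b Z := \sum_t (fmap G' (u Z t) \oc
  (a (irr D (al Z t).1) (irr D' (al Z t).2) \oc fmap G (v Z t))).
exists b; split.
  split=> [Z Z' f|X Y].
    rewrite (fmap_expandr (b Z' \oc _) (vP Z)) /b comp_sumr; apply: eq_bigr => t _.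
    rewrite !hcompA; apply: (congr1 (fun x => x \oc fmap G (v Z t))).
    rewrite !comp_suml -!fmapM.
    have fE := bisys_expand (f \oc u Z t) (vP Z').
    rewrite [in RHS]fE.
    rewrite (linear_sum _ _ _ (@fmap_linear _ _ _ G' _ _)) comp_suml.
    apply: eq_bigr => s _; rewrite -!hcompA -!fmapM T_nat.
    by rewrite !fmapM -!hcompA.
  rewrite [RHS](fmap_expandr _ (vP (T X Y))); apply: eq_bigr => t _.
  by rewrite hcompA -T_nat.
move=> b' [b'nat b'T]; apply: functional_extensionality_dep => Z.
rewrite [RHS](fmap_expandr _ (vP Z)); apply: eq_bigr => t _.
by rewrite b'nat b'T hcompA.
Qed.

End Naturality.

Section Existence.
Variable F : bifunctor D D' A.
Local Notation FF a := (F (irr D a.1) (irr D' a.2)).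
Local Notation Te a b := (bmap T (e1 a b) (e2 a b)).
Local Notation Fe a b := (bmap F (e1 a b) (e2 a b)).

Definition tcoef (a b : I) (h : hom (TT a) (TT b)) : K := sval (cid (T_homP h)).

Lemma tcoefE (a b : I) (h : hom (TT a) (TT b)) : h = tcoef h *: Te a b.
Proof. exact: svalP (cid (T_homP h)). Qed.

(** The extension of [F] on the simple objects of [P], where a morphism is a scalar. *)
Definition psi (a b : I) (h : hom (TT a) (TT b)) : hom (FF a) (FF b) :=
  tcoef h *: Fe a b.

Lemma Fe_ne (a b : I) : a != b -> Fe a b = 0.
Proof.
case: a b => [a a'] [b b'] /=; rewrite xpair_eqE negb_and => /orP[] ne.
  by rewrite (eirr_ne ne) bmap0l.
by rewrite (eirr_ne ne) bmap0r.
Qed.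

Lemma psiE (a b : I) (h : hom (TT a) (TT b)) c : h = c *: Te a b -> psi h = c *: Fe a b.
Proof.
rewrite /psi; have [e|/Fe_ne->] := eqVneq a b; last by rewrite !scaler0.
case: _ / e h => h; rewrite {1}(tcoefE h) => /eqP; rewrite -subr_eq0 -scalerBl scaler_eq0.
rewrite !eirr_id !bmap1 (negPf (simple_id_neq0 (T_simple a))) orbF subr_eq0.
by move=> /eqP->.
Qed.

Lemma psi_linear (a b : I) : linear (@psi a b).
Proof.
move=> c f g; rewrite [in RHS]/psi scalerA -scalerDl; apply: psiE.
by rewrite scalerDl -scalerA -!tcoefE.
Qed.

Lemma psi1 (a : I) : psi (idm (TT a)) = idm (FF a).
Proof. by rewrite (@psiE _ _ _ 1) scale1r !eirr_id !bmap1. Qed.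

Lemma psiM (a b c : I) (g : hom (TT b) (TT c)) (f : hom (TT a) (TT b)) :
  psi (g \oc f) = psi g \oc psi f.
Proof.
have [e|ne] := eqVneq a b; last first.
  by rewrite (T_schur f ne) compm0 !(linear_zero (@psi_linear _ _)) compm0.
case: _ / e f g => f g; rewrite (tcoefE f) !eirr_id bmap1 compmZ hcompm1.
rewrite !(linear_scale _ _ (@psi_linear _ _)) psi1 compmZ.
by rewrite hcompm1.
Qed.

Lemma psi_bmap (a b : I) (f : hom (irr D a.1) (irr D b.1)) (g : hom (irr D' a.2) (irr D' b.2)) :
  psi (bmap T f g) = bmap F f g.
Proof.
rewrite (@psiE _ _ _ (coef f * coef g)).
  by rewrite {2}(coefE f) {2}(coefE g) bmapZl bmapZr scalerA.
by rewrite {1}(coefE f) {1}(coefE g) bmapZl bmapZr scalerA.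
Qed.

(* The functor extending [F] sends [Z] to the object assembled from the values of
   [F] along a decomposition of [Z] into products of simple objects; comparing
   parallel decompositions makes this independent of the choice. *)
Record parallel (Z : P) := Parallel {
  par_index : finType;
  par_irr : par_index -> I;
  par_obj : A;
  par_in : forall t, hom (TT (par_irr t)) Z;
  par_out : forall t, hom Z (TT (par_irr t));
  par_in' : forall t, hom (FF (par_irr t)) par_obj;
  par_out' : forall t, hom par_obj (FF (par_irr t));
  parP : @bisys _ P _ (fun t => TT (par_irr t)) Z par_in par_out;
  parP' : @bisys _ A _ (fun t => FF (par_irr t)) par_obj par_in' par_out'
}.

Arguments par_in {Z} _ _.
Arguments par_out {Z} _ _.
Arguments par_in' {Z} _ _.
Arguments par_out' {Z} _ _.

Definition par_map Z Z' (r : parallel Z) (r' : parallel Z') (f : hom Z Z') :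
    hom (par_obj r) (par_obj r') :=
  \sum_t \sum_t' (par_in' r' t' \oc
    (psi (par_out r' t' \oc (f \oc par_in r t)) \oc par_out' r t)).

Lemma par_map_entry Z Z' (r : parallel Z) (r' : parallel Z') (f : hom Z Z') t t' :
  par_out' r' t' \oc (par_map r r' f \oc par_in' r t) =
  psi (par_out r' t' \oc (f \oc par_in r t)).
Proof.
have [pi pi0 _] := parP' r; have [pi' pi0' _] := parP' r'.
rewrite /par_map comp_suml comp_sumr (bigD1 t) //= [X in _ + X]big1 ?addr0 => [|s ns].
  rewrite comp_suml comp_sumr (bigD1 t') //= [X in _ + X]big1 ?addr0 => [|s ns].
    by rewrite -!hcompA (comp_eq (pi' t')) pi hcomp1m hcompm1.
  by rewrite -!hcompA hcompA pi0' 1?eq_sym // comp0m.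
rewrite comp_suml comp_sumr big1 // => s' _.
by rewrite -!hcompA pi0 // !compm0.
Qed.

Lemma par_map_eq Z Z' (r : parallel Z) (r' : parallel Z') (f : hom Z Z') g :
  (forall t t', par_out' r' t' \oc (g \oc par_in' r t) =
     psi (par_out r' t' \oc (f \oc par_in r t))) -> par_map r r' f = g.
Proof.
by move=> e; apply: (bisys_ext (parP' r) (parP' r')) => t t'; rewrite par_map_entry e.
Qed.

Lemma par_map1 Z (r : parallel Z) : par_map r r (idm Z) = idm _.
Proof.
apply: par_map_eq => t t'; rewrite !hcomp1m.
have [pi pi0 _] := parP r; have [pi' pi0' _] := parP' r.
have [<-|ne] := eqVneq t t'; first by rewrite pi pi' psi1.
by rewrite pi0 1?eq_sym // pi0' 1?eq_sym // (linear_zero (@psi_linear _ _)).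
Qed.

Lemma par_mapM Z Z' Z'' (r : parallel Z) (r' : parallel Z') (r'' : parallel Z'')
    (g : hom Z' Z'') (f : hom Z Z') :
  par_map r r'' (g \oc f) = par_map r' r'' g \oc par_map r r' f.
Proof.
apply: par_map_eq => t t'; rewrite -hcompA hcompA (bisys_insert _ _ (parP' r')).
have -> : par_out r'' t' \oc (g \oc f \oc par_in r t) =
    (par_out r'' t' \oc g) \oc (f \oc par_in r t) by rewrite -!hcompA.
rewrite (bisys_insert _ _ (parP r')) (linear_sum _ _ _ (@psi_linear _ _)).
by apply: eq_bigr => s _; rewrite psiM -[X in psi X \oc _]hcompA -!par_map_entry -!hcompA.
Qed.

Lemma par_map_linear Z Z' (r : parallel Z) (r' : parallel Z') : linear (par_map r r').
Proof.
move=> c f g; apply: par_map_eq => t t'.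
by rewrite compDm compZm !(compmD, compmZ) !par_map_entry compDm compZm
  !(compmD, compmZ) psi_linear.
Qed.

Lemma parallel_exists Z : exists _ : parallel Z, True.
Proof.
have [n [a [u [v b]]]] := T_sysP Z; have [bip _ _ _ _] := abA.
have [S [i [p [pi pi0 ip]]]] := bip n (fun t => FF (a t)).
by exists (@Parallel Z 'I_n a S u v i p b (And3 pi pi0 ip)).
Qed.

Lemma extension_exists : exists G : lin_functor P A,
  exists a : forall X Y, hom (G (T X Y)) (F X Y),
    (forall X Y, is_iso (a X Y)) /\
    forall (X X' : D) (Y Y' : D') (f : hom X X') (g : hom Y Y'),
      a X' Y' \oc fmap G (bmap T f g) = bmap F f g \oc a X Y.
Proof.
have [r _] := dep_choice parallel_exists.
have [n nP] := choice (@irr_sysP K D); have [al alP] := dep_choice nP.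
have [u uP] := dep_choice alP; have [v vP] := dep_choice uP.
have [m mP] := choice (@irr_sysP K D'); have [be beP] := dep_choice mP.
have [w wP] := dep_choice beP; have [z zP] := dep_choice wP.
(* A product carries two parallel decompositions: the chosen one, which computes [G], and this one,
   assembled from its factors, whose object in [A] is [F X Y]. The identity of [T X Y] read between
   them is the required isomorphism. *)
pose st X Y : parallel (T X Y) := @Parallel _ _ (fun t => (al X t.1, be Y t.2)) (F X Y)
  _ _ _ _ (bisys_bmap T (vP X) (zP Y)) (bisys_bmap F (vP X) (zP Y)).
have stE X X' Y Y' (f : hom X X') (g : hom Y Y') :
    par_map (st X Y) (st X' Y') (bmap T f g) = bmap F f g.
  by apply: par_map_eq => t t' /=; rewrite -!bmapM psi_bmap.
pose G := @LinFunctor K P A (fun Z => par_obj (r Z)) (fun Z Z' f => par_map (r Z) (r Z') f)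
  (fun Z => par_map1 (r Z)) (fun Z Z' Z'' g f => par_mapM (r Z) (r Z') (r Z'') g f)
  (fun Z Z' => @par_map_linear Z Z' (r Z) (r Z')).
exists G, (fun X Y => par_map (r (T X Y)) (st X Y) (idm _)); split=> [X Y|X X' Y Y' f g].
  have e1 := par_mapM (r (T X Y)) (st X Y) (r (T X Y)) (idm _) (idm _).
  have e2 := par_mapM (st X Y) (r (T X Y)) (st X Y) (idm _) (idm _).
  rewrite hcomp1m par_map1 in e1; rewrite hcomp1m par_map1 in e2.
  by exists (par_map (st X Y) (r (T X Y)) (idm _)).
have e1 := par_mapM (r (T X Y)) (r (T X' Y')) (st X' Y') (idm _) (bmap T f g).
have e2 := par_mapM (r (T X Y)) (st X Y) (st X' Y') (bmap T f g) (idm _).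
by rewrite hcomp1m in e1; rewrite hcompm1 stE in e2; rewrite -e1 e2.
Qed.

End Existence.
End Extension.

Lemma bifunctor_deligne_universal : deligne_universal T.
Proof.
split=> [|A abA]; first exact: fusion_biright_exact.
split=> [F _|G G' _ _ a aT]; last exact: extension_unique.
have [G [a [isoa nat]]] := extension_exists abA F.
by exists G; split; [exact: fusion_right_exact|exists a].
Qed.

End Universality.

(** * The interchange of middle factors *)

Section Middle.
Context {K : fieldType} {C : braided_fusion K}.
Implicit Types V W X Y Z : C.

Lemma associ_nat X X' Y Y' Z Z' (f : hom X X') (g : hom Y Y') (h : hom Z Z') :
  associ X' Y' Z' \oc (f \otm (g \otm h)) = ((f \otm g) \otm h) \oc associ X Y Z.
Proof. exact: conj_inv (assocK _ _ _) (assocK _ _ _) (assoc_nat _ _ _). Qed.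

Lemma cw_otm X X' Y Y' W W' (f : hom X X') (g : hom Y Y') (h : hom W W') :
  cw X' Y' W' \oc (f \otm (g \otm h)) = (g \otm (f \otm h)) \oc cw X Y W.
Proof.
rewrite !cwE -!hcompA associ_nat -(comp_eq2 (assoc_nat _ _ _)).
rewrite [in LHS](comp_eq (h := (braid X' Y' \oc (f \otm g)) \otm h)); last first.
  by rewrite -[in RHS](hcomp1m h) bmapM.
rewrite [in RHS](comp_eq (h := ((g \otm f) \oc braid X Y) \otm h)); last first.
  by rewrite -[in RHS](hcompm1 h) bmapM.
by rewrite braid_nat.
Qed.

Lemma lunit_munit_lw X : munit \lw lunit X = lunit (munit \ot X).
Proof.
by apply: (iso_mono (f := lunit X)); [exists (luniti X); apply: lunitK|rewrite lunit_lw].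
Qed.

Lemma cw_mod X Y V W : (Y \lw assoc X V W) \oc (assoc Y (X \ot V) W \oc (cw X Y V \rw W)) =
  cw X Y (V \ot W) \oc ((X \lw assoc Y V W) \oc assoc X (Y \ot V) W).
Proof.
apply: (iso_epi (is_iso_rw W (is_iso_assoc X Y V))).
rewrite -!hcompA -pentagonw -rwM -cw_assoc rwM.
rewrite (comp_eq3 (esym (pentagonw Y X V W))) -!hcompA assoc_rw.
by rewrite (comp_eq (cw_assoc _ _ _)) -!hcompA.
Qed.

Lemma assoc_associ_rw X Y Z W : assoc (X \ot Y) Z W \oc (associ X Y Z \rw W) =
  associ X Y (Z \ot W) \oc ((X \lw assoc Y Z W) \oc assoc X (Y \ot Z) W).
Proof.
apply: (iso_epi (is_iso_rw W (is_iso_assoc X Y Z))).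
rewrite -!hcompA -rwM associE rw1 hcompm1 -pentagonw.
by rewrite (comp_eq (associE _ _ _)) hcomp1m.
Qed.

Definition mid X X' Y Y' : hom ((X \ot Y) \ot (X' \ot Y')) ((X \ot X') \ot (Y \ot Y')) :=
  locked_with strict_key
    (associ X X' (Y \ot Y') \oc ((X \lw cw Y X' Y') \oc assoc X Y (X' \ot Y'))).
Lemma midE X X' Y Y' : mid X X' Y Y' =
  associ X X' (Y \ot Y') \oc ((X \lw cw Y X' Y') \oc assoc X Y (X' \ot Y')).
Proof. by rewrite /mid unlock. Qed.

Lemma assoc_mid X X' Y Y' : assoc X X' (Y \ot Y') \oc mid X X' Y Y' =
  (X \lw cw Y X' Y') \oc assoc X Y (X' \ot Y').
Proof. by rewrite midE (comp_eq (assocE _ _ _)) hcomp1m. Qed.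

Lemma is_iso_mid X X' Y Y' : is_iso (mid X X' Y Y').
Proof.
rewrite midE; apply: is_iso_comp (is_iso_associ _ _ _) _.
by apply: is_iso_comp (is_iso_assoc _ _ _); apply/is_iso_lw/is_iso_cw.
Qed.

Lemma mid_nat X1 X2 X1' X2' Y1 Y2 Y1' Y2' (f : hom X1 X2) (f' : hom X1' X2')
    (g : hom Y1 Y2) (g' : hom Y1' Y2') :
  ((f \otm f') \otm (g \otm g')) \oc mid X1 X1' Y1 Y1' =
  mid X2 X2' Y2 Y2' \oc ((f \otm g) \otm (f' \otm g')).
Proof.
rewrite !midE -!hcompA assoc_nat (comp_eq2 (esym (associ_nat _ _ _))).
congr (_ \oc _); rewrite /lwhisk !hcompA -!bmapM hcomp1m hcompm1.
by rewrite cw_otm.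
Qed.

Lemma mid_mod X X' Y Y' W :
  assoc X X' (Y \ot (Y' \ot W)) \oc (((X \ot X') \lw assoc Y Y' W) \oc
    (assoc (X \ot X') (Y \ot Y') W \oc (mid X X' Y Y' \rw W))) =
  (X \lw cw Y X' (Y' \ot W)) \oc (assoc X Y (X' \ot (Y' \ot W)) \oc
    (((X \ot Y) \lw assoc X' Y' W) \oc assoc (X \ot Y) (X' \ot Y') W)).
Proof.
rewrite (comp_eq2 (assoc_lw _ _ _)) midE !rwM (comp_eq (assoc_associ_rw _ _ _ _)).
rewrite -!hcompA (comp_eq (assocE _ _ _)) hcomp1m (comp_eq2 (assoc_mw _ _ _)).
have e : (X \lw (X' \lw assoc Y Y' W)) \oc ((X \lw assoc X' (Y \ot Y') W) \oc
    (X \lw (cw Y X' Y' \rw W))) = (X \lw cw Y X' (Y' \ot W)) \oc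
    ((X \lw (Y \lw assoc X' Y' W)) \oc (X \lw assoc Y (X' \ot Y') W)).
  by rewrite -!lwM cw_mod.
rewrite (comp_eq3 e) -!hcompA -pentagonw -(comp_eq2 (assoc_lw _ _ _)).
by [].
Qed.

Lemma mid_assoc X1 X2 X3 Y1 Y2 Y3 :
  (assoc X1 X2 X3 \otm assoc Y1 Y2 Y3) \oc mid (X1 \ot X2) X3 (Y1 \ot Y2) Y3
    \oc (mid X1 X2 Y1 Y2 \otm idm (X3 \ot Y3)) =
  mid X1 (X2 \ot X3) Y1 (Y2 \ot Y3) \oc (idm (X1 \ot Y1) \otm mid X2 X3 Y2 Y3)
    \oc assoc (X1 \ot Y1) (X2 \ot Y2) (X3 \ot Y3).
Proof.
rewrite -/(rwhisk _ _) -/(lwhisk _ _) -!hcompA.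
apply: (iso_mono (is_iso_assoc X1 (X2 \ot X3) (Y1 \ot (Y2 \ot Y3)))).
apply: (iso_mono (is_iso_lw X1 (is_iso_assoc X2 X3 (Y1 \ot (Y2 \ot Y3))))).
rewrite otmE -!hcompA (comp_eq3 (esym (pentagonw _ _ _ _))) -!hcompA.
rewrite (comp_eq2 (assoc_lw _ _ _)) (comp_eq (assoc_mid _ _ _ _)) -!hcompA.
have e1 : ((X1 \ot X2) \lw (X3 \lw assoc Y1 Y2 Y3)) \oc ((X1 \ot X2) \lw cw (Y1 \ot Y2) X3 Y3) =
    ((X1 \ot X2) \lw (cw Y1 X3 (Y2 \ot Y3) \oc (Y1 \lw cw Y2 X3 Y3))) \oc
    ((X1 \ot X2) \lw assoc Y1 Y2 (X3 \ot Y3)).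
  by rewrite -!lwM cw_hex2 hcompA.
rewrite (comp_eq e1) -!hcompA (comp_eq2 (assoc_lw _ _ _)) mid_mod.
rewrite (comp_eq (assoc_mid _ _ _ _)) -!hcompA.
have e2 : (X1 \lw assoc X2 X3 (Y1 \ot (Y2 \ot Y3))) \oc (X1 \lw cw Y1 (X2 \ot X3) (Y2 \ot Y3)) =
   (X1 \lw ((X2 \lw cw Y1 X3 (Y2 \ot Y3)) \oc cw Y1 X2 (X3 \ot (Y2 \ot Y3)))) \oc
   (X1 \lw (Y1 \lw assoc X2 X3 (Y2 \ot Y3))).
  by rewrite -!lwM cw_hex1 hcompA.
rewrite (comp_eq e2) -!hcompA -(comp_eq2 (assoc_lw _ _ _)).
have e3 : ((X1 \ot Y1) \lw assoc X2 X3 (Y2 \ot Y3)) \oc ((X1 \ot Y1) \lw mid X2 X3 Y2 Y3) =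
   ((X1 \ot Y1) \lw (X2 \lw cw Y2 X3 Y3)) \oc ((X1 \ot Y1) \lw assoc X2 Y2 (X3 \ot Y3)).
  by rewrite -!lwM assoc_mid.
rewrite (comp_eq e3) -!hcompA !(comp_eq2 (assoc_lw _ _ _)).
rewrite !hcompA; do 3 congr (_ \oc _); rewrite -!lwM; congr (_ \lw _).
by rewrite lwM -!hcompA cw_nat.
Qed.

Lemma mid_lunit X Y : (lunit X \otm lunit Y) \oc mid munit X munit Y
  \oc (luniti munit \otm idm (X \ot Y)) = lunit (X \ot Y).
Proof.
rewrite -/(rwhisk _ _) midE otmE -!hcompA -(comp_eq2 (associ_lw _ _ _)).
have e : (munit \lw (X \lw lunit Y)) \oc (munit \lw cw munit X Y) =
    munit \lw lunit (X \ot Y) by rewrite -lwM cw_lunit.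
rewrite (comp_eq e) lunit_munit_lw (comp_eq (lunit_assoc _ _)) -rwM lunitE rw1 hcompm1.
by rewrite -lunit_assoc -hcompA assocE hcompm1.
Qed.

Lemma mid_runit X Y : (runit X \otm runit Y) \oc mid X munit Y munit
  \oc (idm (X \ot Y) \otm luniti munit) = runit (X \ot Y).
Proof.
rewrite -/(lwhisk _ _) midE otmE -!hcompA -(comp_eq2 (associ_lw _ _ _)) assoc_lw.
rewrite -trianglew -!hcompA (comp_eq (assocE _ _ _)) hcomp1m.
have e : (X \lw lunit Y) \oc ((X \lw (munit \lw runit Y)) \oc ((X \lw cw Y munit munit) \oc
    (X \lw (Y \lw luniti munit)))) = X \lw runit Y.
  rewrite -!lwM; congr (_ \lw _); rewrite (comp_eq2 (lunit_lw _)) (comp_eq (lunit_cw _ _)).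
  by rewrite -lwM lunitE lw1 hcompm1.
by rewrite (comp_eq4 e) runit_assoc.
Qed.

(** Braiding the two products also crosses [X] with [Y'], and [mid] on the right crosses them back;
    [triv] cancels the pair. *)
Lemma mid_braid X X' Y Y' : braid Y' X \oc braid X Y' = idm (X \ot Y') ->
  (braid X X' \otm braid Y Y') \oc mid X X' Y Y' =
  mid X' X Y' Y \oc braid (X \ot Y) (X' \ot Y').
Proof.
move=> triv.
have cwK : cw Y' X Y \oc cw X Y' Y = idm _.
  apply: (iso_epi (is_iso_assoc X Y' Y)).
  by rewrite -hcompA -cw_assoc (comp_eq2 (esym (cw_assoc _ _ _))) -rwM triv rw1 hcompm1 hcomp1m.
apply: (iso_mono (is_iso_assoc X' X (Y' \ot Y))).
rewrite (comp_eq (assoc_mid _ _ _ _)) -hcompA otmE.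
have e1 : assoc X' Y' (X \ot Y) \oc braid (X \ot Y) (X' \ot Y') =
    (X' \lw braid (X \ot Y) Y') \oc cw (X \ot Y) X' Y'.
  apply: (iso_epi (is_iso_assoc (X \ot Y) X' Y')).
  by rewrite hexagon1 -!hcompA cw_assoc.
have e2 : braid (X \ot Y) Y' = cw X Y' Y \oc ((X \lw braid Y Y') \oc assoc X Y Y').
  apply: (iso_mono (is_iso_associ Y' X Y)); apply: (iso_epi (is_iso_associ X Y Y')).
  rewrite hexagon2 cwE -!hcompA (comp_eq (associE _ _ _)) hcomp1m assocE hcompm1.
  by [].
rewrite e1 e2 !lwM -!hcompA cw_hex2 (comp_eq (h := idm _)); last by rewrite -lwM cwK lw1.
rewrite hcomp1m (comp_eq (cw_assoc _ _ _)) -!hcompA (comp_eq2 (assoc_lw _ _ _)) assoc_mid.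
by rewrite (comp_eq2 (cw_nat _ _ _)).
Qed.

End Middle.

(** * The decomposition *)

Section PointedPart.
Context {R : realType} {K : numClosedFieldType} {C : fusion K}.
Local Notation I := 'I_(rank C).
Variable phi : I -> R.
Hypothesis phi_gt0 : forall a, 0 < phi a.
Hypothesis phiM : forall a b, phi a * phi b = \sum_c (Nf a b c)%:R * phi c.

Let phi_ge0 a : 0 <= phi a := ltW (phi_gt0 a).

Lemma phi_unit : phi iunit = 1.
Proof.
have := phiM iunit iunit; rewrite (bigD1 iunit) //= Nf1l eqxx mul1r big1 ?addr0 => [|k nk].
  by rewrite -[RHS]mulr1 => /mulfI; apply; rewrite gt_eqF.
by rewrite Nf1l eq_sym (negPf nk) mul0r.
Qed.

(** Multiplication by the dual is the transpose of multiplication by [i], and [phi] is an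
    eigenvector of both. *)
Lemma phi_dual i : phi (idual i) = phi i.
Proof.
have sq : \sum_j phi j * phi j != 0.
  by rewrite (bigD1 i) //= gt_eqF // ltr_pwDl ?mulr_gt0 // sumr_ge0 // => j _; rewrite mulr_ge0 ?ltW.
apply: (mulIf sq); rewrite !mulr_sumr.
transitivity (\sum_k \sum_j (Nf i j k)%:R * (phi j * phi k)).
  apply: eq_bigr => k _; rewrite mulrA phiM mulr_suml; apply: eq_bigr => j _.
  by rewrite -Nf_dual mulrA.
rewrite exchange_big; apply: eq_bigr => j _ /=; rewrite mulrA phiM mulr_suml.
by apply: eq_bigr => k _; rewrite [phi j * _]mulrC mulrA.
Qed.

Lemma Nf_phi_le i j k : (0 < Nf i j k)%N -> phi k <= phi i * phi j.
Proof.
move=> N0; rewrite phiM (bigD1 k) //= ler_wpDr //.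
  by apply: sumr_ge0 => l _; rewrite mulr_ge0.
by rewrite ler_peMl // ler1n.
Qed.

Lemma Nf_dual_unit (i : I) : Nf i (idual i) iunit = 1%N.
Proof. by rewrite Nf_unit eqxx. Qed.

Lemma Nf_unit_dual (i : I) : Nf (idual i) i iunit = 1%N.
Proof. by rewrite -Nf_dual Nf1r eqxx. Qed.

Lemma phi_ge1 i : 1 <= phi i.
Proof.
have : phi iunit <= phi i * phi (idual i) by rewrite Nf_phi_le // Nf_dual_unit.
by rewrite phi_unit phi_dual -expr2 expr_ge1.
Qed.

Lemma phi1_mul i j k : phi i = 1 -> phi j = 1 -> (0 < Nf i j k)%N -> phi k = 1.
Proof.
move=> i1 j1 /Nf_phi_le; rewrite i1 j1 mul1r => le1; apply/eqP.
by rewrite eq_le le1 phi_ge1.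
Qed.

Lemma phi1_unit i j : phi i = 1 -> phi j = 1 -> (0 < Nf i j iunit)%N ->
  forall k, Nf i j k = (k == iunit).
Proof.
move=> i1 j1 N0 k; have := phiM i j; rewrite i1 j1 mul1r (bigD1 iunit) //= phi_unit mulr1.
move=> e.
have rest : \sum_(c | c != iunit) (Nf i j c)%:R * phi c = 0.
  apply/eqP; rewrite eq_le; apply/andP; split.
    have : (1 : R) <= (Nf i j iunit)%:R by rewrite ler1n.
    by rewrite {1}e -subr_ge0 opprD addrA subrr sub0r oppr_ge0.
  by apply: sumr_ge0 => c _; rewrite mulr_ge0 .
have [->|nk] := eqVneq k iunit.
  have e' : (Nf i j iunit)%:R = 1 :> R by rewrite [RHS]e rest addr0.
  by apply/eqP; rewrite -(eqr_nat R) e'.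
move/eqP: rest; rewrite psumr_eq0 => [/allP/(_ k)|c _]; last by rewrite mulr_ge0 .
rewrite mem_index_enum nk /= mulf_eq0 pnatr_eq0 (gt_eqF (phi_gt0 k)) orbF.
by move=> /(_ isT)/eqP.
Qed.

Lemma phi1_invertible i X : isomorphic X (irr C i) -> phi i = 1 -> invertible X.
Proof.
move=> iso i1; have d1 : phi (idual i) = 1 by rewrite phi_dual.
by apply: (invertible_irr iso); apply: phi1_unit => //; rewrite ?Nf_dual_unit ?Nf_unit_dual.
Qed.

Lemma invertible_phi1 i X : isomorphic X (irr C i) -> invertible X -> phi i = 1.
Proof.
move=> iso [ev _].
have iso1 : isomorphic (irr C (idual i) \ot irr C i) (irr C iunit).
  apply: iso_trans iunitP; apply: iso_trans (ex_intro _ _ ev).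
  by apply: iso_otm; apply: iso_sym => //; apply: iso_ldual.
have := phiM (idual i) i; rewrite (bigD1 iunit) //= big1 => [|k nk].
  rewrite /Nf (mult_iso _ iso1) mult_irr eqxx mul1r phi_unit addr0 phi_dual => /eqP.
  by rewrite -expr2 sqrp_eq1 ?ltW // => /eqP.
by rewrite /Nf (mult_iso _ iso1) mult_irr eq_sym (negPf nk) mul0r.
Qed.

(** The objects supported on simple objects of dimension 1 form a fusion subcategory containing all
    invertible simple objects, which bounds the generated one from above. *)
Lemma pt_subcat_irr i : @pt_subcat K C (irr C i) <-> phi i = 1.
Proof.
split=> [h|i1 E _ inv]; last first.
  by apply: inv (irr_simple i) _; apply: phi1_invertible i1; apply: iso_refl.
have /supported_irr/eqP-> // : supported [pred k | phi k == 1] (irr C i).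
apply: h => [|Y /irr_surj[k iso] invY].
  apply: supported_fusion_subcat => [|k|a b c] /=; first by rewrite phi_unit.
    by rewrite phi_dual.
  by move=> /eqP a1 /eqP b1 /(phi1_mul a1 b1)->.
apply: supported_iso (iso_sym iso) _; apply/supported_irr => /=.
by apply/eqP/(invertible_phi1 iso).
Qed.

Lemma FPdim_pt : FPdim_sub R (@pt_subcat K C) = #|[pred i | phi i == 1]|%:R.
Proof.
rewrite /FPdim_sub -sum1_card natr_sum; apply: eq_big => i.
  by apply/asboolP/eqP => /pt_subcat_irr.
by move=> /asboolP/pt_subcat_irr i1; rewrite (FPdimE phi_gt0 phiM) i1 expr1n.
Qed.

End PointedPart.

Section SubcategoryProduct.
Context {K : numClosedFieldType} {C : braided_fusion K}.
Local Notation I := 'I_(rank C).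

Lemma centralize_supported (J J' : pred I) :
  (forall i j, J i -> J' j ->
    braid (irr C j) (irr C i) \oc braid (irr C i) (irr C j) = idm _) ->
  forall X Y, supported J X -> supported J' Y -> braid Y X \oc braid X Y = idm (X \ot Y).
Proof.
move=> cen X Y hX hY.
have [n [a [u [v bX]]]] := irr_sysP X; have [m [b [w [z bY]]]] := irr_sysP Y.
have Ja t : J (a t).
  by apply: hX; rewrite (mult_sys bX); apply/card_gt0P; exists t; rewrite inE.
have Jb t : J' (b t).
  by apply: hY; rewrite (mult_sys bY); apply/card_gt0P; exists t; rewrite inE.
have B := bisys_bmap (tens C) bX bY; have [_ _ <-] := B.
rewrite {1}(bisys_expandr (braid Y X \oc braid X Y) B); apply: eq_bigr => t _.
by rewrite -[_ \oc braid X Y \oc _]hcompA braid_nat [braid Y X \oc _]hcompA braid_nat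
  -[_ \oc braid _ _ \oc braid _ _]hcompA cen ?hcompm1.
Qed.

Variables J J' : pred I.
Hypothesis J1 : J iunit.
Hypothesis Jdual : forall i, J i -> J (idual i).
Hypothesis JN : forall i j k, J i -> J j -> (0 < Nf i j k)%N -> J k.
Hypothesis J'1 : J' iunit.
Hypothesis J'dual : forall i, J' i -> J' (idual i).
Hypothesis J'N : forall i j k, J' i -> J' j -> (0 < Nf i j k)%N -> J' k.
Local Notation D := (sub_braided J1 Jdual JN).
Local Notation D' := (sub_braided J'1 J'dual J'N).

Definition sub_product : bifunctor D D' C := @Bifunctor K D D' C
  (fun X Y => sval X \ot sval Y)
  (fun X X' Y Y' => @bmap K C C C (tens C) (sval X) (sval X') (sval Y) (sval Y'))
  (fun X Y => bmap1 _ (sval X) (sval Y))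
  (fun X X' X'' Y Y' Y'' => @bmapM K C C C (tens C) (sval X) (sval X') (sval X'')
     (sval Y) (sval Y') (sval Y''))
  (fun X X' Y Y' g => @bmap_linearl K _ _ _ _ (sval X) (sval X') (sval Y) (sval Y') g)
  (fun X X' Y Y' f => @bmap_linearr K _ _ _ _ (sval X) (sval X') (sval Y) (sval Y') f).

Hypothesis cen : forall i j, J i -> J' j ->
  braid (irr C j) (irr C i) \oc braid (irr C i) (irr C j) = idm _.
Hypothesis prod_simple : forall i j, J i -> J' j -> simple (irr C i \ot irr C j).
Hypothesis prod_inj : forall i j i' j', J i -> J' j -> J i' -> J' j' ->
  isomorphic (irr C i \ot irr C j) (irr C i' \ot irr C j') -> i = i' /\ j = j'.
Hypothesis prod_surj : forall k, exists i j,
  [/\ J i, J' j & isomorphic (irr C k) (irr C i \ot irr C j)].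

Lemma sub_deligne_product : is_deligne_product D D' C.
Proof.
exists sub_product; split.
  apply: bifunctor_deligne_universal.
  - move=> [i j]; exact: prod_simple (enum_valP i) (enum_valP j).
  - move=> [i j] [i' j'] iso.
    have [e e'] := prod_inj (enum_valP i) (enum_valP j) (enum_valP i') (enum_valP j') iso.
    by rewrite (enum_val_inj e) (enum_val_inj e').
  - move=> k; have [i [j [Ji Jj iso]]] := prod_surj k.
    exists (enum_rank_in Ji i, enum_rank_in (Jj : j \in J') j).
    by rewrite /= !enum_rankK_in.
exists (fun X X' Y Y' => mid (sval X) (sval X') (sval Y) (sval Y')), (luniti munit).
split.
- split=> [X X' Y Y'|]; first exact: is_iso_mid.
  by exists (lunit munit); apply/inverse_sym/lunitK.
- move=> X1 X2 X1' X2' Y1 Y2 Y1' Y2' f f' g g'; exact: mid_nat.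
- move=> X1 X2 X3 Y1 Y2 Y3; exact: mid_assoc.
- by move=> X Y; split; [exact: mid_lunit|exact: mid_runit].
- move=> X X' Y Y'; apply: mid_braid.
  exact: centralize_supported cen _ _ (svalP X) (svalP Y').
Qed.

End SubcategoryProduct.

Lemma braided_equivalent_refl (K : fieldType) (C : braided_fusion K) : braided_equivalent C C.
Proof.
exists (@LinFunctor K C C id (fun X Y => id) (fun X => erefl) (fun X Y Z g f => erefl)
  (fun X Y a f g => erefl)); split.
  by split=> [X Y|Z]; [exists id|exists Z; apply: iso_refl].
exists (fun X Y => idm _), (idm _); split=> [|X X' Y Y' f g|X Y Z|X|X Y] /=.
- by split=> [X Y|]; apply: is_iso_id.
- by rewrite hcompm1 hcomp1m.
- by rewrite !bmap1 !hcompm1 hcomp1m.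
- by rewrite !bmap1 !hcompm1.
- by rewrite hcompm1 hcomp1m.
Qed.

Section Decomposition.
Context {K : numClosedFieldType} {C : modular K}.
Local Notation I := 'I_(rank C).
Local Notation chi := (@mchi K C).
Local Notation S := (S_mx (@twist K C)).

Variables A B : pred I.
Hypothesis Ao : A iunit.
Hypothesis Adual : forall i, A i -> A (idual i).
Hypothesis AN : forall i j k, A i -> A j -> (0 < Nf i j k)%N -> A k.
Hypothesis Bo : B iunit.
Hypothesis Bdual : forall i, B i -> B (idual i).
Hypothesis BN : forall i j k, B i -> B j -> (0 < Nf i j k)%N -> B k.
Hypothesis AB : forall g j, A g -> B j -> chi j g / chi iunit g = 1.
Hypothesis Amul : forall g j, A g -> exists k, forall k', Nf g j k' = (k' == k).
Hypothesis AB_surj : forall i, exists g j, [/\ A g, B j & Nf g j i = 1%N].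
Hypothesis AB_inj : forall g j g' j' i, A g -> B j -> A g' -> B j' ->
  (0 < Nf g j i)%N -> (0 < Nf g' j' i)%N -> g = g' /\ j = j'.

Lemma centralize_chi g j : A g -> B j -> chi j g = chi iunit g.
Proof. by move=> Ag Bj; apply: divr1_eq; apply: AB. Qed.

Lemma prod_iso g j : A g -> exists2 k, isomorphic (irr C g \ot irr C j) (irr C k) & Nf g j k = 1%N.
Proof.
move=> Ag; have [k kP] := Amul j Ag; exists k; last by rewrite kP eqxx.
exact: mult_unique_iso.
Qed.

Lemma factor_iso i : exists g j, [/\ A g, B j & isomorphic (irr C g \ot irr C j) (irr C i)].
Proof.
have [g [j [Ag Bj Ni]]] := AB_surj i; exists g, j; split=> //.
have [k kP] := Amul j Ag; have := kP i; rewrite Ni.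
by case: eqP => // -> _; apply: mult_unique_iso.
Qed.

Lemma chi_factor i g j k : isomorphic (irr C g \ot irr C j) (irr C k) ->
  chi i k = chi i g * chi i j.
Proof. by move=> iso; rewrite /mchi -(hch_iso i iso) hch_tens. Qed.

(** Write [k] as a product of [g] in [A] and [y] in [B]. The characters of [A] take on [y] its
    dimension, so column [k] is a multiple of column [g] on [A]. *)
Lemma A_nondegenerate k : exists2 g, A g & exists c, forall j, A j -> S j k = c * S j g.
Proof.
have [g [y [Ag By iso]]] := factor_iso k; exists g => //; exists (chi iunit y) => h Ah.
rewrite !SE (chi_factor h iso); suff -> : chi h y = chi iunit y by ring.
apply: (mulIf (mchi_o_neq0 h)); rewrite mchi_sym (centralize_chi Ah By).
exact: mulrC.
Qed.

Lemma B_nondegenerate k : exists2 y, B y & exists c, forall j, B j -> S j k = c * S j y.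
Proof.
have [g [y [Ag By iso]]] := factor_iso k; exists y => //; exists (chi iunit g) => z Bz.
by rewrite !SE (chi_factor z iso) (centralize_chi Ag Bz); ring.
Qed.

Local Notation D := (sub_modular Ao Adual AN A_nondegenerate).
Local Notation D' := (sub_modular Bo Bdual BN B_nondegenerate).

Lemma decomposition : is_deligne_product D D' C.
Proof.
apply: sub_deligne_product.
- move=> g j Ag Bj; have [k iso _] := prod_iso j Ag.
  by have [-> _] := braid_scalar iso; rewrite AB // scale1r.
- move=> g j Ag Bj; have [k iso _] := prod_iso j Ag.
  exact: simple_iso (iso_sym iso) (irr_simple k).
- move=> g j g' j' Ag Bj Ag' Bj' iso.
  have [k _ Nk] := prod_iso j Ag.
  apply: (@AB_inj g j g' j' k) => //; first by rewrite Nk.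
  by rewrite /Nf -(mult_iso k iso) -/(Nf _ _ _) Nk.
- by move=> k; have [g [j [Ag Bj iso]]] := factor_iso k; exists g, j; split=> //; apply: iso_sym.
Qed.

End Decomposition.

Section ComplexDimension.
Context {R : realType} {C : modular (complex R : numClosedFieldType)}.
Local Notation I := 'I_(rank C).
Variable i0 : I.
Hypothesis chi_gt0 : forall l, 0 < mchi i0 l.

(** Positive elements of [complex R] are real, so no information is lost, and [FPdimE] asks for a
    character with values in [R]. *)
Definition chidim (i : I) : R := complex.Re (mchi i0 i).

Lemma chidimE i : (chidim i)%:C%C = mchi i0 i.
Proof. exact: RRe_real (gtr0_real (chi_gt0 i)). Qed.

Lemma chidim_gt0 i : 0 < chidim i.
Proof. by rewrite -ltcR chidimE chi_gt0. Qed.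

Lemma chidimM i j : chidim i * chidim j = \sum_k (Nf i j k)%:R * chidim k.
Proof.
apply: complexI; rewrite rmorphM rmorph_sum /= !chidimE [LHS]hchM; apply: eq_bigr => k _.
by rewrite rmorphM rmorph_nat /= chidimE.
Qed.

Lemma chidim_eq1 i : (chidim i == 1) = (mchi i0 i == 1).
Proof. by rewrite -chidimE -(inj_eq (@complexI R)). Qed.

Lemma chidim_sum (P : pred I) : ((\sum_(i | P i) chidim i ^+ 2)%:C)%C = \sum_(i | P i) mchi i0 i ^+ 2.
Proof. by rewrite rmorph_sum; apply: eq_bigr => i _; rewrite rmorphXn /= chidimE. Qed.

Lemma chidim_sum_nat (P : pred I) n :
  (\sum_(i | P i) mchi i0 i ^+ 2 = n%:R) <-> (\sum_(i | P i) chidim i ^+ 2 = n%:R).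
Proof.
by rewrite -chidim_sum -(rmorph_nat (real_complex R)); split=> [/complexI|->].
Qed.

End ComplexDimension.

Lemma modular_decomposition (R : realType) (C : modular (complex R : numClosedFieldType))
    (d m : nat) :
  FPdim_cat R C = (d * m)%:R -> square_free d -> coprime d m ->
  (forall X : C, simple X ->
     forall k : nat, FPdim R X ^+ 2 = k%:R -> coprime d k) ->
  (exists k : nat, FPdim_sub R (@pt_subcat _ C) = (d * k)%:R) /\
  (exists D D' : modular (complex R : numClosedFieldType),
     [/\ pointed D, FPdim_cat R D = d%:R, FPdim_cat R D' = m%:R
       & is_deligne_product D D' C]).
Proof.
move=> dimC sqd cop copX; pose K : numClosedFieldType := complex R.
have [i0 pos] := positive_chi (@Nf1l K C) (@NfC K C) (@Nf_dual K C) (@mchi1 K C)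
  (@hchM K C) (@mchi_inj K C).
have FPE := FPdimE (chidim_gt0 pos) (chidimM pos).
have sum_dm : \sum_l mchi i0 l ^+ 2 = (d * m)%:R.
  apply/(chidim_sum_nat pos xpredT); rewrite -dimC; apply: eq_bigr => l _.
  by rewrite FPE.
have cop_chi l k : mchi i0 l ^+ 2 = k%:R -> coprime d k.
  move=> e; apply: (copX _ (irr_simple l)); rewrite FPE.
  by apply: complexI; rewrite rmorphXn rmorph_nat /= chidimE.
have tw_fix g j : mchi i0 g = 1 -> Nf g j j = 1%N ->
    mtw g * (mchi j g / mchi iunit g) = 1.
  move=> g1 Njj.
  (* The product of [g] and [j] contains [j] and has its dimension, so it is [j]; the twist of [j]
     then cancels from the balancing equation. *)
  have : chidim i0 g * chidim i0 j = chidim i0 j.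
    by apply: complexI; rewrite rmorphM /= !chidimE // g1 mul1r.
  rewrite chidimM // (bigD1 j) //= Njj mul1r -[RHS]addr0 => /addrI/eqP.
  rewrite psumr_eq0 => [/allP z|k _]; last by rewrite mulr_ge0 // ltW ?chidim_gt0.
  have iso : isomorphic (irr C g \ot irr C j) (irr C j).
    apply: mult_unique_iso => k; have [->|nk] := eqVneq k j; first exact: Njj.
    have := z k (mem_index_enum _); rewrite nk /= mulf_eq0 pnatr_eq0.
    by rewrite (gt_eqF (chidim_gt0 pos k)) orbF => /eqP.
  have [_ e] := braid_scalar iso; apply: (mulIf (mtw_neq0 j)).
  by rewrite mul1r [RHS]e; ring.
have [dvd [A [B [[cA Ao As AN A1] [Bo Bs BN sB] AB Am [surj inj]]]]] :=
  modular_numbers (@Nf1l K C) (@NfC K C) (@Nf_dual K C) (@mchi1 K C) (@hchM K C)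
    (@mchi_sym K C) (@mchi_inj K C) (@mchi_o_neq0 K C) pos sum_dm sqd cop cop_chi tw_fix.
split.
  have [k e] := dvdnP dvd; exists k.
  rewrite (FPdim_pt (chidim_gt0 pos) (chidimM pos)) mulnC -e; congr (_%:R).
  by apply: eq_card => i; rewrite !inE chidim_eq1.
exists (sub_modular Ao As AN (A_nondegenerate AB Am surj)).
exists (sub_modular Bo Bs BN (B_nondegenerate AB Am surj)).
have A1' i : A i -> chidim i0 i = 1 by move=> /A1/eqP; rewrite -chidim_eq1 // => /eqP.
split.
- move=> X /sub_simple/irr_surj[i iso].
  apply: (phi1_invertible (chidim_gt0 pos) (chidimM pos) iso).
  by apply/A1'/supported_irr/(supported_iso iso)/svalP.
- rewrite (FPdim_cat_sub _ _ _ (chidim_gt0 pos) (chidimM pos)).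
  rewrite (eq_bigr (fun=> 1)) => [|i /A1'->]; last by rewrite expr1n.
  by rewrite sumr_const cA.
- rewrite (FPdim_cat_sub _ _ _ (chidim_gt0 pos) (chidimM pos)).
  exact/(chidim_sum_nat pos B).
- exact: decomposition.
Qed.

Theorem theorem1p21 (R : realType) (C : modular (complex R)) (d m : nat) :
  weakly_integral R C ->
  FPdim_cat R C = (d * m)%:R ->
  (0 < d)%N ->
  square_free d ->
  coprime d m ->
  (forall X : C, simple X ->
     forall k : nat, FPdim R X ^+ 2 = k%:R -> coprime d k) ->
  (exists k : nat, FPdim_sub R (@pt_subcat (complex R) C) = (d * k)%:R) /\
  (exists D D' : modular (complex R),
     [/\ pointed D,
         FPdim_cat R D = d%:R,
         FPdim_cat R D' = m%:R
       & exists P : braided_fusion (complex R),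
           is_deligne_product D D' P /\ braided_equivalent C P]).
Proof.
move=> _ dimC _ sqd cop copX.
have [pt [D [D' [pD dD dD' prod]]]] := @modular_decomposition R C d m dimC sqd cop copX.
split; first exact: pt.
exists D, D'; split=> //; exists C; split; [exact: prod|exact: braided_equivalent_refl].
Qed.
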